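(* Let $r>0$. There exist constants $C,\delta_0,\beta_*>0$ such that for every $\xi_*\in X$ with $\|\xi_*\|_X\le\delta_0$ and every $0<\beta<\beta_*$, the following estimates hold for $f:(0,\infty)\to\mathbb R$: $$\Bigl\|\bigl(F^*F+\tfrac12\overline{\xi_*}^2+\beta^2\bigr)^{-1}f\Bigr\|_{X_{\xi_*}}\le\frac{C}{\beta^{1-s}}\|\rho^sf\|_{L^2},\qquad 0\le s\le1,$$ $$\Bigl\|\bigl(F^*F+\tfrac12\overline{\xi_*}^2+\beta^2\bigr)^{-1}f\Bigr\|_{X_{\xi_*}}\le\frac{C}{\beta^{1+s}}\Bigl(\|\rho^{1-s}\partial_\rho f\|_{L^2}+\|\rho^{-s}f\|_{L^2}+\|\rho^{1-s}\overline{\xi_*}f\|_{L^2}\Bigr),\qquad 0<s\le1.$$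
   Context: $L^2$ denotes $L^2((0,\infty);\rho\,d\rho)$. $X$ is the space of $f:(0,\infty)\to\mathbb R$ with $\|f\|_X^2=\|\partial_\rho f\|_{L^2}^2+\|f/\rho\|_{L^2}^2<\infty$. Let $\theta(\rho)=\arccos\frac{\rho^2-4r^2}{\rho^2+4r^2}\in[0,\pi]$ and $$F=\partial_\rho+\frac{\cos\theta}{\rho}=\partial_\rho+\frac{\rho^2-4r^2}{\rho(\rho^2+4r^2)},$$ with $F^*$ the adjoint in $L^2$, so that $F^*F=-\partial_\rho^2-\frac1\rho\partial_\rho+\frac1{\rho^2}-\frac{32r^2}{(\rho^2+4r^2)^2}$. For $\xi_*\in X$ put $\overline{\xi_*}=\xi_*+\frac{4r}{(\rho^2+4r^2)^{1/2}}$ and $$\|f\|_{X_{\xi_*}}=\Bigl(\|f\|_X^2+\tfrac12\|\overline{\xi_*}f\|_{L^2}^2\Bigr)^{1/2}.$$ The operator $F^*F+\frac12\overline{\xi_*}^2+\beta^2$ is positive and hence invertible. The estimates are meant for $f$ for which the right-hand side is finite. *)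

(* Defs.v *)
From HB Require Import structures.
From mathcomp Require Import all_boot all_order all_algebra.
From mathcomp Require Import all_classical all_reals all_analysis.
Set Implicit Arguments.
Unset Strict Implicit.
Unset Printing Implicit Defensive.
Import Order.TTheory GRing.Theory Num.Theory.
Import numFieldNormedType.Exports.
Local Open Scope classical_set_scope.
Local Open Scope ring_scope.

(* A function (0,oo) -> R is represented by a total function R -> R whose
   values outside (0,oo) are never used; functions are identified when they
   agree almost everywhere on (0,oo). *)

Notation halfline R := (`]0%R, +oo[%classic : set R).

Section spaces.
Context {R : realType}.
Implicit Types f g h u v : R -> R.

Local Notation mu := (@lebesgue_measure R).

Definition ae_eq_halfline f g : Prop := {ae mu, forall x, 0 < x -> f x = g x}.

(* The norm of L^2((0,oo); x dx); it is +oo when f is not square integrable. *)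
Definition l2norm f : \bar R :=
  ((\int[mu]_(x in halfline R) ((f x) ^+ 2 * x)%:E) `^ 2^-1)%E.

(* g is the weak derivative of f on (0,oo): up to a null set, f is a locally
   absolutely continuous function whose derivative is g. *)
Definition is_wderiv f g : Prop :=
  [/\ measurable_fun (halfline R) f,
      locally_integrable (halfline R) g &
      exists f0 : R -> R, ae_eq_halfline f f0 /\
        forall a b : R, 0 < a -> a <= b ->
          (f0 b - f0 a)%:E = (\int[mu]_(x in `[a, b]) (g x)%:E)%E].

Definition wdifferentiable f : Prop := exists g, is_wderiv f g.

(* A weak derivative is unique up to a null set, so that the norms and integrals
   below do not depend on the choice. The value is 0 if there is none. *)
Definition wderiv f : R -> R := xget (cst 0) [set g | is_wderiv f g].

Definition Xnorm f : \bar R :=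
  ((l2norm (wderiv f) `^ 2 + l2norm (fun x => f x / x)%R `^ 2) `^ 2^-1)%E.

Definition in_X f : Prop := wdifferentiable f /\ (Xnorm f < +oo)%E.

Definition theta (r x : R) : R :=
  acos ((x ^+ 2 - 4 * r ^+ 2) / (x ^+ 2 + 4 * r ^+ 2)).

Definition opF (r : R) u : R -> R :=
  fun x : R => wderiv u x + cos (theta r x) / x * u x.

Definition xibar (r : R) (xi : R -> R) : R -> R :=
  fun x : R => xi x + 4 * r / Num.sqrt (x ^+ 2 + 4 * r ^+ 2).

Definition Xxinorm (r : R) (xi : R -> R) f : \bar R :=
  ((Xnorm f `^ 2 + 2^-1%:E * l2norm (fun x => xibar r xi x * f x)%R `^ 2)
     `^ 2^-1)%E.

Definition in_Xxi (r : R) (xi : R -> R) f : Prop :=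
  wdifferentiable f /\ (Xxinorm r xi f < +oo)%E.

Definition compactly_supported v : Prop :=
  exists a b : R, [/\ 0 < a, a <= b &
    forall x : R, 0 < x -> x \notin `[a, b] -> v x = 0].

(* F^* g = h, where F^* is the adjoint of F for the pairing
   (g, h) |-> \int g h x dx. On L^2 the maximal domain of F is X `&` L^2, and the
   elements of X with compact support in (0,oo) form a core of it, so testing on
   the latter gives the Hilbert space adjoint when g and h are in L^2. Compact
   support makes the definition meaningful also for g and h that are only locally
   square integrable: both integrands are then integrable. *)
Definition is_adjF (r : R) g h : Prop :=
  forall v, in_X v -> compactly_supported v ->
    (\int[mu]_(x in halfline R) (g x * opF r v x * x)%:E =
     \int[mu]_(x in halfline R) (h x * v x * x)%:E)%E.

(* (F^* F + xibar^2 / 2 + beta^2) u = f, with u in X_xi *)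
Definition solves (r : R) (xi : R -> R) (beta : R) f u : Prop :=
  in_Xxi r xi u /\
  is_adjF r (opF r u)
    (fun x : R => f x - (2^-1 * xibar r xi x ^+ 2 * u x + beta ^+ 2 * u x)).

(* u = (F^* F + xibar^2 / 2 + beta^2)^-1 f: u is the one solution. The right-hand
   side f is not assumed to be in L^2, so u need not be in L^2 either; for f in
   L^2 this is the inverse of the self-adjoint operator on L^2. *)
Definition is_inverse (r : R) (xi : R -> R) (beta : R) f u : Prop :=
  solves r xi beta f u /\
  forall u', solves r xi beta f u' -> ae_eq_halfline u' u.

End spaces.

(* Main.v *)
Require Import Defs.
From HB Require Import structures.
From mathcomp Require Import all_boot all_order all_algebra.
From mathcomp Require Import all_classical all_reals all_analysis.
From mathcomp Require Import measurable_realfun.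
From mathcomp Require Import ring lra.
Set Implicit Arguments.
Unset Strict Implicit.
Unset Printing Implicit Defensive.
Import Order.TTheory GRing.Theory Num.Theory.
Import numFieldNormedType.Exports.
Local Open Scope classical_set_scope.
Local Open Scope ring_scope.

(** Write xb for xi + 4r/(x^2+4r^2)^(1/2). Since cos(theta)' is explicit,
    |F u|^2 = |u'|^2 + |u/x|^2 - int V u^2 with V = 32r^2/(x^2+4r^2)^2, and V is
    dominated by xb^2 up to a small multiple of 1/x^2 when xi is small in X (hence
    in sup norm). So a(u,u) = |F u|^2 + 1/2 |xb u|^2 controls the norm of X_xi on
    compactly supported u, and the form a + beta^2 <.,.> is represented by
    minimising over such u and completing in L^2. Splitting the source as f1 + f2,
    with u = w + beta^-2 f2, gives
      |u|_{X_xi} <= C (beta^(s-1) |x^s f1| + beta^-2 |f2|_{X_xi}),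
    because x^(-2s) <= beta^(2s-2) (x^-2 + beta^2). The first estimate is the case
    f2 = 0; the second takes f2 = eta f with eta = (beta x)^2/(1 + (beta x)^2) and
    s = 0 for f1. Uniqueness in X_xi follows by testing with chi u, where chi is a
    logarithmic cutoff with |chi'| <= 4 e/x. *)

(** * The weighted space L^2(x dx) *)

(** Neither the sources of the two estimates nor the solutions need lie in L^2, so the inverse
    cannot be read off from an operator on L^2. The equation is tested on compactly supported t,
    where every pairing is finite, and a source enters only through a bound of its functional l:
    [l t ^+ 2] is at most K times a(t,t) + beta^2 |t|^2. A source f1 with x^s f1 in L^2 has such a
    bound, because it pairs with x^(-s) t. A source f2 known only through f2/x would pair with x t,
    which the form does not control; this is the obstacle that the ansatz beta^-2 f2 removes,
    leaving the functional -beta^-2 a(f2, t). The scale 1/beta of eta balances the two contributions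
    to the second estimate: beta^-1 beta^-s from f1 and beta^-2 beta^(1-s) from f2, both equal to
    beta^-(1+s). A weak derivative is determined only up to a null set. Functions therefore travel
    in pairs with one of their weak derivatives, limits are taken of u, u', u/x and xb u separately,
    and the passage to the chosen [wderiv] is made only at the end. *)

Section weightedL2.
Context {R : realType}.
Implicit Types f g h : R -> R.
Local Notation mu := (@lebesgue_measure R).
Local Notation H := (halfline R).

Definition itg h : Prop := mu.-integrable H (EFin \o h).
Definition II h : R := \int[mu]_(x in H) h x.

Lemma inH (x : R) : H x <-> 0 < x.
Proof. by rewrite /= in_itv/= andbT. Qed.

Lemma measurableH : measurable H. Proof. exact: measurable_itv. Qed.
Hint Resolve measurableH : core.

(* Lebesgue measure is declared over an alias of R with its own display. *)
Local Notation RL := (g_sigma_algebraType (R.-ocitv.-measurable)).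

Let mH : measurable (H : set RL). Proof. exact: measurable_itv. Qed.

Lemma aeS (P Q : R -> Prop) : (forall x, P x -> Q x) ->
  {ae mu, forall x, P x} -> {ae mu, forall x, Q x}.
Proof. by move=> PQ [N [mN N0 sub]]; exists N; split => // x nQ; apply: sub => /PQ. Qed.

Lemma ae2S (P Q S : R -> Prop) : (forall x, P x -> Q x -> S x) ->
  {ae mu, forall x, P x} -> {ae mu, forall x, Q x} -> {ae mu, forall x, S x}.
Proof.
move=> PQS [N [mN N0 sN]] [M [mM M0 sM]]; exists (N `|` M); split => //.
- exact: measurableU.
- by rewrite null_set_setU.
move=> x nS; have [Px|nP] := pselect (P x); last by left; exact: sN.
by right; apply: sM => Qx; apply: nS; exact: PQS.
Qed.

Lemma itg_meas h : itg h -> measurable_fun H h.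
Proof. by move=> /measurable_int /measurable_EFinP. Qed.

Lemma itg_le f g : measurable_fun H f -> (forall x, 0 < x -> `|f x| <= g x) ->
  itg g -> itg f.
Proof.
move=> mf fg; apply: le_integrable => //; first exact/measurable_EFinP.
by move=> x /inH x0 /=; rewrite lee_fin (le_trans (fg _ x0)) ?ler_norm.
Qed.

Lemma eq_itg f g : (forall x, 0 < x -> f x = g x) -> itg f -> itg g.
Proof.
by move=> fg; apply: eq_integrable => // x /set_mem/inH x0 /=; rewrite fg.
Qed.

Lemma eq_II f g : (forall x, 0 < x -> f x = g x) -> II f = II g.
Proof. by move=> fg; apply: eq_Rintegral => x /set_mem/inH x0; exact: fg. Qed.

Lemma itgD f g : itg f -> itg g -> itg (fun x => f x + g x).
Proof.
move=> If Ig; have := integrableD mH If Ig.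
by apply: eq_integrable => // x _ /=; rewrite EFinD.
Qed.

Lemma itgZ c f : itg f -> itg (fun x => c * f x).
Proof.
move=> If; have := integrableZl mH c If.
by apply: eq_integrable => // x _ /=; rewrite EFinM.
Qed.

Lemma itgN f : itg f -> itg (fun x => - f x).
Proof. by move=> If; apply: eq_itg (itgZ (-1) If) => x _; rewrite mulN1r. Qed.

Lemma itgB f g : itg f -> itg g -> itg (fun x => f x - g x).
Proof. by move=> If Ig; exact: (itgD If (itgN Ig)). Qed.

Lemma itg0 : itg (fun=> 0).
Proof. exact: integrable0. Qed.

Lemma IID f g : itg f -> itg g -> II (fun x => f x + g x) = II f + II g.
Proof. by move=> If Ig; exact: (RintegralD mH If Ig). Qed.

Lemma IIB f g : itg f -> itg g -> II (fun x => f x - g x) = II f - II g.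
Proof. by move=> If Ig; exact: (RintegralB mH If Ig). Qed.

Lemma IIZ c f : itg f -> II (fun x => c * f x) = c * II f.
Proof. by move=> If; exact: (RintegralZl c mH If). Qed.

Lemma II_zero : II (fun=> 0) = 0.
Proof. by rewrite /II /Rintegral integral0. Qed.

Lemma II_ge0 f : (forall x, 0 < x -> 0 <= f x) -> 0 <= II f.
Proof. by move=> f0; apply: Rintegral_ge0 => x /inH; exact: f0. Qed.

Lemma le_II f g : itg f -> itg g -> (forall x, 0 < x -> f x <= g x) ->
  II f <= II g.
Proof.
by move=> If Ig fg; apply: (le_Rintegral mH If Ig) => x /inH; exact: fg.
Qed.

Lemma EFin_II f : itg f -> (II f)%:E = (\int[mu]_(x in H) (f x)%:E)%E.
Proof. by move=> If; rewrite /II /Rintegral fineK// integrable_fin_num. Qed.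

Lemma ae_II f g : measurable_fun H f -> measurable_fun H g ->
  ae_eq_halfline f g -> II f = II g.
Proof.
move=> mf mg fg; rewrite /II /Rintegral; congr fine; apply: ae_eq_integral => //.
- exact/measurable_EFinP.
- exact/measurable_EFinP.
- by apply: aeS fg => x fg /inH/fg ->.
Qed.

Lemma ae_itg f g : measurable_fun H g ->
  ae_eq_halfline f g -> itg f -> itg g.
Proof.
move=> mg fg If; have mf := itg_meas If.
move/integrableP : If => [_ foo]; apply/integrableP; split.
  exact/measurable_EFinP.
rewrite (_ : integral _ _ _ = \int[mu]_(x in H) `|(EFin \o f) x|)%E//.
apply: ae_eq_integral => //.
- by apply/measurable_EFinP; apply: measurableT_comp.
- by apply/measurable_EFinP; apply: measurableT_comp.
- by apply: aeS fg => x fg /inH/fg /= ->.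
Qed.

Lemma itg_lty f : measurable_fun H f -> (forall x, 0 < x -> 0 <= f x) ->
  (\int[mu]_(x in H) (f x)%:E < +oo)%E -> itg f.
Proof.
move=> mf f0 foo; apply/integrableP; split; first exact/measurable_EFinP.
apply: le_lt_trans foo; rewrite le_eqVlt; apply/orP; left; apply/eqP.
by apply: eq_integral => x /set_mem/inH x0 /=; rewrite ger0_norm// f0.
Qed.

Lemma II_eq0 f : itg f -> (forall x, 0 < x -> 0 <= f x) -> II f <= 0 ->
  ae_eq_halfline f (fun=> 0).
Proof.
move=> If f0 If0; have {}If0 : II f = 0.
  by apply/eqP; rewrite eq_le If0 II_ge0.
have mf := itg_meas If.
have /(ae_eq_integral_abs mu mH)[+ _] : measurable_fun H (EFin \o f).
  exact/measurable_EFinP.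
case.
  rewrite -[RHS](congr1 EFin If0) EFin_II//; apply: eq_integral.
  by move=> x /set_mem/inH x0 /=; rewrite ger0_norm// f0.
move=> N [mN N0 sub]; exists N; split => // x /= nf; apply: sub => /= nf'.
by apply: nf => x0; have /= := nf' ((inH x).2 x0); case.
Qed.

Definition L2 f : Prop := measurable_fun H f /\ itg (fun x => f x ^+ 2 * x).
Definition ip f g : R := II (fun x => f x * g x * x).
Definition nsq f : R := II (fun x => f x ^+ 2 * x).

Lemma nsqE f : nsq f = ip f f.
Proof. by []. Qed.

Lemma nsq_ge0 f : 0 <= nsq f.
Proof. by apply: II_ge0 => x x0; rewrite mulr_ge0 ?sqr_ge0 ?ltW. Qed.

Lemma eq_L2 f g : (forall x, 0 < x -> f x = g x) -> L2 f -> L2 g.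
Proof.
move=> fg [mf If]; split.
  by apply: eq_measurable_fun mf => x /set_mem/inH; exact: fg.
by apply: eq_itg If => x x0; rewrite fg.
Qed.

Lemma eq_nsq f g : (forall x, 0 < x -> f x = g x) -> nsq f = nsq g.
Proof. by move=> fg; apply: eq_II => x x0; rewrite fg. Qed.

Lemma eq_ip f f' g g' : (forall x, 0 < x -> f x = f' x) ->
  (forall x, 0 < x -> g x = g' x) -> ip f g = ip f' g'.
Proof. by move=> ff gg; apply: eq_II => x x0; rewrite ff ?gg. Qed.

Lemma L2_itg f g : L2 f -> L2 g -> itg (fun x => f x * g x * x).
Proof.
move=> [mf If] [mg Ig].
have := itgD If Ig; apply: itg_le.
  by do 2?apply: measurable_funM.
move=> x x0; rewrite -mulrDl normrM (gtr0_norm x0) ler_pM2r// normrM.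
rewrite -[f x ^+ 2]real_normK ?num_real// -[g x ^+ 2]real_normK ?num_real//.
have := sqr_ge0 (`|f x| - `|g x|).
have := normr_ge0 (f x); have := normr_ge0 (g x); nra.
Qed.

Lemma L2_dom c f g : measurable_fun H f ->
  (forall x, 0 < x -> `|f x| <= c * `|g x|) -> L2 g -> L2 f.
Proof.
move=> mf fg [mg Ig]; split => //; apply: itg_le (itgZ (c ^+ 2) Ig).
  by do 2?apply: measurable_funM => //; exact: measurable_funX.
move=> x x0; rewrite normrM (gtr0_norm x0) mulrA ler_pM2r// normrX.
rewrite -[g x ^+ 2]real_normK ?num_real// -exprMn lerXn2r ?nnegrE ?fg//.
exact: le_trans (fg _ x0).
Qed.

Lemma L2D f g : L2 f -> L2 g -> L2 (fun x => f x + g x).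
Proof.
move=> Lf Lg; split; first by apply: measurable_funD; [exact: Lf.1|exact: Lg.1].
have := itgD (itgD Lf.2 Lg.2) (itgZ 2 (L2_itg Lf Lg)).
by apply: eq_itg => x x0; ring.
Qed.

Lemma L2Z c f : L2 f -> L2 (fun x => c * f x).
Proof.
move=> Lf; apply: (L2_dom (c := `|c|)) (Lf).
  by apply: measurable_funM => //; exact: Lf.1.
by move=> x x0; rewrite normrM.
Qed.

Lemma L2N f : L2 f -> L2 (fun x => - f x).
Proof. by move=> Lf; apply: eq_L2 (L2Z (-1) Lf) => x _; rewrite mulN1r. Qed.

Lemma L2B f g : L2 f -> L2 g -> L2 (fun x => f x - g x).
Proof. by move=> Lf Lg; exact: L2D Lf (L2N Lg). Qed.

Lemma L20 : L2 (fun=> 0).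
Proof.
by split => //; apply: eq_itg itg0 => x _; rewrite expr0n/= mul0r.
Qed.

Lemma ipC f g : ip f g = ip g f.
Proof. by apply: eq_II => x _; rewrite [f x * _]mulrC. Qed.

Lemma ipDl f g h : L2 f -> L2 g -> L2 h ->
  ip (fun x => f x + g x) h = ip f h + ip g h.
Proof.
move=> Lf Lg Lh; rewrite -IID; [|exact: L2_itg..].
by apply: eq_II => x _; rewrite !mulrDl.
Qed.

Lemma ipZl c f h : L2 f -> L2 h -> ip (fun x => c * f x) h = c * ip f h.
Proof.
move=> Lf Lh; rewrite -IIZ; [|exact: L2_itg].
by apply: eq_II => x _; rewrite !mulrA.
Qed.

Lemma ipDr f g h : L2 f -> L2 g -> L2 h ->
  ip h (fun x => f x + g x) = ip h f + ip h g.
Proof. by move=> Lf Lg Lh; rewrite ipC ipDl// !(ipC h). Qed.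

Lemma ipZr c f h : L2 f -> L2 h -> ip h (fun x => c * f x) = c * ip h f.
Proof. by move=> Lf Lh; rewrite ipC ipZl// !(ipC h). Qed.

(** Serves twice: for Cauchy-Schwarz in the weighted space, and to turn near-minimality of a
    quadratic functional into smallness of its derivative. The degenerate case [c = 0] is included
    because the forms are only known to be semidefinite. *)
Lemma discriminant_ge0 (a b c : R) :
  (forall t : R, 0 <= a + 2 * t * b + t ^+ 2 * c) -> 0 <= c -> b ^+ 2 <= a * c.
Proof.
move=> abc; rewrite le_eqVlt => /predU1P[c0|c0].
  subst c; rewrite mulr0; have [->|b0] := eqVneq b 0; first by rewrite expr0n.
  (* When [c = 0] the expression is affine in t; this t gives it the value -1. *)
  have := abc (- (a + 1) / (2 * b)).
  rewrite mulr0 addr0.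
  have -> : a + 2 * (- (a + 1) / (2 * b)) * b = -1 by field.
  by rewrite oppr_ge0 ler10.
have := abc (- b / c).
have -> : a + 2 * (- b / c) * b + (- b / c) ^+ 2 * c = (a * c - b ^+ 2) / c.
  by field; rewrite gt_eqF.
by rewrite pmulr_lge0 ?invr_gt0// subr_ge0.
Qed.

Lemma ip_cs f g : L2 f -> L2 g -> ip f g ^+ 2 <= nsq f * nsq g.
Proof.
move=> Lf Lg; apply: discriminant_ge0; last exact: nsq_ge0.
move=> t; have := nsq_ge0 (fun x => f x + t * g x).
have Ltg := L2Z t Lg.
rewrite (nsqE (fun x => _)) ipDl//; last exact: L2D.
rewrite !ipDr// ipZl// ipZl// !ipZr// -!nsqE (ipC g f) => /le_trans; apply.
by rewrite le_eqVlt; apply/orP; left; apply/eqP; ring.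
Qed.

Lemma le_nsq c f g : L2 f -> L2 g ->
  (forall x, 0 < x -> f x ^+ 2 <= c * g x ^+ 2) -> nsq f <= c * nsq g.
Proof.
move=> Lf Lg fg; rewrite -IIZ ?Lg.2//; last exact: Lg.2.
apply: le_II; [exact: Lf.2|exact: itgZ Lg.2|] => x x0.
by rewrite mulrA ler_pM2r// fg.
Qed.

Lemma nsqZ c f : L2 f -> nsq (fun x => c * f x) = c ^+ 2 * nsq f.
Proof.
move=> Lf; rewrite -IIZ; last exact: Lf.2.
by apply: eq_II => x _; rewrite exprMn mulrA.
Qed.

Lemma nsqD f g : L2 f -> L2 g ->
  nsq (fun x => f x + g x) <= 2 * nsq f + 2 * nsq g.
Proof.
move=> Lf Lg; rewrite -!IIZ; [|exact: Lg.2|exact: Lf.2].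
rewrite -IID; [|apply: itgZ; exact: Lf.2|apply: itgZ; exact: Lg.2].
apply: le_II; first exact: (L2D Lf Lg).2.
  apply: itgD; apply: itgZ; [exact: Lf.2|exact: Lg.2].
move=> x x0; rewrite !mulrA -mulrDl ler_pM2r//.
have := sqr_ge0 (f x - g x); nra.
Qed.

Lemma ae_L2 f g : measurable_fun H g -> ae_eq_halfline f g -> L2 f -> L2 g.
Proof.
move=> mg fg [mf If]; split => //; apply: ae_itg If.
  by apply: measurable_funM => //; exact: measurable_funX.
by apply: aeS fg => x fg /fg ->.
Qed.

Lemma ae_nsq f g : measurable_fun H f -> measurable_fun H g ->
  ae_eq_halfline f g -> nsq f = nsq g.
Proof.
move=> mf mg fg; apply: ae_II.
- by apply: measurable_funM => //; exact: measurable_funX.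
- by apply: measurable_funM => //; exact: measurable_funX.
- by apply: aeS fg => x fg /fg ->.
Qed.

Lemma l2normE f : L2 f -> l2norm f = (nsq f `^ 2^-1)%:E.
Proof. by move=> [_ If]; rewrite /l2norm -EFin_II// poweR_EFin. Qed.

Lemma l2norm_lty f : measurable_fun H f -> (l2norm f < +oo)%E -> L2 f.
Proof.
move=> mf foo; split => //; apply: itg_lty.
- by apply: measurable_funM => //; exact: measurable_funX.
- by move=> x x0; rewrite mulr_ge0 ?sqr_ge0 ?ltW.
- by apply: lty_poweRy foo; rewrite invr_neq0.
Qed.

Lemma powR_half_sqr (a : R) : 0 <= a -> (a `^ 2^-1) `^ 2 = a.
Proof. by move=> a0; rewrite -powRrM mulVf// powRr1. Qed.

End weightedL2.

(** * Weak derivatives *)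

Section triangle.
Context {R : realType}.
Local Notation mu := (@lebesgue_measure R).
Local Notation RL := (g_sigma_algebraType (R.-ocitv.-measurable)).
Implicit Types f g k : R -> R.

Lemma measurable_triangle : measurable [set z : RL * RL | (z.2 : R) <= (z.1 : R)].
Proof.
rewrite -[X in measurable X]setTI.
apply: (@measurable_fun_le _ _ R setT (fun z : RL * RL => z.2 : R) (fun z : RL * RL => z.1 : R)) => //.
exact: measurable_snd.
exact: measurable_fst.
Qed.

(** Integration by parts in disguise: with g and k merely integrable, the product rule for their
    primitives comes from exchanging the order of integration over the triangle s <= t. *)
Lemma Fubini_triangle g k a b :
  mu.-integrable `[a, b] (EFin \o g) -> mu.-integrable `[a, b] (EFin \o k) ->
  \int[mu]_(t in `[a, b]) (g t * \int[mu]_(s in `[a, t]) k s) =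
  \int[mu]_(s in `[a, b]) (k s * \int[mu]_(t in `[s, b]) g t).
Proof.
move=> ig ik.
set A := [set` `[a, b]].
have mA : measurable (A : set RL) by exact: measurable_itv.
have mgA h : mu.-integrable A (EFin \o h) ->
    mu.-integrable setT (EFin \o (h \_ A)).
  by move=> ih; rewrite -restrict_EFin; apply/(integrable_mkcond _ mA).
have {}ig := mgA _ ig; have {}ik := mgA _ ik.
pose T := [set z : RL * RL | (z.2 : R) <= (z.1 : R)].
pose F (z : RL * RL) := ((g \_ A) z.1 * (k \_ A) z.2 * \1_T z)%:E.
have mg : measurable_fun [set: RL] (g \_ A).
  by move/measurable_int : ig => /measurable_EFinP.
have mk : measurable_fun [set: RL] (k \_ A).
  by move/measurable_int : ik => /measurable_EFinP.
have mF : measurable_fun [set: RL * RL] F.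
  apply/measurable_EFinP; apply: measurable_funM.
    by apply: measurable_funM; [exact: measurableT_comp|exact: measurableT_comp].
  by apply: measurable_indic; exact: measurable_triangle.
(* The indicator is at most 1, so the iterated integral of |F| is at most the product of the two L^1
   norms. *)
have iF : (mu \x mu)%E.-integrable setT F.
  apply/(integrable12ltyP _ _ mF).
  move/integrableP : ig => [_ fg]; move/integrableP : ik => [mk' fk].
  set Mk := (\int[mu]_x `|(EFin \o k \_ A) x|)%E in fk.
  have Mk0 : (0 <= Mk)%E by apply: integral_ge0.
  have Mkfin : Mk \is a fin_num by rewrite ge0_fin_numE.
  apply: (@le_lt_trans _ _ (\int[mu]_(x in [set: RL]) (`|(EFin \o g \_ A) x| * Mk))%E); last first.
    rewrite -(fineK Mkfin) ge0_integralZr//.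
      rewrite (fineK Mkfin) lte_mul_pinfty//; first exact: integral_ge0.
      by rewrite ge0_fin_numE//; exact: integral_ge0.
      by apply/measurable_EFinP; apply: measurableT_comp.
      by rewrite fineK.
  apply: (@ge0_le_integral _ RL R mu setT) => //.
  - by move=> x _; apply: integral_ge0.
  - apply: (measurable_fun_fubini_tonelli_F (abse \o F)) => //=.
    exact: measurableT_comp.
  - by apply: emeasurable_funM => //; apply/measurable_EFinP; apply: measurableT_comp.
  - move=> x _; rewrite /Mk -ge0_integralZl//; last first.
      by apply/measurable_EFinP; apply: measurableT_comp.
    apply: ge0_le_integral => //.
    + apply: measurableT_comp => //; apply: measurableT_comp mF _.
      exact: measurable_pair1.
    + apply: measurable_funeM; apply/measurable_EFinP; exact: measurableT_comp.
    + move=> y _; rewrite /F /= lee_fin !normrM -[leRHS]mulr1 ler_wpM2l//.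
      by rewrite indicE; case: (_ \in _); rewrite /= ?normr1 ?normr0.
have Fub := Fubini iF.
have E1 : (\int[mu]_x \int[mu]_y F (x, y) =
    \int[mu]_(t in A) (g t * \int[mu]_(s in `[a, t]) k s)%:E)%E.
  rewrite [RHS]integral_mkcond; apply: eq_integral => t _.
  rewrite patchE; case: ifPn => tA; last first.
    rewrite (_ : (fun y => _) = cst 0%E) ?integral0//.
    by apply/funext => y; rewrite /F /= patchE (negbTE tA) !mul0r.
  have tab : a <= t <= b by move: tA; rewrite inE /A /= in_itv.
  have itk : mu.-integrable `[a, t] (EFin \o k).
    have := ik; rewrite -restrict_EFin => /(integrable_mkcond _ mA).
    apply: integrableS => //.
    by apply: subset_itvl; rewrite bnd_simp; case/andP: tab.
  rewrite EFinM /Rintegral fineK; last exact: integrable_fin_num.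
  rewrite -integralZl// [RHS]integral_mkcond; apply: eq_integral => s _.
  rewrite /F /= patchE tA patchE [RHS]patchE indicE.
  have -> : (s \in [set` `[a, t]]) = (s \in A) && ((t, s) \in T).
    apply/idP/idP; rewrite /A /T.
      rewrite inE/= in_itv/= => /andP[as_ st]; apply/andP; rewrite !inE/= in_itv/=.
      by rewrite as_ st (le_trans st)//; case/andP: tab.
    by move=> /andP[]; rewrite !inE/= !in_itv/= => /andP[-> _] ->.
  case: (s \in A) => /=; last by rewrite mulr0 mul0r.
  by case: (_ \in T); rewrite /= ?mulr1 ?mulr0 ?EFinM.
have E2 : (\int[mu]_y \int[mu]_x F (x, y) =
    \int[mu]_(s in A) (k s * \int[mu]_(t in `[s, b]) g t)%:E)%E.
  rewrite [RHS]integral_mkcond; apply: eq_integral => s _.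
  rewrite patchE; case: ifPn => sA; last first.
    rewrite (_ : (fun y => _) = cst 0%E) ?integral0//.
    by apply/funext => y; rewrite /F /= [(k \_ A) _]patchE (negbTE sA) mulr0 mul0r.
  have sab : a <= s <= b by move: sA; rewrite inE /A /= in_itv.
  have isg : mu.-integrable `[s, b] (EFin \o g).
    have := ig; rewrite -restrict_EFin => /(integrable_mkcond _ mA).
    apply: integrableS => //.
    by apply: subset_itvr; rewrite bnd_simp; case/andP: sab.
  rewrite EFinM /Rintegral fineK; last exact: integrable_fin_num.
  rewrite -integralZl// [RHS]integral_mkcond; apply: eq_integral => t _.
  rewrite /F /= [(k \_ A) _]patchE sA patchE [RHS]patchE indicE.
  have -> : (t \in [set` `[s, b]]) = (t \in A) && ((t, s) \in T).
    apply/idP/idP; rewrite /A /T.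
      rewrite inE/= in_itv/= => /andP[st tb]; apply/andP; rewrite !inE/= in_itv/=.
      by rewrite tb st (le_trans _ st)//; case/andP: sab.
    by move=> /andP[]; rewrite !inE/= !in_itv/= => /andP[_ ->] ->.
  case: (t \in A) => /=; last by rewrite !mul0r.
  by case: (_ \in T); rewrite /= ?mulr1 ?mulr0 ?EFinM 1?muleC.
by rewrite /Rintegral -E1 -E2 Fub.
Qed.

End triangle.

(** * Locally absolutely continuous functions and the product rule *)

Section primitives.
Context {R : realType}.
Local Notation mu := (@lebesgue_measure R).
Local Notation RL := (g_sigma_algebraType (R.-ocitv.-measurable)).
Local Notation H := (halfline R).
Implicit Types f g k : R -> R.

(** The identity holds at all points, so f is the continuous representative; [is_wderiv] is this
    notion up to a null set in f. *)
Definition acp f g : Prop := locally_integrable H g /\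
  forall a b, 0 < a -> a <= b -> f b - f a = \int[mu]_(x in `[a, b]) g x.

Lemma itv_subH (a b : R) : 0 < a -> `[a, b] `<=` H.
Proof. by move=> a0 x; rewrite /= !in_itv/= andbT => /andP[/(lt_le_trans a0)]. Qed.

Lemma loc_itv g a b : locally_integrable H g -> 0 < a ->
  mu.-integrable `[a, b] (EFin \o g).
Proof.
move=> [mg _ ig] a0; apply/integrableP; split.
  apply/measurable_EFinP; apply: measurable_funS mg; first exact: measurableH.
  exact: itv_subH.
by apply: ig; [exact: itv_subH|exact: segment_compact].
Qed.

Lemma loc_itvP g : measurable_fun H g ->
  (forall a b, 0 < a -> a <= b -> mu.-integrable `[a, b] (EFin \o g)) ->
  locally_integrable H g.
Proof.
move=> mg ig; split => //.
move=> K KH cK.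
have [M1 [_ /(_ (`|M1| + 1))]] := compact_bounded cK.
have -> : M1 < `|M1| + 1 by rewrite (le_lt_trans (ler_norm _))// ltrDl.
move=> /(_ isT) bK.
(* A compact K in (0,oo) stays away from 0: its image under inversion is compact, hence bounded. *)
have cK' : compact (GRing.inv @` K).
  apply: continuous_compact => //; apply: continuous_in_subspaceT.
  move=> x /set_mem /KH /inH x0; apply: inv_continuous; exact: lt0r_neq0.
have [M2 [_ /(_ (`|M2| + 1))]] := compact_bounded cK'.
have -> : M2 < `|M2| + 1 by rewrite (le_lt_trans (ler_norm _))// ltrDl.
move=> /(_ isT) bK'.
set b : R := `|M1| + 1 in bK; set c : R := `|M2| + 1 in bK'.
have c0 : 0 < c by rewrite ltr_wpDl.
have KS : K `<=` [set` `[c^-1, Num.max c^-1 b]].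
  move=> x Kx; have x0 : 0 < x by apply/inH/KH.
  rewrite /= in_itv/=; apply/andP; split.
    have /= := bK' x^-1; rewrite gtr0_norm ?invr_gt0// => /(_ _).
    rewrite -[leRHS]invrK; move=> h; rewrite -[x]invrK lef_pV2 ?posrE ?invr_gt0//.
    by rewrite -[leRHS]invrK; apply: h; exists x.
  by rewrite le_max (le_trans (ler_norm _) (bK _ Kx)) orbT.
have c0' : 0 < c^-1 by rewrite invr_gt0.
have cb : c^-1 <= Num.max c^-1 b by rewrite le_max lexx.
have /integrableP[mg' foo] := ig _ _ c0' cb.
apply: le_lt_trans foo; apply: ge0_subset_integral => //=.
- exact: compact_measurable.
- by apply/measurable_EFinP; apply: measurableT_comp => //; exact/measurable_EFinP.
Qed.

Lemma acp_itv f g a b : acp f g -> 0 < a -> mu.-integrable `[a, b] (EFin \o g).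
Proof. by case=> lg _; exact: loc_itv. Qed.

Lemma acp_within f g a b : acp f g -> 0 < a -> a <= b ->
  {within `[a, b], continuous f}.
Proof.
move=> fg a0 ab.
have := parameterized_integral_continuous ab (acp_itv b fg a0) => /= ci.
apply: (@subspace_eq_continuous _ _ _
   (fun x => f a + \int[mu]_(t in `[a, x]) g t)) => /=.
  move=> x /set_mem; rewrite /= in_itv/= => /andP[ax _] /=.
  by rewrite -fg.2// addrC subrK.
by move=> x; apply: cvgD; [exact: cvg_cst|exact: ci].
Qed.

Lemma acp_cont f g x : acp f g -> 0 < x -> {for x, continuous f}.
Proof.
move=> fg x0; have x20 : 0 < x / 2 by rewrite divr_gt0.
have ab : x / 2 < x + 1 by lra.
apply: (within_continuous_continuous ab (acp_within fg x20 (ltW ab))).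
by rewrite in_itv/=; apply/andP; split; lra.
Qed.

Lemma continuousH_meas f : (forall x : R, 0 < x -> {for x, continuous f}) ->
  measurable_fun H f.
Proof.
move=> cf; apply: open_continuous_measurable_fun; first exact: interval_open.
by move=> x /set_mem/inH; exact: cf.
Qed.

Lemma acp_meas f g : acp f g -> measurable_fun H f.
Proof. by move=> fg; apply: continuousH_meas => x; exact: acp_cont fg. Qed.

Lemma itv_itgM f g a b : {within `[a, b], continuous f} ->
  mu.-integrable `[a, b] (EFin \o g) ->
  mu.-integrable `[a, b] (EFin \o (fun x => g x * f x)).
Proof.
move=> cf ig.
have mf : measurable_fun `[a, b] f by exact: subspace_continuous_measurable_fun.
have bf : [bounded f x | x in `[a, b]].
  have := compact_bounded (continuous_compact cf (@segment_compact _ a b)).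
  by move=> [M [Mr Mb]]; exists M; split => // M' MM' x ax; apply: Mb => //; exists x.
have mI : measurable ([set` `[a, b]] : set RL) by exact: measurable_itv.
have := integrableMl mI ig mf bf.
by apply: eq_integrable => // x _ /=; rewrite EFinM.
Qed.

Lemma RintD a b g k : mu.-integrable `[a, b] (EFin \o g) ->
  mu.-integrable `[a, b] (EFin \o k) ->
  \int[mu]_(x in `[a, b]) (g x + k x) =
  \int[mu]_(x in `[a, b]) g x + \int[mu]_(x in `[a, b]) k x.
Proof. by move=> ig ik; apply: RintegralD => //; exact: measurable_itv. Qed.

Lemma RintZ a b g c : mu.-integrable `[a, b] (EFin \o g) ->
  \int[mu]_(x in `[a, b]) (c * g x) = c * \int[mu]_(x in `[a, b]) g x.
Proof. by move=> ig; apply: RintegralZl => //; exact: measurable_itv. Qed.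

Lemma integrable_itvD a b g k : mu.-integrable `[a, b] (EFin \o g) ->
  mu.-integrable `[a, b] (EFin \o k) ->
  mu.-integrable `[a, b] (EFin \o (fun x => g x + k x)).
Proof.
move=> ig ik; have mI : measurable ([set` `[a, b]] : set RL) by exact: measurable_itv.
have := integrableD mI ig ik.
by apply: eq_integrable => // x _ /=; rewrite EFinD.
Qed.

Lemma integrable_itvZ a b g c : mu.-integrable `[a, b] (EFin \o g) ->
  mu.-integrable `[a, b] (EFin \o (fun x => c * g x)).
Proof.
move=> ig; have mI : measurable ([set` `[a, b]] : set RL) by exact: measurable_itv.
have := integrableZl mI c ig.
by apply: eq_integrable => // x _ /=; rewrite EFinM.
Qed.

(** In [Fubini_triangle] the inner integrals are f'(t) - f'(a) and f(b) - f(s). Expanding both sides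
    leaves the two terms of the product rule and the boundary values. *)
Lemma acpM f g f' g' : acp f g -> acp f' g' ->
  acp (fun x => f x * f' x) (fun x => g x * f' x + g' x * f x).
Proof.
move=> fg fg'.
have ig a b : 0 < a -> mu.-integrable `[a, b] (EFin \o g) by exact: acp_itv fg.
have ig' a b : 0 < a -> mu.-integrable `[a, b] (EFin \o g') by exact: acp_itv fg'.
have igf a b : 0 < a -> a <= b ->
    mu.-integrable `[a, b] (EFin \o (fun x => g x * f' x)).
  by move=> a0 ab; apply: itv_itgM; [exact: acp_within fg' a0 ab|exact: ig].
have igf' a b : 0 < a -> a <= b ->
    mu.-integrable `[a, b] (EFin \o (fun x => g' x * f x)).
  by move=> a0 ab; apply: itv_itgM; [exact: acp_within fg a0 ab|exact: ig'].
split.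
  apply: loc_itvP.
    by apply: measurable_funD; apply: measurable_funM;
      [by case: fg => -[]|exact: acp_meas fg'|by case: fg' => -[]|exact: acp_meas fg].
  by move=> a b a0 ab; apply: integrable_itvD; [exact: igf|exact: igf'].
move=> a b a0 ab; rewrite RintD; [|exact: igf|exact: igf'].
have := Fubini_triangle (ig a b a0) (ig' a b a0).
have -> : \int[mu]_(t in `[a, b]) (g t * \int[mu]_(s in `[a, t]) g' s) =
    \int[mu]_(t in `[a, b]) (g t * f' t) - f' a * (f b - f a).
  rewrite fg.2// -mulNr -RintZ ?ig// -RintD ?igf//; last exact/integrable_itvZ/ig.
  apply: eq_Rintegral => t /set_mem; rewrite /= in_itv/= => /andP[at_ _].
  by rewrite -fg'.2//; ring.
have -> : \int[mu]_(s in `[a, b]) (g' s * \int[mu]_(t in `[s, b]) g t) =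
    f b * (f' b - f' a) - \int[mu]_(s in `[a, b]) (g' s * f s).
  rewrite fg'.2// -RintZ ?ig'// -mulN1r -RintZ ?igf'//.
  rewrite -RintD; [|exact/integrable_itvZ/ig'|exact/integrable_itvZ/igf'].
  apply: eq_Rintegral => t /set_mem; rewrite /= in_itv/= => /andP[at_ tb].
  by rewrite -fg.2//; [ring|exact: lt_le_trans at_].
by move=> /eqP; rewrite subr_eq => /eqP ->; ring.
Qed.

Lemma acp_lin c f g f' g' : acp f g -> acp f' g' ->
  acp (fun x => f x + c * f' x) (fun x => g x + c * g' x).
Proof.
move=> fg fg'; split.
  apply: loc_itvP.
    by apply: measurable_funD; [|apply: measurable_funM]; [by case: fg => -[]|by []|by case: fg' => -[]].
  move=> a b a0 _; apply: integrable_itvD; first exact: acp_itv fg a0.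
  exact/integrable_itvZ/(acp_itv _ fg' a0).
move=> a b a0 ab; rewrite RintD; [|exact: acp_itv fg a0|]; last first.
  exact/integrable_itvZ/(acp_itv _ fg' a0).
rewrite RintZ; last exact: acp_itv fg' a0.
by rewrite -fg.2// -fg'.2//; ring.
Qed.

Lemma acp_ext f g f' g' : (forall x, 0 < x -> f x = f' x) ->
  (forall x, 0 < x -> g x = g' x) -> acp f g -> acp f' g'.
Proof.
move=> ff gg fg; split.
  apply: loc_itvP.
    apply: (eq_measurable_fun g); last by case: fg => -[].
    by move=> x /set_mem/inH; exact: gg.
  move=> a b a0 _; have := acp_itv b fg a0.
  apply: eq_integrable => //.
  by move=> x /set_mem/(itv_subH a0)/inH x0 /=; rewrite gg.
move=> a b a0 ab; rewrite -!ff ?(lt_le_trans a0 ab)// fg.2//.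
by apply: eq_Rintegral => x /set_mem/(itv_subH a0)/inH; exact: gg.
Qed.

Lemma acp_C1 f g : (forall x : R, 0 < x -> is_derive x 1 f (g x)) ->
  (forall x : R, 0 < x -> {for x, continuous g}) -> acp f g.
Proof.
move=> df cg.
have cf (x : R) : 0 < x -> {for x, continuous f}.
  by move=> x0; have := df _ x0 => -[dx _]; exact/differentiable_continuous/derivable1_diffP.
have wg a b : 0 < a -> {within `[a, b], continuous g}.
  move=> a0; apply: continuous_in_subspaceT => x /set_mem/(itv_subH a0)/inH.
  exact: cg.
split.
  apply: loc_itvP; first exact: continuousH_meas.
  move=> a b a0 _; apply: continuous_compact_integrable; first exact: segment_compact.
  exact: wg.
move=> a b a0; rewrite le_eqVlt => /predU1P[<-|ab].
  by rewrite subrr set_itv1 Rintegral_set1.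
rewrite /Rintegral (@continuous_FTC2 _ g f)//; first exact: wg.
  split; first by move=> x /[!in_itv]/= /andP[ax _]; have [] := df _ (lt_trans a0 ax).
    by apply: cvg_at_right_filter; exact: cf.
  by apply: cvg_at_left_filter; apply: cf; exact: lt_trans ab.
move=> x /[!in_itv]/= /andP[ax _]; rewrite derive1E.
by have [_ ->] := df _ (lt_trans a0 ax).
Qed.

End primitives.

(** * Uniqueness and calculus of weak derivatives *)

Section wderiv.
Context {R : realType}.
Local Notation mu := (@lebesgue_measure R).
Local Notation RL := (g_sigma_algebraType (R.-ocitv.-measurable)).
Local Notation H := (halfline R).
Implicit Types f g k : R -> R.

Lemma ae_dense (P : R -> Prop) (a b : R) : {ae mu, forall x, P x} -> a < b ->
  exists2 y, a < y < b & P y.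
Proof.
move=> [N [mN N0 sub]] ab; apply: contrapT => nex.
have abN : [set` `]a, b[] `<=` N.
  move=> x; rewrite /= in_itv/= => xab; apply: sub => /= Px; apply: nex.
  by exists x.
have : (mu [set` `]a, b[] <= mu N)%E.
  by apply: le_measure => //; rewrite inE//; exact: measurable_itv.
rewrite N0 lebesgue_measure_itv/= lte_fin ab -EFinD lee_fin subr_le0.
by rewrite leNgt ab.
Qed.

(** By continuity a nonzero difference at x persists on an interval to the right of x, which no null
    set contains. The version on an interval is what later shows that the continuous representative
    of a compactly supported function vanishes off the support. *)
Lemma acp_ae_eq_itv f g f' g' (a b : R) : acp f g -> acp f' g' -> 0 <= a ->
  {ae mu, forall x, a < x < b -> f x = f' x} ->
  forall x, a < x < b -> f x = f' x.
Proof.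
move=> fg fg' a0 ff x /andP[ax xb]; have x0 := le_lt_trans a0 ax.
apply/eqP; rewrite -subr_eq0; apply/negPn/negP => d0.
have cd : (fun y => f y - f' y) @ x --> f x - f' x.
  by apply: cvgB; [exact: (acp_cont fg x0)|exact: (acp_cont fg' x0)].
have := cvgr_neq0 _ cd d0 => -[e /= e0 be].
have xe : x < Num.min b (x + e) by rewrite lt_min xb ltrDl.
have [y /andP[xy]] := ae_dense ff xe.
rewrite lt_min => /andP[yb ye] yP.
have := be y; rewrite /ball_/= ltr0_norm; last lra.
rewrite yP ?yb ?(lt_trans ax)// subrr eqxx => h; have // : false by apply: h; lra.
Qed.

Lemma acp_ae_eq f g f' g' : acp f g -> acp f' g' -> ae_eq_halfline f f' ->
  forall x, 0 < x -> f x = f' x.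
Proof.
move=> fg fg' ff x x0; apply: (@acp_ae_eq_itv f g f' g' 0 (x + 1)) => //.
  by apply: aeS ff => y e /andP[/e].
by rewrite x0 ltrDl/=.
Qed.

(** Lebesgue differentiation: almost everywhere g is the derivative of its own primitive, and here
    the primitive vanishes. The intervals from 1/(n+1) to n+1 exhaust the half-line and keep g
    integrable. *)
Lemma int0_ae0 g : locally_integrable H g ->
  (forall a b, 0 < a -> a <= b -> \int[mu]_(x in `[a, b]) g x = 0) ->
  ae_eq_halfline g (fun=> 0).
Proof.
move=> lg g0.
suff hn n : {ae mu, forall x, n.+1%:R^-1 < x -> x < n.+1%:R -> g x = 0}.
  have /ae_foralln := hn; apply: aeS => x gx x0.
  have [n hx] : exists n, n.+1%:R^-1 < x /\ x < n.+1%:R.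
    have [n1 h1] : exists n, x < n.+1%:R by exists (Num.truncn x); exact: truncnS_gt.
    have [n2 h2] : exists n, x^-1 < n.+1%:R by exists (Num.truncn x^-1); exact: truncnS_gt.
    exists (n1 + n2)%N; split.
      rewrite -[x]invrK ltf_pV2 ?posrE ?invr_gt0//.
      by apply: lt_le_trans h2 _; rewrite ler_nat ltnS leq_addl.
    by apply: lt_le_trans h1 _; rewrite ler_nat ltnS leq_addr.
  by case: hx; exact: gx.
pose a : R := n.+1%:R^-1; pose b : R := n.+1%:R.
have a0 : 0 < a by rewrite invr_gt0.
have ig := loc_itv b lg a0.
pose h := g \_ [set` `[a, b]].
have mI : measurable ([set` `[a, b]] : set RL) by exact: measurable_itv.
have ih : mu.-integrable setT (EFin \o h).
  by rewrite -restrict_EFin; apply/(integrable_mkcond _ mI).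
have lh : locally_integrable [set: R] h.
  by apply: open_integrable_locally => //; exact: openT.
have ihy y : mu.-integrable [set` Interval (BLeft a) (BRight y)] (EFin \o h).
  by apply: integrableS ih => //; exact: measurable_itv.
have := FTC1 ihy lh.
apply: aeS => x /= hx ax xb; have [_ Fx] := hx ax.
have xab : x \in ([set` `[a, b]] : set R).
  by rewrite inE/= in_itv/= (ltW ax) (ltW xb).
have <- : h x = g x by rewrite /h patchE xab.
rewrite -Fx derive1E; apply: derive_val.
have : \forall y \near x, cst 0 y = \int[mu]_(t in `[a, y]) h t.
  near=> y.
  have ay : a < y by near: y; exact: lt_nbhsr.
  have yb : y < b by near: y; exact: lt_nbhsl.
  rewrite -(g0 a y a0 (ltW ay)); apply: eq_Rintegral => t /set_mem.
  rewrite /= in_itv/= => /andP[at_ ty]; rewrite /h patchE ifT//.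
  by rewrite inE/= in_itv/= at_ (le_trans ty (ltW yb)).
by move=> e; apply: near_eq_is_derive e _; rewrite ?oner_eq0.
Unshelve. all: by end_near. Qed.

Lemma acp_uniq f g f' g' : acp f g -> acp f' g' -> ae_eq_halfline f f' ->
  ae_eq_halfline g g'.
Proof.
move=> fg fg' ff; have eqf := acp_ae_eq fg fg' ff.
have := acp_lin (-1) fg fg' => -[lg dg].
have : ae_eq_halfline (fun x => g x + -1 * g' x) (fun=> 0).
  apply: int0_ae0 => // a b a0 ab; rewrite -dg// !eqf//; first by ring.
  exact: lt_le_trans ab.
by apply: aeS => x gx x0; have := gx x0; lra.
Qed.

Lemma is_wderivP f g : is_wderiv f g <->
  measurable_fun H f /\ exists2 f0, ae_eq_halfline f f0 & acp f0 g.
Proof.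
split=> [[mf lg [f0 [ff0 df]]]|[mf [f0 ff0 [lg df]]]]; split => //.
- exists f0 => //; split => // a b a0 ab; apply: EFin_inj; rewrite df//.
  by rewrite /Rintegral fineK//; apply: integrable_fin_num; [exact: measurable_itv|exact: loc_itv].
- exists f0; split => // a b a0 ab; rewrite df// /Rintegral fineK//.
  by apply: integrable_fin_num; [exact: measurable_itv|exact: loc_itv].
Qed.

Lemma acp_wderiv f g : acp f g -> is_wderiv f g.
Proof.
by move=> fg; apply/is_wderivP; split; [exact: acp_meas fg|exists f => //; exact: aeW].
Qed.

Lemma is_wderiv_uniq f f' g g' : is_wderiv f g -> is_wderiv f' g' ->
  ae_eq_halfline f f' -> ae_eq_halfline g g'.
Proof.
move=> /is_wderivP[_ [f0 ff0 d0]] /is_wderivP[_ [f1 ff1 d1]] ff.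
apply: acp_uniq d0 d1 _; have := ae2S (fun x => @conj _ _) ff0 ff1.
by apply: ae2S ff => x e [e0 e1] x0; rewrite -e0// e// e1.
Qed.

Lemma wderiv_is f : wdifferentiable f -> is_wderiv f (wderiv f).
Proof. by move=> [g fg]; exact: (xgetPex (cst 0) (ex_intro _ g fg)). Qed.

Lemma is_wderiv_meas f g : is_wderiv f g -> measurable_fun H f /\ measurable_fun H g.
Proof. by case=> mf [mg _ _] _. Qed.

(** [acpM] yields a derivative containing the continuous representatives; these are exchanged for f
    and f' under the integral, where null sets do not count. *)
Lemma is_wderivM f g f' g' : is_wderiv f g -> is_wderiv f' g' ->
  is_wderiv (fun x => f x * f' x) (fun x => g x * f' x + g' x * f x).
Proof.
move=> fg fg'; have [mf mg] := is_wderiv_meas fg.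
have [mf' mg'] := is_wderiv_meas fg'.
move: fg fg' => /is_wderivP[_ [f0 ff0 d0]] /is_wderivP[_ [f1 ff1 d1]].
have [lg df] := acpM d0 d1.
have aeg : ae_eq_halfline (fun x => g x * f1 x + g' x * f0 x)
    (fun x => g x * f' x + g' x * f x).
  by apply: ae2S ff0 ff1 => x e0 e1 x0; rewrite e0// e1.
have mG : measurable_fun H (fun x => g x * f' x + g' x * f x).
  by apply: measurable_funD; apply: measurable_funM.
apply/is_wderivP; split; first exact: measurable_funM.
exists (fun x => f0 x * f1 x).
  by apply: ae2S ff0 ff1 => x e0 e1 x0; rewrite e0// e1.
have sub a b : 0 < a -> [set` `[a, b]] `<=` H by exact: itv_subH.
have ae_itv a b : 0 < a -> ae_eq mu [set` `[a, b]]
   (EFin \o (fun x => g x * f1 x + g' x * f0 x))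
   (EFin \o (fun x => g x * f' x + g' x * f x)).
  move=> a0; apply: aeS aeg => x e /(sub _ _ a0)/inH x0 /=.
  by rewrite e.
have mIe k (a b : R) : 0 < a -> measurable_fun H k ->
    measurable_fun ([set` `[a, b]] : set RL) (EFin \o k).
  move=> a0 mk; apply/measurable_EFinP; apply: measurable_funS mk.
    exact: measurableH.
  exact: sub.
have mI (a b : R) : measurable ([set` `[a, b]] : set RL) by exact: measurable_itv.
have m0 : measurable_fun H (fun x => g x * f1 x + g' x * f0 x).
  by apply: measurable_funD; apply: measurable_funM => //;
    [exact: acp_meas d1|exact: acp_meas d0].
split.
  apply: loc_itvP => // a b a0 _.
  have /integrableP[_ foo] := loc_itv b lg a0.
  apply/integrableP; split; first exact: mIe.
  apply: le_lt_trans foo; rewrite le_eqVlt; apply/orP; left; apply/eqP.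
  apply: ae_eq_integral => //.
  - by apply: measurableT_comp => //; exact: mIe.
  - by apply: measurableT_comp => //; exact: mIe.
  - by apply: aeS (ae_itv a b a0) => x e xab; congr (`| _ |)%E; exact/esym/e.
move=> a b a0 ab; rewrite df//; congr fine; apply: ae_eq_integral => //.
- exact: mIe.
- exact: mIe.
- exact: ae_itv.
Qed.

Lemma is_wderiv_lin c f g f' g' : is_wderiv f g -> is_wderiv f' g' ->
  is_wderiv (fun x => f x + c * f' x) (fun x => g x + c * g' x).
Proof.
move=> fg fg'; have [mf mg] := is_wderiv_meas fg.
have [mf' mg'] := is_wderiv_meas fg'.
move: fg fg' => /is_wderivP[_ [f0 ff0 d0]] /is_wderivP[_ [f1 ff1 d1]].
apply/is_wderivP; split.
  by apply: measurable_funD => //; exact: measurable_funM.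
exists (fun x => f0 x + c * f1 x); last exact: acp_lin.
by apply: ae2S ff0 ff1 => x e0 e1 x0; rewrite e0// e1.
Qed.

End wderiv.

(** * Riesz representation and completeness *)

Section riesz.
Context {R : realType} {V : Type}.
Variables (D : V -> Prop) (lin : V -> R -> V -> V).
Variables (B : V -> V -> R) (l : V -> R) (K : R).
Hypothesis Dlin : forall u c v, D u -> D v -> D (lin u c v).
Hypothesis Blin : forall u c v w, D u -> D v -> D w ->
  B (lin u c v) w = B u w + c * B v w.
Hypothesis Bsym : forall u v, D u -> D v -> B u v = B v u.
Hypothesis B_ge0 : forall u, D u -> 0 <= B u u.
Hypothesis llin : forall u c v, D u -> D v -> l (lin u c v) = l u + c * l v.
Hypothesis K_ge0 : 0 <= K.
Hypothesis l_bound : forall v, D v -> l v ^+ 2 <= K * B v v.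

(* w nearly minimises B(v,v) - 2 l(v); nothing is assumed about completeness. *)
Lemma riesz_sequence (v0 : V) (eps : nat -> R) : D v0 ->
  (forall n, 0 < eps n) -> exists w : nat -> V,
  [/\ forall n, D (w n), forall n, B (w n) (w n) <= 4 * K &
      forall n v, D v -> (B (w n) v - l v) ^+ 2 <= eps n * B v v].
Proof.
move=> Dv0 eps0; pose J v := B v v - 2 * l v.
(* V carries no zero vector; z plays its part, since J vanishes there. *)
pose z := lin v0 (-1) v0.
have Dz : D z by exact: Dlin.
have Jlin w t v : D w -> D v ->
    J (lin w t v) = J w + 2 * t * (B w v - l v) + t ^+ 2 * B v v.
  move=> Dw Dv; have Dl := Dlin t Dw Dv; rewrite /J Blin// llin//.
  by rewrite (Bsym Dw)// (Bsym Dv)// !Blin// (Bsym Dv Dw); ring.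
have Jz : J z = 0 by rewrite /J /z Blin// llin// Bsym// Blin//; ring.
have JK v : D v -> - K <= J v.
  move=> Dv; rewrite /J; have := B_ge0 Dv; have := l_bound Dv.
  set b := B v v; set a := l v => ab b0.
  have : `|2 * a| <= b + K.
    rewrite -(@ler_pXn2r _ 2)// ?nnegrE ?addr_ge0// real_normK ?num_real//.
    have := sqr_ge0 (b - K); nra.
  by rewrite ler_norml => /andP[_]; lra.
pose S := [set J v | v in D].
have hS : has_inf S by split; [exists (J z); exists z|exists (- K) => _ [v Dv <-]; exact: JK].
have Jm v : D v -> inf S <= J v by move=> Dv; apply: ge_inf hS.2 _ _; exists v.
have /choice[w hw] n : exists w, [/\ D w, J w <= 0 & J w <= inf S + eps n].
  have [_ [v Dv <-] hv] := inf_adherent (eps0 n) hS.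
  (* A near-minimiser with J > 0 is replaced by z, which does better. The sign J <= 0 means B(w,w)
     <= 2 l(w), and with the bound on l this gives B(w,w) <= 4 K. *)
  have [Jv|Jv] := leP (J v) 0; first by exists v; split => //; exact: ltW.
  by exists z; split; rewrite ?Jz//; exact/ltW/(lt_trans Jv).
exists w; split => [n|n|n v Dv]; first by case: (hw n).
  have [Dw Jw _] := hw n; have := l_bound Dw; have := B_ge0 Dw.
  move: Jw; rewrite /J; set b := B _ _; set a := l _ => h b0 ab.
  have [->|bn0] := eqVneq b 0; first by rewrite mulr_ge0.
  have b0' : 0 < b by rewrite lt_neqAle eq_sym bn0.
  by rewrite -(ler_pM2r b0'); nra.
(* J at w + t v is at least J(w) - eps for every t. The resulting quadratic in t has the residual
   B(w,v) - l(v) as its linear coefficient. *)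
have [Dw _ Jw] := hw n; apply: discriminant_ge0; last exact: B_ge0.
by move=> t; have := Jm _ (Dlin t Dw Dv); rewrite Jlin//; lra.
Qed.

(** With d = w m - w n, B(d,d) is the difference of the residuals of w m and w n at d. Each squared
    residual is at most eps B(d,d), so one factor B(d,d) can be divided out. *)
Lemma riesz_cauchy (w : nat -> V) (eps : nat -> R) : (forall n, D (w n)) ->
  (forall n, 0 < eps n) ->
  (forall n v, D v -> (B (w n) v - l v) ^+ 2 <= eps n * B v v) ->
  forall m n, B (lin (w m) (-1) (w n)) (lin (w m) (-1) (w n)) <= 2 * (eps m + eps n).
Proof.
move=> Dw eps0 hw m n; set d := lin _ _ _.
have Dd : D d by exact: Dlin.
have := hw m _ Dd; have := hw n _ Dd; have := B_ge0 Dd.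
have : B d d = B (w m) d - B (w n) d by rewrite {1}/d Blin//; ring.
set x := B (w m) d; set y := B (w n) d; set b := B d d; set a := l d.
move=> bE b0 hn hm; have [->|bn0] := eqVneq b 0.
  by rewrite mulr_ge0// addr_ge0// ltW.
have b0' : 0 < b by rewrite lt_neqAle eq_sym bn0.
rewrite -(ler_pM2r b0'); rewrite {1}bE.
have := sqr_ge0 ((x - a) + (y - a)); nra.
Qed.

End riesz.

(** * Completeness of the weighted space *)

Section riesz_fischer.
Context {R : realType}.
Local Notation mu := (@lebesgue_measure R).
Local Notation RL := (g_sigma_algebraType (R.-ocitv.-measurable)).
Local Notation H := (halfline R).
Implicit Types f : nat -> R -> R.

Lemma sum_half_le (n : nat) : \sum_(0 <= i < n) (2^-1 : R) ^+ i <= 2.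
Proof.
suff : \sum_(0 <= i < n) (2^-1 : R) ^+ i = 2 - 2 * 2^-1 ^+ n.
  by move=> ->; rewrite gerBl mulr_ge0// exprn_ge0// invr_ge0.
elim: n => [|n IH]; first by rewrite big_geq// expr0; ring.
by rewrite big_nat_recr//= IH exprS; field.
Qed.

(** Since |d| <= 2^-i + 2^i d^2 for the i-th increment d, the increments are absolutely summable. *)
Lemma cvg_of_weighted_squares (u : nat -> R) (M : R) :
  (forall n, \sum_(0 <= i < n) 2 ^+ i * (u i.+1 - u i) ^+ 2 <= M) -> cvgn u.
Proof.
move=> hM.
have sum_le n : \sum_(0 <= i < n) `|telescope u i| <= 2 + M.
  apply: le_trans (_ : \sum_(0 <= i < n) (2^-1 ^+ i + 2 ^+ i * (u i.+1 - u i) ^+ 2) <= _).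
    apply: ler_sum => i _; rewrite /telescope; set d := u _ - _.
    rewrite -[d ^+ 2]real_normK ?num_real//; set a := `|d|.
    have p0 : 0 < (2 : R) ^+ i by rewrite exprn_gt0.
    rewrite exprVn -(ler_pM2l p0) mulrDr mulfV ?gt_eqF//.
    have := sqr_ge0 (2 ^+ i * a - 1); set p : R := 2 ^+ i; nra.
  by rewrite big_split/= lerD// sum_half_le.
have cs : cvgn (series (telescope u)).
  apply: normed_cvg; rewrite /normed_series_of seriesEnat.
  apply: nondecreasing_is_cvgn.
    by apply/nondecreasing_seqP => n /=; rewrite big_nat_recr//= lerDl.
  by exists (2 + M) => _ [n _ <-]; exact: sum_le.
rewrite (_ : u = fun n => u 0%N + series (telescope u) n); last first.
  by apply/funext => n; rewrite -eq_sum_telescope.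
by apply: is_cvgD => //; exact: is_cvg_cst.
Qed.

(** The weight 2^n sits between the two requirements: against the decay 4^-n it leaves a convergent
    series of integrals, so the weighted sum of squared increments is finite almost everywhere, and
    pointwise it forces convergence. *)
Lemma L2_fast_cauchy_cvg f (C : R) : (forall n, L2 (f n)) -> 0 <= C ->
  (forall n, nsq (fun x => f n.+1 x - f n x) <= C * (4^-1) ^+ n) ->
  {ae mu, forall x, 0 < x -> cvgn (f^~ x)}.
Proof.
move=> Lf C0 hC.
pose d n x := 2 ^+ n * ((f n.+1 x - f n x) ^+ 2 * x).
have id n : itg (d n) by apply: itgZ; exact: (L2B (Lf n.+1) (Lf n)).2.
have d0 n x : 0 < x -> 0 <= d n x.
  by move=> x0; rewrite mulr_ge0 ?exprn_ge0// mulr_ge0 ?sqr_ge0// ltW.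
pose G x := (\sum_(n <oo) (d n x)%:E)%E.
have md n : measurable_fun H (fun x => (d n x)%:E).
  by apply/measurable_EFinP; exact: itg_meas.
have mG : measurable_fun H G.
  apply: ge0_emeasurable_sum => // n x Hx _.
  by rewrite lee_fin d0//; apply/inH.
have mH : measurable (H : set RL) by exact: measurable_itv.
have iG : mu.-integrable H G.
  apply/integrableP; split => //.
  rewrite (_ : integral _ _ _ = \int[mu]_(x in H) G x)%E; last first.
    apply: eq_integral => x /set_mem/inH x0; rewrite gee0_abs//.
    by apply: nneseries_ge0 => n _ _; rewrite lee_fin d0.
  rewrite integral_nneseries//; last first.
    by move=> n x /inH x0; rewrite lee_fin d0.
  apply: (@le_lt_trans _ _ (C * 2)%:E); last by rewrite ltry.
  apply: lime_le.
    by apply: is_cvg_nneseries => n _ _; apply: integral_ge0 => x /inH x0; rewrite lee_fin d0.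
  apply: nearW => n.
  under eq_bigr do rewrite -EFin_II//.
  rewrite sumEFin lee_fin.
  apply: le_trans (_ : \sum_(0 <= i < n) C * 2^-1 ^+ i <= _).
    apply: ler_sum => i _; rewrite IIZ; last exact: (L2B (Lf i.+1) (Lf i)).2.
    apply: le_trans (ler_wpM2l _ (hC i)) _; first by rewrite exprn_ge0.
    rewrite mulrCA ler_wpM2l// -exprMn.
    by have -> : 2 * 4^-1 = 2^-1 :> R by field.
  by rewrite -mulr_sumr ler_wpM2l// sum_half_le.
have := integrable_ae mH iG; apply: aeS => x fG x0.
have {}fG := fG ((inH x).2 x0).
apply: (@cvg_of_weighted_squares _ (fine (G x) / x)) => n.
rewrite ler_pdivlMr// -lee_fin fineK//.
apply: le_trans (nneseries_lim_ge n _); last by move=> m _ _; rewrite lee_fin d0.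
rewrite sumEFin lee_fin mulr_suml le_eqVlt; apply/orP; left; apply/eqP.
by apply: eq_bigr => i _; rewrite /d mulrA.
Qed.

Lemma fatou_nsq f (F : R -> R) (c : R) : (forall n, L2 (f n)) ->
  measurable_fun H F ->
  {ae mu, forall x, 0 < x -> f^~ x @ \oo --> F x} ->
  (\forall n \near \oo, nsq (f n) <= c) -> L2 F /\ nsq F <= c.
Proof.
move=> Lf mF cf fc.
have mH : measurable (H : set RL) by exact: measurable_itv.
pose h n x := ((f n x) ^+ 2 * x)%:E.
have mh n : measurable_fun H (h n).
  by apply/measurable_EFinP; apply: itg_meas; exact: (Lf n).2.
have h0 n x : H x -> (0 <= h n x)%E.
  by move=> /inH x0; rewrite lee_fin mulr_ge0 ?sqr_ge0// ltW.
have mF2 : measurable_fun H (fun x => F x ^+ 2 * x).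
  by apply: measurable_funM => //; exact: measurable_funX.
have key : (\int[mu]_(x in H) (F x ^+ 2 * x)%:E <= c%:E)%E.
  apply: le_trans (_ : limn_einf (fun n => \int[mu]_(x in H) h n x) <= _)%E; last first.
    rewrite limn_einf_lim; apply: lime_le; first exact: is_cvg_einfs.
    case: fc => N _ fc; near=> n.
    apply: (@le_trans _ _ (\int[mu]_(x in H) h n x)%E).
      by apply: ereal_inf_lbound; exists n => //=.
    rewrite -EFin_II; last exact: (Lf n).2.
    by rewrite lee_fin; apply: fc => /=; near: n; exact: nbhs_infty_ge.
  have mh' n : measurable_fun (H : set RL) (h n) by exact: mh.
  have := fatou mu mH mh' h0; apply: le_trans.
  rewrite le_eqVlt; apply/orP; left; apply/eqP; apply: ae_eq_integral => //.
  - exact/measurable_EFinP.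
  - rewrite /limn_einf; apply: measurableT_comp => //.
    by apply: measurable_fun_limn_esup => n; apply: measurableT_comp => //; exact: mh'.
  apply: aeS cf => x cfx /inH x0.
  have : (h n x) @[n --> \oo] --> (F x ^+ 2 * x)%:E.
    apply: cvg_EFin; first exact: nearW.
    by apply: cvgMl; rewrite /=; apply: cvgM; exact: cfx.
  by move=> hl; rewrite is_cvg_limn_einfE; [apply/esym/cvg_lim|apply/cvg_ex; eexists; exact: hl].
have LF : L2 F.
  split => //; apply: itg_lty => //; last by apply: le_lt_trans key _; rewrite ltry.
  by move=> x x0; rewrite mulr_ge0 ?sqr_ge0// ltW.
by split => //; rewrite -lee_fin EFin_II//; exact: LF.2.
Unshelve. all: by end_near. Qed.

(** Fatou in m, with n fixed. The pointwise limit F is prescribed, so that the limits of w/x and xb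
    w can be identified with W/x and xb W once w tends to W. *)
Lemma L2_cauchy_limit f (F : R -> R) (C : R) : (forall n, L2 (f n)) -> 0 <= C ->
  measurable_fun H F -> {ae mu, forall x, 0 < x -> f^~ x @ \oo --> F x} ->
  (forall m n, nsq (fun x => f m x - f n x) <= C * (4^-1 ^+ m + 4^-1 ^+ n)) ->
  L2 F /\ forall n, nsq (fun x => f n x - F x) <= 2 * C * 4^-1 ^+ n.
Proof.
move=> Lf C0 mF cf hC.
have bnd n : L2 (fun x => f n x - F x) /\
   nsq (fun x => f n x - F x) <= 2 * C * 4^-1 ^+ n.
  apply: (@fatou_nsq (fun m x => f n x - f m x)).
  - by move=> m; exact: L2B.
  - by apply: measurable_funB => //; exact: (Lf n).1.
  - by apply: aeS cf => x cfx x0; apply: cvgB; [exact: cvg_cst|exact: cfx].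
  - exists n => // m /= nm; apply: le_trans (hC _ _) _.
    rewrite -mulrA mulrCA ler_wpM2l// mulr_natl mulr2n lerD//.
    by apply: ler_wiXn2l nm; lra.
split; last by move=> n; have [] := bnd n.
by have := L2B (Lf 0%N) (bnd 0%N).1; apply: eq_L2 => x _; rewrite opprB addrC subrK.
Qed.

Lemma L2_complete f (C : R) : (forall n, L2 (f n)) -> 0 <= C ->
  (forall m n, nsq (fun x => f m x - f n x) <= C * (4^-1 ^+ m + 4^-1 ^+ n)) ->
  exists F, [/\ L2 F, {ae mu, forall x, 0 < x -> f^~ x @ \oo --> F x} &
    forall n, nsq (fun x => f n x - F x) <= 2 * C * 4^-1 ^+ n].
Proof.
move=> Lf C0 hC.
have : {ae mu, forall x, 0 < x -> cvgn (f^~ x)}.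
  apply: (@L2_fast_cauchy_cvg f (2 * C)) => //; first by rewrite mulr_ge0.
  move=> n; apply: le_trans (hC _ _) _; rewrite -mulrA mulrCA ler_wpM2l//.
  rewrite mulr_natl mulr2n lerD// exprS ler_piMl ?exprn_ge0//.
  by lra.
move=> [N [mN N0 sub]].
(* Set to 0 on the exceptional null set, the sequence converges at every point of (0,oo), which
   makes the pointwise limit measurable. *)
pose g n := f n \_ (~` N).
have fg n x : ~ N x -> g n x = f n x by move=> nN; rewrite /g patchE mem_set.
have cg x : 0 < x -> cvgn (g^~ x).
  move=> x0; have [Nx|nN] := pselect (N x).
    rewrite (_ : g^~ x = fun=> 0); first exact: is_cvg_cst.
    by apply/funext => n; rewrite /g patchE memNset//=; apply.
  rewrite (_ : g^~ x = f^~ x); last by apply/funext => n; exact: fg.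
  by apply: contrapT => nc; apply: nN; apply: sub => /(_ x0).
have mg n : measurable_fun H (g n).
  have mf := (Lf n).1.
  apply/measurable_restrict => //; first exact: measurableC.
  apply: measurable_funS mf; first exact: measurableH.
  exact: subIsetl.
pose F x := limn (g^~ x).
have mF : measurable_fun H F.
  by apply: (measurable_fun_cvg mg) => x /inH/cg.
have aeN (P : R -> Prop) : (forall x, ~ N x -> 0 < x -> P x) ->
    {ae mu, forall x, 0 < x -> P x}.
  move=> PN; exists N; split => // x /= nP; apply: contrapT => nN.
  by apply: nP => x0; exact: PN.
have cf : {ae mu, forall x, 0 < x -> f^~ x @ \oo --> F x}.
  apply: aeN => x nN x0; rewrite (_ : f^~ x = g^~ x); last first.
    by apply/funext => n; rewrite fg.
  exact: cg.
by have [LF bnd] := L2_cauchy_limit Lf C0 mF cf hC; exists F.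
Qed.

End riesz_fischer.

(** * Integrals over the half-line and the sup bound on X *)

Section halfline_integrals.
Context {R : realType}.
Local Notation mu := (@lebesgue_measure R).
Local Notation RL := (g_sigma_algebraType (R.-ocitv.-measurable)).
Local Notation H := (halfline R).
Implicit Types f g h : R -> R.

Let mH : measurable (H : set RL). Proof. exact: measurable_itv. Qed.

Lemma near_natS_gt (y : R) : \forall n \near \oo, y < n.+1%:R.
Proof.
exists (Num.truncn y) => // n /= yn; apply: lt_le_trans (truncnS_gt y) _.
by rewrite ler_nat ltnS.
Qed.

Lemma itg_le_ae f g : measurable_fun H f ->
  {ae mu, forall x, 0 < x -> `|f x| <= g x} -> itg g -> itg f.
Proof.
move=> mf fg /integrableP[mg goo]; apply/integrableP; split.
  exact/measurable_EFinP.
apply: le_lt_trans goo; apply: ae_ge0_le_integral => //.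
- by apply: measurableT_comp => //; exact/measurable_EFinP.
- by apply: measurableT_comp => //; exact/measurable_EFinP.
- by apply: aeS fg => x fg /inH x0; rewrite /= lee_fin (le_trans (fg x0))// ler_norm.
Qed.

(** The comparison goes through max(f, g), which dominates f at every point and equals g almost
    everywhere. *)
Lemma le_II_ae f g : itg f -> itg g ->
  {ae mu, forall x, 0 < x -> f x <= g x} -> II f <= II g.
Proof.
move=> If Ig fg; have mf := itg_meas If; have mg := itg_meas Ig.
have IM : itg (fun x => Num.max (f x) (g x)).
  apply: itg_le (itgD (integrable_norm If) (integrable_norm Ig)).
    exact: measurable_maxr.
  move=> x _ /=; rewrite /Num.max; case: ifP => _; first by rewrite lerDr.
  by rewrite lerDl.
apply: (@le_trans _ _ (II (fun x => Num.max (f x) (g x)))).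
  by apply: le_II => // x _; rewrite le_max lexx.
rewrite le_eqVlt; apply/orP; left; apply/eqP; apply: ae_II => //.
  exact: measurable_maxr.
by apply: aeS fg => x fg x0; rewrite max_r// fg.
Qed.

Lemma L2_dom_ae c f g : measurable_fun H f ->
  {ae mu, forall x, 0 < x -> `|f x| <= c * `|g x|} -> L2 g -> L2 f.
Proof.
move=> mf fg [mg Ig]; split => //; apply: itg_le_ae (itgZ (c ^+ 2) Ig).
  by apply: measurable_funM => //; exact: measurable_funX.
apply: aeS fg => x fg x0.
rewrite normrM (gtr0_norm x0) mulrA ler_pM2r// normrX.
rewrite -[g x ^+ 2]real_normK ?num_real// -exprMn lerXn2r ?nnegrE ?fg//.
exact: le_trans (fg x0).
Qed.

Lemma Rint_II f a b : 0 < a ->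
  \int[mu]_(x in `[a, b]) f x = II (fun x => f x * \1_[set` `[a, b]] x).
Proof.
move=> a0; rewrite (_ : [set` `[a, b]] = H `&` [set` `[a, b]]); last first.
  by apply/seteqP; split => [x abx|x []//]; split => //; exact: itv_subH abx.
rewrite Rintegral_mkcondr; apply: eq_II => x x0.
rewrite patchE indicE; case: ifPn => /= xab.
  suff -> : x \in H `&` [set` `[a, b]] by rewrite mulr1.
  by rewrite inE; split; [exact/inH|exact/set_mem].
suff /negbTE -> : x \notin H `&` [set` `[a, b]] by rewrite mulr0.
by apply: contra xab; rewrite !inE => -[].
Qed.

Lemma itg_itv f a b : 0 < a -> itg f -> mu.-integrable `[a, b] (EFin \o f).
Proof.
by move=> a0; apply: integrableS => //; exact: itv_subH.
Qed.

Lemma itg_indic f a b : measurable_fun H f -> mu.-integrable `[a, b] (EFin \o f) ->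
  0 < a -> itg (fun x => f x * \1_[set` `[a, b]] x).
Proof.
move=> mf If a0.
have mab : measurable ([set` `[a, b]] : set RL) by exact: measurable_itv.
have : mu.-integrable H ((EFin \o f) \_ [set` `[a, b]]).
  apply/integrable_restrict => //; apply: integrableS If => //.
  exact: measurableI.
apply: eq_integrable => // x _; rewrite patchE /= indicE.
by case: ifPn => xab; rewrite /= ?mulr1 ?mulr0.
Qed.

Lemma II_cvg f : itg f ->
  \int[mu]_(x in `[n.+1%:R^-1, n.+1%:R]) f x @[n --> \oo] --> II f.
Proof.
move=> If; have mf := itg_meas If.
pose a n : R := n.+1%:R^-1; pose b n : R := n.+1%:R.
have a0 n : 0 < a n by rewrite invr_gt0.
pose fn n x := (f x * \1_[set` `[a n, b n]] x)%:E.
have Ifn n : itg (fun x => f x * \1_[set` `[a n, b n]] x).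
  by apply: itg_indic => //; exact: itg_itv.
have cf : {ae mu, forall x, H x -> fn ^~ x @ \oo --> (f x)%:E}.
  apply: aeW => x /inH x0; apply: cvg_EFin; first exact: nearW.
  apply: cvg_near_cst; near=> n.
  rewrite /fn /= indicE mem_set ?mulr1// /= in_itv/=; apply/andP; split.
    rewrite -[x]invrK /a lef_pV2 ?posrE ?invr_gt0//.
    by apply: ltW; near: n; exact: near_natS_gt.
  by apply: ltW; near: n; exact: near_natS_gt.
have [] := @dominated_convergence _ RL R mu H mH fn (EFin \o f)
  (fun x => `|f x|%:E) _ _ cf _ _.
- by move=> n; apply/measurable_EFinP; exact: itg_meas.
- exact/measurable_EFinP.
- exact: integrable_norm.
- apply: aeW => x n Hx; rewrite /fn /= lee_fin normrM ler_piMr//.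
  by rewrite indicE; case: (_ \in _); rewrite /= ?normr1 ?normr0.
move=> _ _; rewrite (_ : integral _ _ _ = (II f)%:E); last by rewrite EFin_II.
move=> /fine_cvg.
apply: cvg_trans; apply: near_eq_cvg; apply: nearW => n /=.
by rewrite Rint_II.
Unshelve. all: by end_near. Qed.

Lemma Rint_le_II f a b : 0 < a -> itg f -> (forall x, 0 < x -> 0 <= f x) ->
  \int[mu]_(x in `[a, b]) f x <= II f.
Proof.
move=> a0 If f0; rewrite Rint_II//; apply: le_II => //.
  by apply: itg_indic; [exact: itg_meas|exact: itg_itv|].
by move=> x x0; rewrite ler_piMr ?f0// indicE.
Qed.

(** Over [1/(n+1), n+1] the integral is a difference of two values of the continuous representative.
    Both are 0 as soon as the interval extends beyond the support on either side. *)
Lemma is_wderiv_II0 v g : is_wderiv v g -> compactly_supported v -> itg g ->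
  II g = 0.
Proof.
move=> /is_wderivP[_ [v0 vv0 dv]] [a [b [a0 ab vab]]] Ig.
have z0 : acp (fun=> 0 : R) (fun=> 0 : R).
  by apply: acp_ext (acp_lin (-1) dv dv) => x _; rewrite mulN1r subrr.
have z1 x : 0 < x < a -> v0 x = 0.
  apply: (acp_ae_eq_itv dv z0) => //; apply: aeS vv0 => y e /andP[y0 ya].
  by rewrite -e// vab// in_itv/= leNgt ya.
have z2 x : b < x -> v0 x = 0.
  move=> bx; apply: (@acp_ae_eq_itv _ _ _ _ _ b (x + 1) dv z0).
  - by apply: ltW; exact: lt_le_trans ab.
  - apply: aeS vv0 => y e /andP[yb _].
    have y0 : 0 < y by apply: lt_trans yb; exact: lt_le_trans ab.
    by rewrite -e// vab// in_itv/= [y <= _]leNgt yb andbF.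
  - by rewrite bx ltrDl/=.
have /cvg_lim <- // := II_cvg Ig; apply/cvg_lim => //.
apply: cvg_near_cst; near=> n.
have n1 : n.+1%:R^-1 < a.
  rewrite -[a]invrK ltf_pV2 ?posrE ?invr_gt0//.
  by near: n; exact: near_natS_gt.
have n2 : b < n.+1%:R by near: n; exact: near_natS_gt.
rewrite -dv.2 ?invr_gt0//; last first.
  by apply/ltW/(lt_trans n1)/(le_lt_trans ab).
by rewrite z2// z1 ?subrr// n1 invr_gt0 ltr0n.
Unshelve. all: by end_near. Qed.

(** Let Q be the squared X norm. As |(v^2)'| <= (g^2 + (v/z)^2) z, the function v^2 drops by at most
    Q to the right of any point. A value above 3 Q at x would keep v^2 above 2 Q from x on, which is
    too much for the integral of v^2/z. *)
Lemma sup_bound v g : is_wderiv v g -> L2 g -> L2 (fun x => v x / x) ->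
  {ae mu, forall x, 0 < x -> v x ^+ 2 <= 3 * (nsq g + nsq (fun x => v x / x))}.
Proof.
move=> vg Lg Lv; have [mv mg] := is_wderiv_meas vg.
move: vg => /is_wderivP[_ [v0 vv0 dv]].
have mv0 := acp_meas dv.
have Lv0 : L2 (fun x => v0 x / x).
  apply: (ae_L2 _ _ Lv).
    apply: measurable_funM => //; apply: continuousH_meas => x x0.
    by apply: inv_continuous; rewrite gt_eqF.
  by apply: aeS vv0 => x e x0; rewrite e.
set Q := nsq g + _.
have QE : Q = nsq g + nsq (fun x => v0 x / x).
  congr (_ + _); apply: ae_nsq; [exact: Lv.1|exact: Lv0.1|].
  by apply: aeS vv0 => x e x0; rewrite e.
suff key x : 0 < x -> v0 x ^+ 2 <= 3 * Q.
  by apply: aeS vv0 => x e x0; rewrite e// key.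
move=> x0; have [//|vQ] := leP; exfalso.
have IQ : itg (fun x => g x ^+ 2 * x + (v0 x / x) ^+ 2 * x).
  by apply: itgD; [exact: Lg.2|exact: Lv0.2].
have QII : Q = II (fun x => g x ^+ 2 * x + (v0 x / x) ^+ 2 * x).
  by rewrite QE -IID; [|exact: Lg.2|exact: Lv0.2].
have osc y : x <= y -> v0 x ^+ 2 - Q <= v0 y ^+ 2.
  move=> xy; rewrite lerBlDr -lerBlDl -opprB !expr2.
  rewrite (acpM dv dv).2//; apply: le_trans (ler_norm _) _; rewrite normrN.
  have Ivv := acp_itv y (acpM dv dv) x0.
  apply: le_trans (le_normr_Rintegral _ Ivv) _; first exact: measurable_itv.
  rewrite QII; apply: le_trans (Rint_le_II y x0 IQ _); last first.
    by move=> z z0; rewrite addr_ge0// mulr_ge0 ?sqr_ge0// ltW.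
  apply: le_Rintegral.
  - exact: measurable_itv.
  - exact: integrable_norm.
  - exact: itg_itv.
  - move=> z /(itv_subH x0)/inH z0.
    have -> : g z * v0 z + g z * v0 z = 2 * (g z * (v0 z / z)) * z.
      by field; rewrite gt_eqF.
    rewrite normrM (gtr0_norm z0) -mulrDl ler_pM2r//.
    have := sqr_ge0 (g z - v0 z / z); have := sqr_ge0 (g z + v0 z / z).
    rewrite ler_norml; set t := v0 z / z; move=> h1 h2; apply/andP; split; nra.
have Q0 : 0 <= Q by rewrite addr_ge0// nsq_ge0.
have c0 : 2 * Q < v0 x ^+ 2 - Q by lra.
set c := v0 x ^+ 2 - Q in osc c0.
(* On [x, 3x], of length 2x, the integrand v^2/z is at least c/(3x). Together with c > 2 Q this
   would give Q > 4/3 Q. *)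
have : c * (2 / 3) <= Q.
  have x3 : x <= 3 * x by lra.
  have dl : acp (fun t => c / (3 * x) * t) (fun=> c / (3 * x)).
    apply: acp_C1 => t _; last exact: cst_continuous.
    have := is_deriveZ (c / (3 * x)) (is_derive_id t (1 : R)).
    by rewrite /GRing.scale/= mulr1.
  have -> : c * (2 / 3) = \int[mu]_(t in `[x, 3 * x]) (c / (3 * x)).
    by rewrite -dl.2//; field; rewrite gt_eqF.
  rewrite QII; apply: le_trans (Rint_le_II (3 * x) x0 IQ _); last first.
    by move=> z z0; rewrite addr_ge0// mulr_ge0 ?sqr_ge0// ltW.
  apply: le_Rintegral.
  - exact: measurable_itv.
  - exact: acp_itv dl x0.
  - exact: itg_itv.
  - move=> z zi; have z0 : 0 < z by move: zi => /(itv_subH x0)/inH.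
    move: zi; rewrite /= in_itv/= => /andP[xz z3].
    have -> : (v0 z / z) ^+ 2 * z = v0 z ^+ 2 / z by field; rewrite gt_eqF.
    apply: (@le_trans _ _ (v0 z ^+ 2 / z)); last first.
      by rewrite lerDr mulr_ge0 ?sqr_ge0// ltW.
    have vc := osc _ xz; have cp : 0 < c by lra.
    rewrite ler_pdivrMr ?mulr_gt0// mulrAC ler_pdivlMr//.
    by apply: ler_pM => //; [exact: ltW|exact: ltW].
lra.
Qed.

End halfline_integrals.

(** * Coercivity *)

Section coercivity.
Context {R : realType}.
Local Notation mu := (@lebesgue_measure R).
Local Notation H := (halfline R).
Variable r : R.
Hypothesis r0 : 0 < r.
Implicit Types v g xi : R -> R.

Definition potc (x : R) : R := (x ^+ 2 - 4 * r ^+ 2) / (x ^+ 2 + 4 * r ^+ 2).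
Definition xi0 (x : R) : R := 4 * r / Num.sqrt (x ^+ 2 + 4 * r ^+ 2).
(** [opF] with the weak derivative as an explicit argument g, and the cosine in rational form. *)
Definition Fp v g (x : R) : R := g x + potc x / x * v x.

Lemma den_gt0 (x : R) : 0 < x ^+ 2 + 4 * r ^+ 2.
Proof. by rewrite ltr_wpDl ?sqr_ge0// mulr_gt0// exprn_gt0. Qed.

Lemma potc_norm (x : R) : `|potc x| <= 1.
Proof.
have d := den_gt0 x; rewrite normrM normfV (gtr0_norm d) ler_pdivrMr// mul1r.
rewrite ler_norml; have := sqr_ge0 x; have := sqr_ge0 r.
by move=> h1 h2; apply/andP; split; nra.
Qed.

Lemma cos_theta (x : R) : cos (theta r x) = potc x.
Proof.
rewrite /theta acosK// in_itv/=.
by have := potc_norm x; rewrite ler_norml.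
Qed.

Lemma den_continuous (x : R) : {for x, continuous (fun x : R => x ^+ 2 + 4 * r ^+ 2)}.
Proof. by apply: cvgD; [exact: exprn_continuous|exact: cvg_cst]. Qed.

Lemma potc_continuous (x : R) : {for x, continuous potc}.
Proof.
apply: cvgM; last first.
  by apply: cvgV; [rewrite gt_eqF ?den_gt0|exact: den_continuous].
by apply: cvgB; [exact: exprn_continuous|exact: cvg_cst].
Qed.

Lemma is_derive_potc (x : R) :
  is_derive x 1 potc (16 * r ^+ 2 * x / (x ^+ 2 + 4 * r ^+ 2) ^+ 2).
Proof.
have d0 : x ^+ 2 + 4 * r ^+ 2 != 0 by rewrite gt_eqF ?den_gt0.
have -> : potc = (fun x => 1 - 8 * r ^+ 2 * (x ^+ 2 + 4 * r ^+ 2)^-1).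
  apply/funext => y; have := den_gt0 y; rewrite /potc => dy.
  by field; rewrite gt_eqF.
apply: is_derive_eq; rewrite /GRing.scale/=.
by field.
Qed.

Lemma xi0_continuous (x : R) : {for x, continuous xi0}.
Proof.
apply: cvgM; first exact: cvg_cst.
apply: cvgV; first by rewrite gt_eqF// sqrtr_gt0 den_gt0.
by apply: continuous_comp; [exact: den_continuous|exact: sqrt_continuous].
Qed.

Lemma xi0_sqr (x : R) : xi0 x ^+ 2 = 16 * r ^+ 2 / (x ^+ 2 + 4 * r ^+ 2).
Proof.
rewrite exprMn exprVn sqr_sqrtr; last exact/ltW/den_gt0.
by congr (_ / _); ring.
Qed.

Lemma xi0_sqr_le (x : R) : xi0 x ^+ 2 <= 4.
Proof.
by rewrite xi0_sqr ler_pdivrMr ?den_gt0//; have := sqr_ge0 x; nra.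
Qed.

Lemma xibar_meas xi : measurable_fun H xi -> measurable_fun H (xibar r xi).
Proof.
move=> mxi; apply: measurable_funD => //.
by apply: continuousH_meas => x _; exact: xi0_continuous.
Qed.

Lemma inv_meas : measurable_fun H (fun x : R => x^-1).
Proof.
by apply: continuousH_meas => x x0; apply: inv_continuous; rewrite gt_eqF.
Qed.

Lemma id_meas : measurable_fun H (fun x : R => x).
Proof. exact: measurable_id. Qed.

Lemma Fp_L2 v g : L2 g -> L2 (fun x => v x / x) -> L2 (Fp v g).
Proof.
move=> Lg Lv; apply: L2D => //.
suff : L2 (fun x => potc x * (v x / x)).
  by apply: eq_L2 => x _; rewrite [v x / x]mulrC mulrA.
apply: (L2_dom (c := 1)) (Lv).
  apply: measurable_funM; last exact: Lv.1.
  by apply: continuousH_meas => x _; exact: potc_continuous.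
by move=> x _; rewrite normrM ler_wpM2r// potc_norm.
Qed.

(** [potV x * x] is the sum of (1 - potc^2)/x and the derivative of [potc]; the two are equal, each
    being 16 r^2 x / (x^2 + 4 r^2)^2. *)
Definition potV (x : R) : R := 32 * r ^+ 2 / (x ^+ 2 + 4 * r ^+ 2) ^+ 2.

(** (x^2 + 4 r^2)^2 >= 16 r^2 x^2, so [potV x] is at most 2/x^2. *)
Lemma potV_itg v : measurable_fun H v -> L2 (fun x => v x / x) ->
  itg (fun x => potV x * v x ^+ 2 * x).
Proof.
move=> mv Lv; apply: itg_le (itgZ 2 Lv.2).
  apply: measurable_funM; last exact: id_meas.
  apply: measurable_funM; last exact: measurable_funX.
  apply: continuousH_meas => x _; apply: cvgM; first exact: cvg_cst.
  apply: cvgV; first by rewrite expf_neq0// gt_eqF ?den_gt0.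
  by apply: cvgM; exact: den_continuous.
move=> x x0; have d := den_gt0 x; set t := v x / x.
have -> : v x = t * x by rewrite /t divfK// gt_eqF.
rewrite normrM (gtr0_norm x0) mulrA ler_pM2r// ger0_norm; last first.
  by rewrite mulr_ge0 ?sqr_ge0// divr_ge0 ?sqr_ge0// mulr_ge0 ?sqr_ge0.
rewrite /potV mulrAC ler_pdivrMr ?exprn_gt0//.
have -> : 32 * r ^+ 2 * (t * x) ^+ 2 = t ^+ 2 * (32 * (r ^+ 2 * x ^+ 2)) by ring.
rewrite (_ : 2 * t ^+ 2 * _ = t ^+ 2 * (2 * (x ^+ 2 + 4 * r ^+ 2) ^+ 2)); last by ring.
rewrite ler_wpM2l ?sqr_ge0//.
by have := sqr_ge0 (x ^+ 2 - 4 * r ^+ 2); nra.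
Qed.

(* The cross term of (Fv)^2 x is the derivative of cos(theta) v^2 up to
   - cos(theta)' v^2, and compact support kills the boundary terms. *)
Lemma nsq_Fp v g : is_wderiv v g -> L2 g -> L2 (fun x => v x / x) ->
  compactly_supported v ->
  nsq (Fp v g) = nsq g + nsq (fun x => v x / x)
                 - II (fun x => potV x * v x ^+ 2 * x).
Proof.
move=> vg Lg Lv cv; have [mv mg] := is_wderiv_meas vg.
have Ac : is_wderiv potc (fun x => 16 * r ^+ 2 * x / (x ^+ 2 + 4 * r ^+ 2) ^+ 2).
  apply: acp_wderiv; apply: acp_C1 => x _; first exact: is_derive_potc.
  apply: cvgM; first by apply: cvgM; [exact: cvg_cst|exact: cvg_id].
  apply: cvgV; first by rewrite expf_neq0// gt_eqF ?den_gt0.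
  by apply: cvgM; exact: den_continuous.
have Aw := is_wderivM Ac (is_wderivM vg vg).
set w' := (fun x => _ * (v x * v x) + _) in Aw.
have LF := Fp_L2 Lg Lv.
have Vi := potV_itg mv Lv.
have w'E x : 0 < x -> Fp v g x ^+ 2 * x
    - (g x ^+ 2 * x + (v x / x) ^+ 2 * x - potV x * v x ^+ 2 * x) = w' x.
  move=> x0; rewrite /Fp /w' /potV /potc; have := den_gt0 x => d.
  by field; rewrite !gt_eqF.
have I3 : itg (fun x => g x ^+ 2 * x + (v x / x) ^+ 2 * x - potV x * v x ^+ 2 * x).
  by apply: itgB => //; apply: itgD; [exact: Lg.2|exact: Lv.2].
have Iw : itg w' by apply: eq_itg w'E (itgB LF.2 I3).
have cw : compactly_supported (fun x => potc x * (v x * v x)).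
  case: cv => [a [b [a0 ab vab]]]; exists a, b; split => // x x0 xab.
  by rewrite vab// !mulr0.
have := is_wderiv_II0 Aw cw Iw.
rewrite -(eq_II w'E) IIB//; last exact: LF.2.
rewrite IIB//; last by apply: itgD; [exact: Lg.2|exact: Lv.2].
rewrite IID; [|exact: Lg.2|exact: Lv.2].
by move/eqP; rewrite subr_eq0 => /eqP.
Qed.

(** Write D = x^2 + 4 r^2, Z = [xi0 x], X = [xi x]. Then potV = 2 Z^2 / D and Z^2 <= 2 (X + Z)^2 + 2
    X^2. In the first term D >= 4 r^2 gives the coefficient 1/r^2 of xb^2; in the second D >= x^2
    and X^2 <= 1/8 give at most half of (v/x)^2, which is absorbed on the left. Doubling then
    produces the constants. *)
Lemma coercive xi v g : measurable_fun H xi ->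
  {ae mu, forall x, 0 < x -> xi x ^+ 2 <= 8^-1} ->
  is_wderiv v g -> L2 g -> L2 (fun x => v x / x) ->
  L2 (fun x => xibar r xi x * v x) -> compactly_supported v ->
  nsq g + nsq (fun x => v x / x) <=
  2 * nsq (Fp v g) + 2 / r ^+ 2 * nsq (fun x => xibar r xi x * v x).
Proof.
move=> mxi bxi vg Lg Lv Lxv cv; have [mv mg] := is_wderiv_meas vg.
have Vi := potV_itg mv Lv.
have Vle : II (fun x => potV x * v x ^+ 2 * x) <=
    1 / r ^+ 2 * nsq (fun x => xibar r xi x * v x)
    + 2^-1 * nsq (fun x => v x / x).
  rewrite -!IIZ; [|exact: Lv.2|exact: Lxv.2].
  rewrite -IID; [|apply: itgZ; exact: Lxv.2|apply: itgZ; exact: Lv.2].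
  apply: le_II_ae => //.
    by apply: itgD; apply: itgZ; [exact: Lxv.2|exact: Lv.2].
  apply: aeS bxi => x bx x0; have {}bx := bx x0.
  rewrite [1 / _ * (_ * x)]mulrA [2^-1 * (_ * x)]mulrA -mulrDl ler_pM2r//.
  have d := den_gt0 x.
  have -> : potV x = 2 / (x ^+ 2 + 4 * r ^+ 2) * xi0 x ^+ 2.
    by rewrite xi0_sqr /potV; field; rewrite gt_eqF.
  rewrite [xibar r xi x]/xibar -/(xi0 x); set X := xi x in bx *; set Z := xi0 x.
  set D := x ^+ 2 + _; set t := v x / x.
  have -> : v x = t * x by rewrite /t divfK// gt_eqF.
  have Dx : x ^+ 2 <= D by rewrite lerDl mulr_ge0// sqr_ge0.
  have Dr : 4 * r ^+ 2 <= D by rewrite lerDr sqr_ge0.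
  have r2 : 0 < r ^+ 2 by rewrite exprn_gt0.
  have ZX : Z ^+ 2 <= 2 * (X + Z) ^+ 2 + 2 * X ^+ 2.
    by have := sqr_ge0 (X + Z + X); nra.
  apply: (@le_trans _ _ (2 / D * (2 * (X + Z) ^+ 2 + 2 * X ^+ 2) * (t * x) ^+ 2)).
    by rewrite ler_wpM2r ?sqr_ge0// ler_wpM2l// divr_ge0// ltW.
  have D0 : 0 < D := d.
  have q1 : 4 / D <= 1 / r ^+ 2.
    by rewrite ler_pdivrMr// mulrAC ler_pdivlMr// mul1r.
  have q2 : x ^+ 2 / D <= 1 by rewrite ler_pdivrMr// mul1r.
  rewrite mulrDr mulrDl; apply: lerD.
    rewrite (_ : _ * _ = 4 / D * ((X + Z) * (t * x)) ^+ 2); last by ring.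
    by rewrite ler_wpM2r ?sqr_ge0.
  have -> : 2 / D * (2 * X ^+ 2) * (t * x) ^+ 2 = x ^+ 2 / D * (4 * X ^+ 2) * t ^+ 2.
    by rewrite exprMn; ring.
  rewrite ler_wpM2r ?sqr_ge0// (le_trans (ler_wpM2r _ q2))//.
    by rewrite mulr_ge0 ?sqr_ge0.
  by rewrite mul1r; lra.
have := nsq_ge0 g; rewrite nsq_Fp//; move: Vle.
by rewrite mul1r -mulrA; set k := (r ^+ 2)^-1 * _; lra.
Qed.

End coercivity.

(** * Closedness of the weak derivative and a weight inequality *)

Section limits.
Context {R : realType}.
Local Notation mu := (@lebesgue_measure R).
Local Notation H := (halfline R).

Lemma cvg_of_sq_bound (u : nat -> R) (l C : R) :
  (forall n, (u n - l) ^+ 2 <= C * 4^-1 ^+ n) -> u @ \oo --> l.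
Proof.
move=> hu; pose c : R := `|C| + 1.
have c1 : 1 <= c by rewrite lerDr.
have Cc : C <= c ^+ 2.
  have := ler_norm C; have := normr_ge0 C; rewrite /c; nra.
have ul n : `|u n - l| <= c * 2^-1 ^+ n.
  rewrite -(@ler_pXn2r _ 2)// ?nnegrE//; last first.
    by rewrite mulr_ge0 ?exprn_ge0//; lra.
  rewrite real_normK ?num_real// exprMn -exprM mulnC exprM.
  have -> : (2^-1 : R) ^+ 2 = 4^-1 by field.
  by apply: le_trans (hu n) _; rewrite ler_wpM2r// exprn_ge0.
have c0 : (fun n => c * 2^-1 ^+ n) @ \oo --> (0 : R).
  rewrite -[0](mulr0 c); apply: cvgMr; apply: cvg_expr.
  by rewrite ger0_norm; lra.
apply/subr_cvg0/norm_cvg0P.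
apply: (squeeze_cvgr _ (cvg_cst (0 : R)) c0).
by apply: nearW => n; rewrite normr_ge0 ul.
Qed.

Lemma ip_cvg (f : nat -> R -> R) (F h : R -> R) (C : R) :
  (forall n, L2 (f n)) -> L2 F -> L2 h ->
  (forall n, nsq (fun x => f n x - F x) <= C * 4^-1 ^+ n) ->
  ip (f n) h @[n --> \oo] --> ip F h.
Proof.
move=> Lf LF Lh hC; apply: (@cvg_of_sq_bound _ _ (C * nsq h)) => n.
have -> : ip (f n) h - ip F h = ip (fun x => f n x - F x) h.
  rewrite -mulN1r -ipZl// -ipDl//; last exact: L2Z.
  by apply: eq_ip => // x _; rewrite mulN1r.
apply: le_trans (ip_cs (L2B (Lf n) LF) Lh) _.
by rewrite mulrAC ler_wpM2r// nsq_ge0.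
Qed.

(** Pairing with this function in L^2(x dx) is the unweighted integral over [a,b]. Convergence of
    derivatives in L^2 thus becomes convergence of the increments of their primitives. *)
Lemma L2_indic_inv (a b : R) : 0 < a ->
  L2 (fun x => x^-1 * \1_[set` `[a, b]] x).
Proof.
move=> a0.
have mi : measurable_fun H (fun x : R => x^-1) by exact: inv_meas.
have ii : itg (fun x => x^-1 * \1_[set` `[a, b]] x).
  apply: itg_indic => //; apply: continuous_compact_integrable.
    exact: segment_compact.
  apply: continuous_in_subspaceT => x /set_mem/(itv_subH a0)/inH x0.
  by apply: inv_continuous; rewrite gt_eqF.
split; first exact: itg_meas.
apply: eq_itg ii => x x0; rewrite exprMn indicE.
by case: (_ \in _); rewrite /= ?expr1n ?expr0n/=; field; rewrite gt_eqF.
Qed.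

Lemma Rint_ip (a b : R) (h : R -> R) : 0 < a ->
  \int[mu]_(x in `[a, b]) h x = ip h (fun x => x^-1 * \1_[set` `[a, b]] x).
Proof.
move=> a0; rewrite Rint_II//; apply: eq_II => x x0.
by field; rewrite gt_eqF.
Qed.

Lemma L2_loc (h : R -> R) : L2 h -> locally_integrable H h.
Proof.
move=> Lh; apply: loc_itvP; first exact: Lh.1.
move=> a b a0 ab; have := itg_itv b a0 (L2_itg Lh (L2_indic_inv b a0)).
apply: eq_integrable => //.
move=> x xab /=; rewrite indicE xab mulr1 mulfVK// gt_eqF//.
by apply/inH; apply: (itv_subH a0); exact: set_mem xab.
Qed.

(** Increments of the continuous representatives converge by pairing, and one point x1 of almost
    everywhere convergence fixes the additive constant. The representatives then converge at every
    point. *)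
Lemma is_wderiv_lim (v g : nat -> R -> R) (W G : R -> R) (C : R) :
  (forall n, is_wderiv (v n) (g n)) -> (forall n, L2 (g n)) -> L2 G ->
  measurable_fun H W -> {ae mu, forall x, 0 < x -> v^~ x @ \oo --> W x} ->
  (forall n, nsq (fun x => g n x - G x) <= C * 4^-1 ^+ n) ->
  is_wderiv W G.
Proof.
move=> vg Lg LG mW cv hC.
have /choice[v0 hv0] n : exists v0, ae_eq_halfline (v n) v0 /\ acp v0 (g n).
  by have /is_wderivP[_ [v0 ? ?]] := vg n; exists v0.
have cint a b : 0 < a ->
    \int[mu]_(x in `[a, b]) g n x @[n --> \oo] --> \int[mu]_(x in `[a, b]) G x.
  move=> a0; rewrite Rint_ip//.
  under eq_fun do rewrite Rint_ip//.
  by apply: ip_cvg => //; exact: L2_indic_inv.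
have aev : {ae mu, forall x, 0 < x -> v0^~ x @ \oo --> W x}.
  have : {ae mu, forall x n, 0 < x -> v n x = v0 n x}.
    apply: ae_foralln => n; exact: (hv0 n).1.
  apply: ae2S cv => x e cvx x0; rewrite (_ : v0^~ x = v^~ x); first exact: e.
  by apply/funext => n; rewrite cvx.
have [x1 /andP[x10 _] cx1] := ae_dense aev (@ltr01 R).
have {}cx1 := cx1 x10.
have dv0 n a b : 0 < a -> a <= b -> v0 n b = v0 n a + \int[mu]_(x in `[a, b]) g n x.
  by move=> a0 ab; rewrite -(hv0 n).2.2// addrC subrK.
have cv0 x : 0 < x -> cvgn (v0^~ x).
  move=> x0; have [xx|xx] := leP x1 x.
    rewrite (_ : v0^~ x = fun n => v0 n x1 + \int[mu]_(t in `[x1, x]) g n t).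
      by apply: is_cvgD; apply/cvg_ex; eexists; [exact: cx1|exact: cint].
    by apply/funext => n; rewrite -dv0.
  rewrite (_ : v0^~ x = fun n => v0 n x1 - \int[mu]_(t in `[x, x1]) g n t).
    by apply: is_cvgB; apply/cvg_ex; eexists; [exact: cx1|exact: cint].
  by apply/funext => n; rewrite (dv0 n _ _ x0 (ltW xx)) addrK.
apply/is_wderivP; split => //; exists (fun x => limn (v0^~ x)).
  by apply: aeS aev => x e x0; apply/esym/cvg_lim => //; exact: e.
split; first exact: L2_loc.
move=> a b a0 ab.
have h1 : v0 n b - v0 n a @[n --> \oo] --> limn (v0^~ b) - limn (v0^~ a).
  by apply: cvgB; [exact: cv0 (lt_le_trans a0 ab)|exact: cv0].
have h2 : v0 n b - v0 n a @[n --> \oo] --> \int[mu]_(x in `[a, b]) G x.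
  rewrite (_ : (fun n => _) = fun n => \int[mu]_(x in `[a, b]) g n x); first exact: cint.
  by apply/funext => n; rewrite (dv0 n a b)// addrC addKr.
by rewrite -(cvg_lim _ h1)// -(cvg_lim _ h2).
Qed.

(** The scaling y = b x reduces this to y^(-2s) <= y^-2 + 1, which holds because y^(-s) is at most 1
    for y >= 1 and at most 1/y for y < 1. *)
Lemma powR_neg_sqr_le (b s x : R) : 0 < b -> 0 <= s -> s <= 1 -> 0 < x ->
  (x `^ (- s)) ^+ 2 <= (b `^ (1 - s)) ^- 2 * ((x ^-1) ^+ 2 + b ^+ 2).
Proof.
move=> b0 s0 s1 x0; set y := b * x.
have y0 : 0 < y by rewrite mulr_gt0.
have p0 : 0 < b `^ (1 - s) by rewrite powR_gt0.
have ys : (y `^ (- s)) ^+ 2 <= y^-1 ^+ 2 + 1.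
  have [y1|y1] := leP 1 y.
    have : y `^ (- s) <= 1.
      by rewrite -(powRr0 y) ler_powR// oppr_le0.
    have := powR_ge0 y (- s); have := sqr_ge0 y^-1; nra.
  have : y `^ (- s) <= y^-1.
    rewrite powRN lef_pV2 ?posrE ?powR_gt0//.
    by apply: ger1_powR => //; rewrite y0 ltW.
  have := powR_ge0 y (- s); nra.
have bE : b `^ s * b `^ (1 - s) = b.
  by rewrite -powRD ?subrKC ?powRr1 ?ltW//; apply/implyP => _; rewrite gt_eqF.
have xE : x `^ (- s) = b `^ s * y `^ (- s).
  by rewrite /y powRM ?ltW// mulrA [b `^ (- s)]powRN mulfV ?mul1r// gt_eqF ?powR_gt0.
rewrite xE exprMn; have bs0 : 0 < b `^ s by rewrite powR_gt0.
have -> : (b `^ (1 - s)) ^- 2 * (x^-1 ^+ 2 + b ^+ 2) =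
    b `^ s ^+ 2 * (y^-1 ^+ 2 + 1).
  have -> : b `^ (1 - s) = b / b `^ s.
    by apply: (canRL (mulfK _)); rewrite ?gt_eqF// mulrC.
  by rewrite /y; field; rewrite !gt_eqF.
by rewrite ler_wpM2l ?sqr_ge0.
Qed.

End limits.

(** * Weighted bounds for compactly supported functions *)

Section compact_support.
Context {R : realType}.
Local Notation mu := (@lebesgue_measure R).
Local Notation H := (halfline R).
Implicit Types m v g : R -> R.

Lemma cs_L2 m v : measurable_fun H m -> measurable_fun H v ->
  L2 (fun x => v x / x) -> compactly_supported v ->
  (forall a b, 0 < a -> a <= b ->
     exists M, {ae mu, forall x, a <= x <= b -> `|m x| <= M}) ->
  L2 (fun x => m x * v x).
Proof.
move=> mm mv Lv [a [b [a0 ab vab]]] hm.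
have [M hM] := hm a b a0 ab.
apply: (L2_dom_ae (c := `|M| * b)) (Lv); first exact: measurable_funM.
apply: aeS hM => x hM x0; have b0 := lt_le_trans a0 ab.
have [xab|xab] := boolP (x \in `[a, b]); last first.
  by rewrite (vab _ x0 xab) mulr0 normr0 mulr_ge0// mulr_ge0// ltW.
move: xab; rewrite in_itv/= => xab.
rewrite !normrM normfV (gtr0_norm x0) -mulrA ler_pM//.
  by apply: le_trans (hM xab) _; exact: ler_norm.
rewrite mulrCA ler_peMr// ler_pdivlMr// mul1r.
by case/andP: xab.
Qed.

Lemma cs_L2_1 v : measurable_fun H v -> L2 (fun x => v x / x) ->
  compactly_supported v -> L2 v.
Proof.
move=> mv Lv cv; suff : L2 (fun x => 1 * v x) by apply: eq_L2 => x _; rewrite mul1r.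
apply: (cs_L2 _ mv Lv cv) => // a b _ _; exists 1; apply: aeW => x _.
by rewrite normr1.
Qed.

Lemma cs_L2_x v : measurable_fun H v -> L2 (fun x => v x / x) ->
  compactly_supported v -> L2 (fun x => x * v x).
Proof.
move=> mv Lv cv; apply: (cs_L2 _ mv Lv cv); first exact: id_meas.
move=> a b a0 _; exists b; apply: aeW => x /andP[ax xb].
by rewrite gtr0_norm// (lt_le_trans a0).
Qed.

Lemma L2_norm v : L2 v -> L2 (fun x => `|v x|).
Proof.
move=> Lv; apply: (L2_dom (c := 1)) (Lv).
  by apply: measurableT_comp => //; exact: Lv.1.
by move=> x _; rewrite normr_id mul1r.
Qed.

Lemma powR_meas (s : R) : measurable_fun H (fun x : R => x `^ s).
Proof.
apply: measurable_funS (measurable_powR s) => //.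
Qed.

Lemma cs_L2_pow (s : R) v : 0 <= s -> s <= 1 ->
  measurable_fun H v -> L2 (fun x => v x / x) ->
  compactly_supported v -> L2 (fun x => x `^ (- s) * v x).
Proof.
move=> s0 s1 mv Lv cv; have L1 := cs_L2_1 mv Lv cv.
apply: (L2_dom (c := 1)) (L2D (L2_norm Lv) (L2_norm L1)).
  by apply: measurable_funM => //; exact: powR_meas.
move=> x x0; rewrite mul1r [leRHS]ger0_norm ?addr_ge0// normrM.
rewrite (ger0_norm (powR_ge0 _ _)) normrM normfV (gtr0_norm x0).
rewrite [`|v x| / x]mulrC -[X in _ + X]mul1r -mulrDl ler_wpM2r//.
have := powR_neg_sqr_le ltr01 s0 s1 x0; rewrite powR1 expr1n invr1 mul1r => h.
have xi0 : 0 < x^-1 by rewrite invr_gt0.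
rewrite -(@ler_pXn2r _ 2)// ?nnegrE ?powR_ge0//; last by lra.
by apply: le_trans h _; nra.
Qed.

Lemma cs_nsq_pow (b s : R) v : 0 < b -> 0 <= s -> s <= 1 ->
  measurable_fun H v -> L2 (fun x => v x / x) -> compactly_supported v ->
  nsq (fun x => x `^ (- s) * v x) <=
  (b `^ (1 - s)) ^- 2 * (nsq (fun x => v x / x) + b ^+ 2 * nsq v).
Proof.
move=> b0 s0 s1 mv Lv cv; have L1 := cs_L2_1 mv Lv cv.
have Lp := cs_L2_pow s0 s1 mv Lv cv.
have Ib : itg (fun x => b ^+ 2 * (v x ^+ 2 * x)) by apply: itgZ; exact: L1.2.
rewrite /nsq -IIZ; last exact: L1.2.
rewrite -IID//; last exact: Lv.2.
rewrite -IIZ; last by apply: itgD => //; exact: Lv.2.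
apply: le_II; first exact: Lp.2.
  by apply: itgZ; apply: itgD => //; exact: Lv.2.
move=> x x0.
have -> : (b `^ (1 - s)) ^- 2 * ((v x / x) ^+ 2 * x + b ^+ 2 * (v x ^+ 2 * x)) =
    (b `^ (1 - s)) ^- 2 * (x^-1 ^+ 2 + b ^+ 2) * (v x ^+ 2 * x).
  by rewrite -!mulrA; congr (_ * _); ring.
rewrite exprMn -[leLHS]mulrA ler_wpM2r//; last exact: powR_neg_sqr_le.
by rewrite mulr_ge0 ?sqr_ge0// ltW.
Qed.

End compact_support.

(** * Existence *)

Section existence.
Context {R : realType}.
Local Notation mu := (@lebesgue_measure R).
Local Notation H := (halfline R).
Variables (r : R) (xi : R -> R) (b : R).
Hypothesis r0 : 0 < r.
Hypothesis mxi : measurable_fun H xi.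
Hypothesis bxi : {ae mu, forall x, 0 < x -> xi x ^+ 2 <= 8^-1}.
Hypothesis b0 : 0 < b.

(* A function is carried together with a weak derivative. *)
Local Notation V := ((R -> R) * (R -> R))%type.
Implicit Types p q t : V.

Local Notation xb := (xibar r xi).

Definition fdiv (p : V) : R -> R := fun x => p.1 x / x.
Definition fxb (p : V) : R -> R := fun x => xb x * p.1 x.
Definition fF (p : V) : R -> R := Fp r p.1 p.2.
Definition lin (p : V) (c : R) (q : V) : V :=
  (fun x => p.1 x + c * q.1 x, fun x => p.2 x + c * q.2 x).

Definition tst p : Prop := [/\ is_wderiv p.1 p.2, L2 p.2, L2 (fdiv p) &
  compactly_supported p.1].
Definition adm p : Prop := [/\ is_wderiv p.1 p.2, L2 p.2, L2 (fdiv p) & L2 (fxb p)].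

(** The form of F^*F + xb^2/2. [Bb] is the form with beta^2 added, and [Qf] the squared norm of
    X_xi. *)
Definition Bf p q : R := ip (fF p) (fF q) + 2^-1 * ip (fxb p) (fxb q).
Definition Bb p q : R := Bf p q + b ^+ 2 * ip p.1 q.1.
Definition Qf p : R := nsq p.2 + nsq (fdiv p) + 2^-1 * nsq (fxb p).

Lemma xb_le3 : {ae mu, forall x, 0 < x -> `|xb x| <= 3}.
Proof.
apply: aeS bxi => x bx x0; have {}bx := bx x0.
rewrite /xibar -/(xi0 r x); have x4 := xi0_sqr_le r0 x.
have h1 : `|xi x| <= 1.
  rewrite -(@ler_pXn2r _ 2)// ?nnegrE// real_normK ?num_real// expr1n; lra.
have h2 : `|xi0 r x| <= 2.
  rewrite -(@ler_pXn2r _ 2)// ?nnegrE// real_normK ?num_real//.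
  by apply: le_trans x4 _; rewrite -natrX.
by apply: le_trans (ler_normD _ _) _; lra.
Qed.

Lemma tst_meas p : tst p -> measurable_fun H p.1.
Proof. by case=> /is_wderiv_meas[]. Qed.

Lemma adm_meas p : adm p -> measurable_fun H p.1.
Proof. by case=> /is_wderiv_meas[]. Qed.

Lemma tst_L2 p : tst p -> L2 p.1.
Proof. by move=> tp; case: (tp) => _ _ Lv cv; apply: cs_L2_1 => //; exact: tst_meas. Qed.

Lemma tst_adm p : tst p -> adm p.
Proof.
move=> tp; case: (tp) => wp Lg Lv cv; split => //.
apply: cs_L2 => //; [exact: xibar_meas|exact: tst_meas|].
move=> a c a0 _; exists 3; apply: aeS xb_le3 => x h /andP[ax _]; apply: h.
exact: lt_le_trans ax.
Qed.

Lemma fF_L2 p : adm p -> L2 (fF p).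
Proof. by case=> _ Lg Lv _; exact: Fp_L2. Qed.

Lemma fdiv_lin p c q x : fdiv (lin p c q) x = fdiv p x + c * fdiv q x.
Proof. by rewrite /fdiv /= mulrDl mulrA. Qed.

Lemma fxb_lin p c q x : fxb (lin p c q) x = fxb p x + c * fxb q x.
Proof. by rewrite /fxb /= mulrDr mulrCA. Qed.

Lemma fF_lin p c q x : fF (lin p c q) x = fF p x + c * fF q x.
Proof. by rewrite /fF /Fp /=; ring. Qed.

Lemma L2_lin (f h k : R -> R) c : (forall x, k x = f x + c * h x) ->
  L2 f -> L2 h -> L2 k.
Proof.
by move=> kE Lf Lh; apply: eq_L2 (L2D Lf (L2Z c Lh)) => x _; rewrite kE.
Qed.

Lemma adm_lin p c q : adm p -> adm q -> adm (lin p c q).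
Proof.
move=> [wp Lp dp xp] [wq Lq dq xq]; split.
- exact: is_wderiv_lin.
- exact: (L2_lin (c := c)) Lp Lq.
- exact: (L2_lin (fdiv_lin p c q)).
- exact: (L2_lin (fxb_lin p c q)).
Qed.

Lemma compactly_supported_lin (f h : R -> R) c : compactly_supported f ->
  compactly_supported h -> compactly_supported (fun x => f x + c * h x).
Proof.
move=> [a [d [a0 ad fad]]] [a' [d' [a'0 ad' had]]].
exists (Num.min a a'), (Num.max d d'); split.
- by rewrite lt_min a0.
- by rewrite ge_min le_max ad.
move=> x x0; rewrite in_itv/= ge_min le_max negb_and !negb_or -!ltNge => xn.
rewrite fad// ?had ?mulr0 ?addr0// in_itv/= negb_and -!ltNge.
  by case/orP: xn => /andP[_ ->]; rewrite ?orbT.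
by case/orP: xn => /andP[-> _]; rewrite ?orbT.
Qed.

Lemma tst_lin p c q : tst p -> tst q -> tst (lin p c q).
Proof.
move=> tp tq; have [wl Ll dl _] := adm_lin c (tst_adm tp) (tst_adm tq).
split => //; case: tp tq => _ _ _ cp [_ _ _ cq].
exact: compactly_supported_lin.
Qed.

Lemma ip_lin (f h k w : R -> R) c : (forall x, k x = f x + c * h x) ->
  L2 f -> L2 h -> L2 w -> ip k w = ip f w + c * ip h w.
Proof.
move=> kE Lf Lh Lw; rewrite -ipZl// -ipDl//; last exact: L2Z.
by apply: eq_ip => // x _; rewrite kE.
Qed.

Lemma Bf_lin p c q t : adm p -> adm q -> adm t ->
  Bf (lin p c q) t = Bf p t + c * Bf q t.
Proof.
move=> ap aq at_; rewrite /Bf.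
have Ft := fF_L2 at_; have Fpp := fF_L2 ap; have Fq := fF_L2 aq.
case: ap aq at_ => _ _ _ xp [_ _ _ xq] [_ _ _ xt].
rewrite (ip_lin (fF_lin p c q))// (ip_lin (fxb_lin p c q))//; ring.
Qed.

(** Stated on test pairs, in contrast to [Bf_lin]: an admissible function need not be in L^2, where
    the beta^2 term lives. *)
Lemma Bb_lin p c q t : tst p -> tst q -> tst t ->
  Bb (lin p c q) t = Bb p t + c * Bb q t.
Proof.
move=> tp tq tt; rewrite /Bb Bf_lin; [|exact: tst_adm..].
rewrite (ip_lin (f := p.1) (h := q.1) (c := c))//; [ring|exact: tst_L2..].
Qed.

Lemma Bf_sym p q : Bf p q = Bf q p.
Proof. by rewrite /Bf ipC [ip (fxb _) _]ipC. Qed.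

Lemma Bb_sym p q : Bb p q = Bb q p.
Proof. by rewrite /Bb Bf_sym [ip p.1 _]ipC. Qed.

Lemma Bf_diag p : Bf p p = nsq (fF p) + 2^-1 * nsq (fxb p).
Proof. by rewrite !nsqE. Qed.

Lemma Bf_ge0 p : 0 <= Bf p p.
Proof. by rewrite Bf_diag addr_ge0 ?mulr_ge0 ?nsq_ge0. Qed.

Lemma Bb_diag p : Bb p p = Bf p p + b ^+ 2 * nsq p.1.
Proof. by rewrite /Bb !nsqE. Qed.

Lemma Bf_le_Bb p : Bf p p <= Bb p p.
Proof. by rewrite Bb_diag lerDl mulr_ge0 ?nsq_ge0 ?sqr_ge0. Qed.

Lemma Bb_ge0 p : 0 <= Bb p p.
Proof. exact: le_trans (Bf_ge0 p) (Bf_le_Bb p). Qed.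

(** The constants of [coercive], the second one doubled because [Bf] contains only half of the xb^2
    term. *)
Definition coerc : R := 2 + 4 / r ^+ 2.

Lemma coerc_ge2 : 2 <= coerc.
Proof. by rewrite lerDl divr_ge0// sqr_ge0. Qed.

Lemma coercive_Bf t : tst t -> nsq t.2 + nsq (fdiv t) <= coerc * Bf t t.
Proof.
move=> tt; have [_ _ _ xt] := tst_adm tt; case: (tt) => wt Lt dt ct.
apply: le_trans (coercive r0 mxi bxi wt Lt dt xt ct) _.
rewrite Bf_diag -/(fF t) -/(fxb t) /coerc.
have k0 : 0 <= (r ^+ 2)^-1 by rewrite invr_ge0 sqr_ge0.
have := nsq_ge0 (fF t); have := nsq_ge0 (fxb t); move: k0.
set k := (r ^+ 2)^-1; set A := nsq (fF t); set X := nsq (fxb t).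
by move=> k0 A0 X0; have := mulr_ge0 k0 A0; have := mulr_ge0 k0 X0; nra.
Qed.

Lemma nsq_fF p : adm p -> nsq (fF p) <= 2 * nsq p.2 + 2 * nsq (fdiv p).
Proof.
move=> [_ Lg Lv _]; have L : L2 (fun x => potc r x / x * p.1 x).
  have := L2B (Fp_L2 r0 Lg Lv) Lg; apply: eq_L2 => x _.
  by rewrite /Fp addrC addKr.
apply: le_trans (nsqD Lg L) _; rewrite lerD2l ler_wpM2l//.
rewrite -[leRHS]mul1r; apply: le_nsq => // x _.
rewrite mul1r /fdiv mulrAC -mulrA exprMn ler_piMl ?sqr_ge0//.
rewrite -real_normK ?num_real// expr_le1// potc_norm//.
Qed.

(** Makes t |-> a(q,t) an admissible functional for the Riesz argument, with K proportional to the
    squared X_xi norm of q. *)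
Lemma Bf_bound q t : adm q -> tst t -> Bf q t ^+ 2 <= 4 * Qf q * Bb t t.
Proof.
move=> aq tt; have at_ := tst_adm tt.
have h1 := ip_cs (fF_L2 aq) (fF_L2 at_).
have h2 : ip (fxb q) (fxb t) ^+ 2 <= nsq (fxb q) * nsq (fxb t).
  by apply: ip_cs; [case: aq|case: at_].
have h3 := nsq_fF aq.
have h4 : nsq (fF t) + 2^-1 * nsq (fxb t) <= Bb t t by rewrite -Bf_diag Bf_le_Bb.
have := Bb_ge0 t; move: h1 h2 h3 h4; rewrite /Bf /Qf.
have := nsq_ge0 (fF q); have := nsq_ge0 (fF t); have := nsq_ge0 (fxb q).
have := nsq_ge0 (fxb t); have := nsq_ge0 q.2; have := nsq_ge0 (fdiv q).
set P := ip (fF q) _; set S := ip (fxb q) _; set B := Bb t t.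
set a1 := nsq (fF q); set a2 := nsq (fF t); set a3 := nsq (fxb q).
set a4 := nsq (fxb t); set a5 := nsq q.2; set a6 := nsq (fdiv q).
move=> p6 p5 p4 p3 p2 p1 h1 h2 h3 h4 B0.
apply: (@le_trans _ _ (2 * (a1 * a2) + 2^-1 * (a3 * a4))).
  have := sqr_ge0 (P - 2^-1 * S); nra.
have k1 : a1 * a2 <= (2 * a5 + 2 * a6) * B by apply: ler_pM => //; lra.
have k2 : a3 * a4 <= a3 * (2 * B) by rewrite ler_wpM2l//; lra.
nra.
Qed.

(** The weight x^s is moved from f to t. The norm of x^(-s) t is controlled by t/x and b t, which
    cost [coerc] and 1 times [Bb t t], with the factor b^(-2(1-s)) from the scaling. *)
Lemma rhs_bound s (f : R -> R) t : 0 <= s -> s <= 1 ->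
  L2 (fun x => x `^ s * f x) -> tst t ->
  ip (fun x => x `^ s * f x) (fun x => x `^ (- s) * t.1 x) ^+ 2 <=
  (coerc + 1) * (nsq (fun x => x `^ s * f x) / (b `^ (1 - s)) ^+ 2) * Bb t t.
Proof.
move=> s0 s1 Lf tt; have mt := tst_meas tt; case: (tt) => wt Lt dt ct.
apply: le_trans (ip_cs Lf (cs_L2_pow s0 s1 mt dt ct)) _.
have := cs_nsq_pow b0 s0 s1 mt dt ct.
have := coercive_Bf tt; have := Bb_diag t; have := Bf_ge0 t.
have := coerc_ge2; have := nsq_ge0 (fun x => x `^ s * f x).
have := nsq_ge0 t.1; have := nsq_ge0 t.2.
have : 0 <= (b `^ (1 - s)) ^- 2 by rewrite invr_ge0 sqr_ge0.
rewrite -/(fdiv t); set k := _ ^- 2; set N := nsq (fun x => _ * f x).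
set M := nsq (fun x => _ * t.1 x); set B := Bb t t; set A := Bf t t.
set n1 := nsq t.1; set n2 := nsq t.2; set n3 := nsq (fdiv t).
move=> k0 n20 n10 N0 c2 A0 BE h1 h2.
have b2 : 0 <= b ^+ 2 * n1 by rewrite mulr_ge0 ?sqr_ge0.
have : n3 + b ^+ 2 * n1 <= (coerc + 1) * B by rewrite BE; nra.
move=> h3; have h4 : M <= k * ((coerc + 1) * B).
  by apply: le_trans h2 _; rewrite ler_wpM2l.
have -> : (coerc + 1) * (N * k) * B = N * (k * ((coerc + 1) * B)) by ring.
by rewrite ler_wpM2l.
Qed.

End existence.

(** * Construction of the solution *)

Section solution.
Context {R : realType}.
Local Notation mu := (@lebesgue_measure R).
Local Notation H := (halfline R).
Variables (r : R) (xi : R -> R) (b : R).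
Hypothesis r0 : 0 < r.
Hypothesis mxi : measurable_fun H xi.
Hypothesis bxi : {ae mu, forall x, 0 < x -> xi x ^+ 2 <= 8^-1}.
Hypothesis b0 : 0 < b.

Local Notation V := ((R -> R) * (R -> R))%type.
Implicit Types p q t : V.
Local Notation tst := (@tst R).
Local Notation adm := (adm r xi).
Local Notation Bf := (Bf r xi).
Local Notation Bb := (Bb r xi b).
Local Notation Qf := (Qf r xi).
Local Notation fxb := (fxb r xi).
Local Notation fF := (fF r).
Local Notation c0 := (coerc r).

(** 4 K bounds [Bb] along the near-minimisers. Fatou passes this to the limit: [c0] times it for the
    derivative, again for u/x, and once more for half of the xb term. *)
Lemma riesz_limit (l : V -> R) (K : R) : 0 <= K ->
  (forall p c q, tst p -> tst q -> l (lin p c q) = l p + c * l q) ->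
  (forall t, tst t -> l t ^+ 2 <= K * Bb t t) ->
  (* The rate 4^-n lets the near-minimisers themselves converge almost everywhere, without
     extracting a subsequence. *)
  exists p, [/\ adm p, L2 p.1, forall t, tst t -> Bb p t = l t &
    Qf p <= (2 * c0 + 1) * (4 * K)].
Proof.
move=> K0 llin lb; pose eps n : R := 4^-1 ^+ n.
have eps0 n : 0 < eps n by rewrite exprn_gt0.
pose z : V := (fun=> 0, fun=> 0).
have tz : tst z.
  split; first by apply: acp_wderiv; apply: acp_C1 => x _; exact: cst_continuous.
  - exact: L20.
  - by apply: eq_L2 L20 => x _; rewrite /fdiv /= mul0r.
  - by exists 1, 1; split.
have Blin u c v w : tst u -> tst v -> tst w ->
    Bb (lin u c v) w = Bb u w + c * Bb v w by exact: Bb_lin.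
have Bge0 u : tst u -> 0 <= Bb u u by move=> _; exact: Bb_ge0.
have Bsym u v : tst u -> tst v -> Bb u v = Bb v u by move=> _ _; exact: Bb_sym.
have Dlin u c v : tst u -> tst v -> tst (lin u c v) by exact: tst_lin r0 mxi bxi u c v.
have [w [tw wK wl]] := riesz_sequence Dlin Blin Bsym Bge0 llin K0 lb tz eps0.
have wc := riesz_cauchy Dlin Blin Bge0 tw eps0 wl.
have aw n : adm (w n) by exact: tst_adm (tw n).
have c2 := coerc_ge2 r; have c00 : 0 <= c0 by lra.
have diff m n : tst (lin (w m) (-1) (w n)) by exact: Dlin.
have L1 n : L2 (w n).1 by exact: tst_L2.
have Lg n : L2 (w n).2 by case: (tw n).
have Ld n : L2 (fdiv (w n)) by case: (tw n).
have Lx n : L2 (fxb (w n)) by case: (aw n).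
have b2 : 0 < b ^+ 2 by rewrite exprn_gt0.
have B1 t : nsq t.1 <= (b ^+ 2)^-1 * Bb t t.
  rewrite mulrC ler_pdivlMr// mulrC Bb_diag lerDr; exact: Bf_ge0.
have B2 t : tst t -> nsq t.2 + nsq (fdiv t) <= c0 * Bb t t.
  move=> tt; apply: le_trans (coercive_Bf r0 mxi bxi tt) _.
  by rewrite ler_wpM2l// Bf_le_Bb.
have B3 t : nsq (fxb t) <= 2 * Bb t t.
  have := Bf_le_Bb r xi b t; rewrite Bf_diag; have := nsq_ge0 (fF t); lra.
have cau (S : V -> R -> R) (C : R) : 0 <= C ->
    (forall m n, forall x, S (w m) x - S (w n) x = S (lin (w m) (-1) (w n)) x) ->
    (forall t, tst t -> nsq (S t) <= C * Bb t t) ->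
    forall m n, nsq (fun x => S (w m) x - S (w n) x) <= C * 2 * (eps m + eps n).
  move=> C0 Slin Sb m n.
  rewrite (eq_nsq (g := S (lin (w m) (-1) (w n)))); last by move=> x _; rewrite Slin.
  by apply: le_trans (Sb _ (diff m n)) _; rewrite -mulrA ler_wpM2l.
have cv : forall m n, nsq (fun x => (w m).1 x - (w n).1 x) <=
    (b ^+ 2)^-1 * 2 * (eps m + eps n).
  apply: cau => //; first by rewrite invr_ge0 ltW.
  by move=> m n x; rewrite /lin /= mulN1r.
have cg : forall m n, nsq (fun x => (w m).2 x - (w n).2 x) <= c0 * 2 * (eps m + eps n).
  apply: cau => //; first by move=> m n x; rewrite /lin /= mulN1r.
  by move=> t tt; apply: le_trans (B2 t tt); rewrite lerDl nsq_ge0.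
have cd : forall m n, nsq (fun x => fdiv (w m) x - fdiv (w n) x) <=
    c0 * 2 * (eps m + eps n).
  apply: cau => //; first by move=> m n x; rewrite fdiv_lin mulN1r.
  by move=> t tt; apply: le_trans (B2 t tt); rewrite lerDr nsq_ge0.
have cx : forall m n, nsq (fun x => fxb (w m) x - fxb (w n) x) <=
    2 * 2 * (eps m + eps n).
  by apply: cau => // m n x; rewrite fxb_lin mulN1r.
have b20 : 0 <= (b ^+ 2)^-1 * 2 by rewrite mulr_ge0// invr_ge0 ltW.
have [W [LW aeW nW]] := L2_complete L1 b20 cv.
have c020 : 0 <= c0 * 2 by rewrite mulr_ge0.
have [G [LG aeG nG]] := L2_complete Lg c020 cg.
have mW := LW.1; pose p : V := (W, G).
have aed : {ae mu, forall x, 0 < x -> (fun n => fdiv (w n) x) @ \oo --> fdiv p x}.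
  by apply: aeS aeW => x e x0; apply: cvgMl; exact: e.
have aex : {ae mu, forall x, 0 < x -> (fun n => fxb (w n) x) @ \oo --> fxb p x}.
  by apply: aeS aeW => x e x0; apply: cvgMr; exact: e.
have md : measurable_fun H (fdiv p) by apply: measurable_funM => //; exact: inv_meas.
have mx : measurable_fun H (fxb p).
  by apply: measurable_funM => //; exact: xibar_meas.
have [Ldp nd] := L2_cauchy_limit Ld c020 md aed cd.
have p22 : 0 <= 2 * 2 :> R by rewrite mulr_ge0.
have [Lxp nx] := L2_cauchy_limit Lx p22 mx aex cx.
have wp : is_wderiv W G.
  by apply: (is_wderiv_lim _ Lg LG mW aeW nG) => n; case: (tw n).
have ap : adm p by split.
have LF n : L2 (fF (w n)) by exact: fF_L2.
have LFp : L2 (fF p) by exact: fF_L2 ap.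
have nF n : nsq (fun x => fF (w n) x - fF p x) <=
    (2 * (2 * (c0 * 2)) + 2 * (2 * (c0 * 2))) * 4^-1 ^+ n.
  have al := adm_lin (-1) (aw n) ap.
  rewrite (eq_nsq (g := fF (lin (w n) (-1) p))); last first.
    by move=> x _; rewrite fF_lin mulN1r.
  apply: le_trans (nsq_fF r0 al) _.
  have g1 : nsq (lin (w n) (-1) p).2 <= 2 * (c0 * 2) * 4^-1 ^+ n.
    rewrite (eq_nsq (g := fun x => (w n).2 x - G x)); first exact: nG.
    by move=> x _; rewrite /= mulN1r.
  have g2 : nsq (fdiv (lin (w n) (-1) p)) <= 2 * (c0 * 2) * 4^-1 ^+ n.
    rewrite (eq_nsq (g := fun x => fdiv (w n) x - fdiv p x)); first exact: nd.
    by move=> x _; rewrite fdiv_lin mulN1r.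
  by move: g1 g2; lra.
exists p; split => //.
  move=> t tt; have at_ := tst_adm r0 mxi bxi tt; have Lt := tst_L2 tt.
  have l1 : Bb (w n) t @[n --> \oo] --> Bb p t.
    apply: cvgD; first apply: cvgD.
    - by have LFt := fF_L2 r0 at_; exact: (ip_cvg LF LFp LFt nF).
    - by apply: cvgMr; have Lxt : L2 (fxb t) by [case: at_]; exact: (ip_cvg Lx Lxp Lxt nx).
    - by apply: cvgMr; exact: (ip_cvg L1 LW Lt nW).
  have l2 : Bb (w n) t @[n --> \oo] --> l t.
    apply: (@cvg_of_sq_bound _ _ _ (Bb t t)) => n.
    by apply: le_trans (wl n t tt) _; rewrite mulrC.
  by rewrite -(cvg_lim _ l1)// -(cvg_lim _ l2).
have k1 : nsq G <= c0 * (4 * K).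
  apply: (fatou_nsq Lg LG.1 aeG _).2; apply: nearW => n.
  apply: le_trans (_ : c0 * Bb (w n) (w n) <= _); last by rewrite ler_wpM2l.
  by apply: le_trans (B2 _ (tw n)); rewrite lerDl nsq_ge0.
have k2 : nsq (fdiv p) <= c0 * (4 * K).
  apply: (fatou_nsq Ld md aed _).2; apply: nearW => n.
  apply: le_trans (_ : c0 * Bb (w n) (w n) <= _); last by rewrite ler_wpM2l.
  by apply: le_trans (B2 _ (tw n)); rewrite lerDr nsq_ge0.
have k3 : nsq (fxb p) <= 2 * (4 * K).
  apply: (fatou_nsq Lx mx aex _).2; apply: nearW => n.
  by apply: le_trans (B3 _) _; rewrite ler_wpM2l.
rewrite /Qf /=; lra.
Qed.

(** From u = w + b^-2 q: [Qf u] is at most 2 [Qf w] + 2 [Qf q] / b^4, [Qf w] is at most 4 (2 c0 + 1)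
    K, and K is at most 2 (c0 + 1) + 8 times the sum of the two source terms. *)
Definition bound_const : R := 8 * (2 * c0 + 1) * (2 * (c0 + 1) + 8) + 2.

Lemma nsq_lin (f h k : R -> R) c : (forall x, k x = f x + c * h x) ->
  L2 f -> L2 h -> nsq k <= 2 * nsq f + 2 * (c ^+ 2 * nsq h).
Proof.
move=> kE Lf Lh; rewrite (eq_nsq (g := fun x => f x + c * h x)).
  by rewrite -nsqZ//; apply: nsqD => //; exact: L2Z.
by move=> x _; rewrite kE.
Qed.

(* The part f1 of the source is paired with t directly; the part q is handled by
   the ansatz u = w + b^-2 q, which turns it into -b^-2 Bf(q, t). *)
Lemma exists_solution (f1 : R -> R) (s : R) q : 0 <= s -> s <= 1 ->
  L2 (fun x => x `^ s * f1 x) -> adm q ->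
  exists u, [/\ adm u,
    forall t, tst t ->
      itg (fun x => (f1 x + q.1 x) * t.1 x * x) /\ itg (fun x => u.1 x * t.1 x * x) /\
      Bf u t = II (fun x => (f1 x + q.1 x) * t.1 x * x)
               - b ^+ 2 * II (fun x => u.1 x * t.1 x * x) &
    Qf u <= bound_const *
      (nsq (fun x => x `^ s * f1 x) / (b `^ (1 - s)) ^+ 2 + Qf q / b ^+ 4)].
Proof.
move=> s0 s1 Lf aq.
pose A := nsq (fun x => x `^ s * f1 x) / (b `^ (1 - s)) ^+ 2.
pose l t := ip (fun x => x `^ s * f1 x) (fun x => x `^ (- s) * t.1 x)
            - (b ^+ 2)^-1 * Bf q t.
have Qf0 p : 0 <= Qf p by rewrite !addr_ge0 ?mulr_ge0 ?nsq_ge0.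
have A0 : 0 <= A by rewrite divr_ge0 ?nsq_ge0 ?sqr_ge0.
have c2 := coerc_ge2 r.
have b2 : 0 < b ^+ 2 by rewrite exprn_gt0.
have b4 : b ^+ 4 = b ^+ 2 * b ^+ 2 by rewrite -exprD.
have Qb0 : 0 <= Qf q / b ^+ 4 by rewrite divr_ge0// b4 mulr_ge0// ltW.
have Lpow t : tst t -> L2 (fun x => x `^ (- s) * t.1 x).
  by move=> tt; have mt := tst_meas tt; case: (tt) => _ _ dt ct; exact: cs_L2_pow.
(* l is a difference, so its square is at most twice the bounds of [rhs_bound] and [Bf_bound]. *)
pose K := 2 * (c0 + 1) * A + 8 * (Qf q / b ^+ 4).
have c1 : 0 <= c0 + 1 by lra.
have K0 : 0 <= K by apply: addr_ge0; apply: mulr_ge0 => //; apply: mulr_ge0.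
have llin p c p' : tst p -> tst p' -> l (lin p c p') = l p + c * l p'.
  move=> tp tp'; rewrite /l ipC.
  rewrite (ip_lin (f := fun x => x `^ (- s) * p.1 x) (h := fun x => x `^ (- s) * p'.1 x) (c := c)) => //; last 3 first.
  - by move=> x /=; rewrite mulrDr mulrCA.
  - exact: Lpow.
  - exact: Lpow.
  rewrite Bf_sym Bf_lin//; [|exact: tst_adm|exact: tst_adm].
  by rewrite [Bf p q]Bf_sym [Bf p' q]Bf_sym ipC [ip (fun x => _ * p'.1 x) _]ipC; ring.
have lb t : tst t -> l t ^+ 2 <= K * Bb t t.
  move=> tt; have h1 := rhs_bound r0 mxi bxi b0 s0 s1 Lf tt.
  have h2 := Bf_bound b r0 mxi bxi aq tt.
  rewrite /l; set P := ip _ _ in h1 *; set S := Bf q t in h2 *.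
  have h3 : ((b ^+ 2)^-1 * S) ^+ 2 <= 4 * (Qf q / b ^+ 4) * Bb t t.
    rewrite exprMn; have -> : 4 * (Qf q / b ^+ 4) * Bb t t =
      (b ^+ 2)^-1 ^+ 2 * (4 * Qf q * Bb t t) by rewrite b4; field; rewrite gt_eqF.
    by rewrite ler_wpM2l ?sqr_ge0.
  move: h1 h3; set S' := _ * S; rewrite -/A /K; set B := Bb t t.
  move=> h1 h3; have := sqr_ge0 (P + S'); nra.
have [w [aw Lw wl wQ]] := riesz_limit K0 llin lb.
pose u := lin w (b ^+ 2)^-1 q.
have au : adm u by exact: adm_lin.
exists u; split => //.
  move=> t tt; have mt := tst_meas tt; have at_ := tst_adm r0 mxi bxi tt.
  have Lt := tst_L2 tt.
  have Ixt : L2 (fun x => x * t.1 x) by case: (tt) => _ _ dt ct; exact: cs_L2_x.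
  have I1 : itg (fun x => f1 x * t.1 x * x).
    apply: eq_itg (L2_itg Lf (Lpow t tt)) => x x0.
    by rewrite powRN mulrACA [_ `^ s / _]divff ?mul1r// gt_eqF// powR_gt0.
  have I2 : itg (fun x => q.1 x * t.1 x * x).
    have Lq : L2 (fdiv q) by case: aq.
    apply: eq_itg (L2_itg Lq Ixt) => x x0; rewrite /fdiv.
    by field; rewrite gt_eqF.
  have I3 : itg (fun x => w.1 x * t.1 x * x) by exact: L2_itg.
  have I12 : itg (fun x => (f1 x + q.1 x) * t.1 x * x).
    by apply: eq_itg (itgD I1 I2) => x _; ring.
  have Iu : itg (fun x => u.1 x * t.1 x * x).
    by apply: eq_itg (itgD I3 (itgZ (b ^+ 2)^-1 I2)) => x _ /=; ring.
  split => //; split => //; rewrite Bf_lin//.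
  have -> : II (fun x => u.1 x * t.1 x * x) =
      ip w.1 t.1 + (b ^+ 2)^-1 * II (fun x => q.1 x * t.1 x * x).
    rewrite -IIZ// -IID//; last exact: itgZ.
    by apply: eq_II => x _ /=; ring.
  have -> : II (fun x => (f1 x + q.1 x) * t.1 x * x) =
      II (fun x => f1 x * t.1 x * x) + II (fun x => q.1 x * t.1 x * x).
    by rewrite -IID//; apply: eq_II => x _; ring.
  have -> : II (fun x => f1 x * t.1 x * x) =
      ip (fun x => x `^ s * f1 x) (fun x => x `^ (- s) * t.1 x).
    apply: eq_II => x x0.
    by rewrite powRN mulrACA [_ `^ s / _]divff ?mul1r// gt_eqF// powR_gt0.
  (* The term b^-2 a(q,t) coming from u = w + b^-2 q cancels the one in l, and the q-part of b^2
     times the pairing of u with t cancels the q-part of the source. *)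
  have := wl t tt; rewrite /Bb /l => /eqP; rewrite -subr_eq0 => /eqP e.
  apply/eqP; rewrite -subr_eq0; apply/eqP; rewrite -[RHS]e.
  by field; rewrite gt_eqF.
case: aw aq => _ Lwg Lwd Lwx [_ Lqg Lqd Lqx].
have h1 : nsq u.2 <= 2 * nsq w.2 + 2 * ((b ^+ 2)^-1 ^+ 2 * nsq q.2) by exact: nsq_lin.
have h2 := nsq_lin (fdiv_lin w (b ^+ 2)^-1 q) Lwd Lqd.
have h3 := nsq_lin (fxb_lin r xi w (b ^+ 2)^-1 q) Lwx Lqx.
have : Qf u <= 2 * Qf w + 2 * (Qf q / b ^+ 4).
  have -> : Qf q / b ^+ 4 = (b ^+ 2)^-1 ^+ 2 * Qf q.
    by rewrite b4; field; rewrite gt_eqF.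
  rewrite /Qf -/u; move: h1 h2 h3; rewrite -/u; set k := (b ^+ 2)^-1 ^+ 2; nra.
move=> h4; apply: le_trans h4 _.
apply: (@le_trans _ _ (2 * ((2 * c0 + 1) * (4 * K)) + 2 * (Qf q / b ^+ 4))).
  by rewrite lerD2r ler_wpM2l.
rewrite -/A /bound_const /K; set E := Qf q / b ^+ 4 in Qb0 *.
have := mulr_ge0 A0 A0; set c := c0 in c2 *.
have cA : 0 <= c * A by rewrite mulr_ge0//; lra.
have cE : 0 <= c * E by rewrite mulr_ge0//; lra.
have ccE : 0 <= c * (c * E) by rewrite mulr_ge0//; lra.
have ccA : 0 <= c * (c * A) by rewrite mulr_ge0//; lra.
nra.
Qed.

End solution.

(** * Uniqueness *)

Section cutoff.
Context {R : realType}.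

(** Treats the square of the positive part at all points at once, including the junction at 0. *)
Lemma is_derive_of_quadratic (f : R -> R) (x d : R) :
  (forall h, `|f (x + h) - f x - d * h| <= h ^+ 2) -> is_derive x 1 f d.
Proof.
move=> hf.
have cf : (fun h : R => h^-1 *: ((f \o shift x) (h *: 1) - f x)) @ 0^' --> d.
  apply/cvgrPdist_le => e e0; near=> h.
  have h0 : h != 0 by near: h; exact: nbhs_dnbhs_neq.
  have he : `|h| <= e by near: h; exact: dnbhs0_le.
  rewrite /= /GRing.scale/= mulr1 [h + x]addrC.
  have -> : d - h^-1 * (f (x + h) - f x) = - (h^-1 * (f (x + h) - f x - d * h)).
    by field.
  rewrite normrN normrM normfV ler_pdivrMl ?normr_gt0//.
  apply: le_trans (hf h) _; rewrite -real_normK ?num_real// expr2.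
  by rewrite ler_wpM2l.
apply: DeriveDef; first by apply/cvg_ex; exists d.
exact/cvg_lim.
Unshelve. all: by end_near. Qed.

Definition pos_part (y : R) : R := (y + `|y|) / 2.

Lemma pos_partP (y : R) : (0 <= y /\ pos_part y = y) \/ (y < 0 /\ pos_part y = 0).
Proof.
rewrite /pos_part; have [y0|y0] := leP 0 y; [left|right]; split => //.
  by rewrite ger0_norm//; field.
by rewrite ltr0_norm// subrr mul0r.
Qed.

Lemma pos_part_ge0 (y : R) : 0 <= pos_part y.
Proof. by case: (pos_partP y) => -[y0 ->]. Qed.

Lemma pos_part_continuous (y : R) : {for y, continuous pos_part}.
Proof.
apply: cvgMl; apply: cvgD; first exact: cvg_id.
by apply: cvg_norm; exact: cvg_id.
Qed.

Lemma is_derive_pos_part_sqr (y : R) :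
  is_derive y 1 (fun y => pos_part y ^+ 2) (2 * pos_part y).
Proof.
apply: is_derive_of_quadratic => h; rewrite ler_norml.
case: (pos_partP (y + h)) => -[y1 ->]; case: (pos_partP y) => -[y2 ->];
  apply/andP; split; nra.
Qed.

(** Squaring the positive part makes the cutoff C^1 at the ends of its support; the variable
    [e * ln x] makes x times its derivative of order e. *)
Definition chi (e x : R) : R := pos_part (1 - (e * ln x) ^+ 2) ^+ 2.
Definition dchi (e x : R) : R :=
  2 * pos_part (1 - (e * ln x) ^+ 2) * (- (2 * (e * ln x) * (e * x^-1))).

Lemma is_derive_chi (e x : R) : 0 < x -> is_derive x 1 (chi e) (dchi e x).
Proof.
move=> x0.
have d1 : is_derive x 1 (fun x => 1 - (e * ln x) ^+ 2)
    (- (2 * (e * ln x) * (e * x^-1))).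
  have dl := is_derive1_ln x0.
  by apply: is_derive_eq; rewrite /GRing.scale/=; ring.
exact: (is_derive1_comp (is_derive_pos_part_sqr _) d1).
Qed.

Lemma ln_for_continuous (x : R) : 0 < x -> {for x, continuous (@ln R)}.
Proof. by move=> x0; exact: continuous_ln. Qed.

Lemma chi_arg_continuous (e x : R) : 0 < x ->
  {for x, continuous (fun x => 1 - (e * ln x) ^+ 2)}.
Proof.
move=> x0; apply: cvgB; first exact: cvg_cst.
by apply: cvgM; apply: cvgMr; exact: ln_for_continuous.
Qed.

Lemma dchi_continuous (e x : R) : 0 < x -> {for x, continuous (dchi e)}.
Proof.
move=> x0; apply: cvgM.
  apply: cvgMr.
  apply: (@continuous_comp _ _ _ (fun x : R => 1 - (e * ln x) ^+ 2) pos_part x).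
    exact: chi_arg_continuous.
  exact: pos_part_continuous.
apply: cvgN; apply: cvgM.
  by apply: cvgMr; apply: cvgMr; exact: ln_for_continuous.
by apply: cvgMr; apply: inv_continuous; rewrite gt_eqF.
Qed.

Lemma chi_ge0 (e x : R) : 0 <= chi e x.
Proof. exact: sqr_ge0. Qed.

Lemma chi_arg_bounds (e x : R) : 0 <= pos_part (1 - (e * ln x) ^+ 2) <= 1.
Proof.
rewrite pos_part_ge0/=; case: (pos_partP (1 - (e * ln x) ^+ 2)) => -[h ->] //.
by rewrite gerBl sqr_ge0.
Qed.

Lemma chi_le1 (e x : R) : chi e x <= 1.
Proof.
by have /andP[h1 h2] := chi_arg_bounds e x; rewrite /chi expr_le1.
Qed.

Lemma dchi_bound (e x : R) : 0 < e -> 0 < x -> `|dchi e x| <= 4 * e * x^-1.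
Proof.
move=> e0 x0; have xi0 : 0 < x^-1 by rewrite invr_gt0.
rewrite /dchi; set z := e * ln x.
have -> : 2 * pos_part (1 - z ^+ 2) * (- (2 * z * (e * x^-1))) =
  - (4 * e * x^-1 * (pos_part (1 - z ^+ 2) * z)) by ring.
rewrite normrN normrM ger0_norm; last by rewrite !mulr_ge0// ltW.
rewrite ler_piMr//; first by rewrite !mulr_ge0// ltW.
rewrite ler_norml; case: (pos_partP (1 - z ^+ 2)) => -[h ->].
  have : `|z| <= 1.
    rewrite -(@ler_pXn2r _ 2)// ?nnegrE// real_normK ?num_real// expr1n; lra.
  rewrite ler_norml => /andP[z1 z2]; have h1 := sqr_ge0 z.
  have k1 : 0 <= (1 - z ^+ 2) * (1 - z) by rewrite mulr_ge0// subr_ge0.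
  have k2 : 0 <= (1 - z ^+ 2) * (1 + z) by rewrite mulr_ge0//; lra.
  by apply/andP; split; lra.
by rewrite mul0r lerN10 ler01.
Qed.

Lemma chi_mono (e e' x : R) : 0 <= e -> e <= e' -> chi e' x <= chi e x.
Proof.
move=> e0 ee; rewrite /chi lerXn2r ?nnegrE ?pos_part_ge0//.
have : (e * ln x) ^+ 2 <= (e' * ln x) ^+ 2.
  rewrite !exprMn ler_wpM2r ?sqr_ge0// lerXn2r ?nnegrE//.
  exact: le_trans ee.
case: (pos_partP (1 - (e' * ln x) ^+ 2)) => -[h ->]; last by move=> _; exact: pos_part_ge0.
case: (pos_partP (1 - (e * ln x) ^+ 2)) => -[h' ->]; lra.
Qed.

Lemma chi_support (e x : R) : 0 < e -> 0 < x ->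
  x \notin `[expR (- e^-1), expR e^-1] -> chi e x = 0.
Proof.
move=> e0 x0; rewrite in_itv/= negb_and -!ltNge => h.
suff z1 : 1 < (e * ln x) ^+ 2.
  rewrite /chi; case: (pos_partP (1 - (e * ln x) ^+ 2)) => -[h' ->].
    by exfalso; lra.
  by rewrite expr0n.
have lnE : expR (ln x) = x by apply: lnK; rewrite posrE.
have ie : e * e^-1 = 1 by rewrite divff// gt_eqF.
case/orP: h => h.
  have : ln x < - e^-1 by rewrite -ltr_expR lnE.
  move=> k; have : e * ln x < e * - e^-1 by rewrite ltr_pM2l.
  rewrite mulrN ie; nra.
have : e^-1 < ln x by rewrite -ltr_expR lnE.
move=> k; have : e * e^-1 < e * ln x by rewrite ltr_pM2l.
rewrite ie; nra.
Qed.

Lemma chi_gt0 (e x : R) : (e * ln x) ^+ 2 < 1 -> 0 < chi e x.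
Proof.
move=> h; rewrite /chi exprn_gt0//.
by case: (pos_partP (1 - (e * ln x) ^+ 2)) => -[h' ->]; lra.
Qed.

End cutoff.

(** * The homogeneous weak equation *)

Section uniqueness.
Context {R : realType}.
Local Notation mu := (@lebesgue_measure R).
Local Notation H := (halfline R).
Variables (r : R) (xi : R -> R) (b : R).
Hypothesis r0 : 0 < r.
Hypothesis mxi : measurable_fun H xi.
Hypothesis b0 : 0 < b.

Variable p : (R -> R) * (R -> R).
Hypothesis ap : adm r xi p.
Hypothesis hp : forall t, tst t ->
  Bf r xi p t = - (b ^+ 2 * II (fun x => p.1 x * t.1 x * x)).

Let cut (e : R) : (R -> R) * (R -> R) :=
  (fun x => chi e x * p.1 x, fun x => dchi e x * p.1 x + p.2 x * chi e x).

Let acp_chi (e : R) : acp (chi e) (dchi e).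
Proof. by apply: acp_C1 => x x0; [exact: is_derive_chi|exact: dchi_continuous]. Qed.

Let mchi (e : R) : measurable_fun H (chi e). Proof. exact: acp_meas (acp_chi e). Qed.

Let mdchi (e : R) : measurable_fun H (dchi e).
Proof. by apply: continuousH_meas => x; exact: dchi_continuous. Qed.

Let chi_L2 (e : R) (f : R -> R) : L2 f -> L2 (fun x => chi e x * f x).
Proof.
move=> Lf; apply: (L2_dom (c := 1)) (Lf).
  by apply: measurable_funM => //; exact: Lf.1.
move=> x x0; rewrite normrM ler_wpM2r// ger0_norm ?chi_ge0//.
exact: chi_le1.
Qed.

Let dchi_sqr (e x : R) : 0 < e -> 0 < x ->
  (dchi e x * p.1 x) ^+ 2 <= (4 * e) ^+ 2 * fdiv p x ^+ 2.
Proof.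
move=> e0 x0; rewrite -real_normK ?num_real// normrM.
have -> : (4 * e) ^+ 2 * fdiv p x ^+ 2 = (4 * e * x^-1 * `|p.1 x|) ^+ 2.
  by rewrite /fdiv !exprMn real_normK ?num_real//; ring.
have h : `|dchi e x| * `|p.1 x| <= 4 * e * x^-1 * `|p.1 x|.
  by rewrite ler_wpM2r// dchi_bound.
have h0 : 0 <= `|dchi e x| * `|p.1 x| by rewrite mulr_ge0.
by rewrite lerXn2r// nnegrE// (le_trans h0 h).
Qed.

Let dchi_L2 (e : R) : 0 < e -> L2 (fun x => dchi e x * p.1 x).
Proof.
move=> e0; have Ld : L2 (fdiv p) by case: ap.
apply: (L2_dom (c := 4 * e)) (Ld).
  by apply: measurable_funM => //; exact: adm_meas ap.
move=> x x0; rewrite -(@ler_pXn2r _ 2)// ?nnegrE ?mulr_ge0//; last exact: ltW.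
by rewrite exprMn !real_normK ?num_real// dchi_sqr.
Qed.

Let cut_tst (e : R) : 0 < e -> tst (cut e).
Proof.
move=> e0; case: (ap) => wp Lg Ld _; split.
- exact: is_wderivM (acp_wderiv (acp_chi e)) wp.
- apply: L2D; first exact: dchi_L2.
  by apply: eq_L2 (chi_L2 e Lg) => x _; rewrite mulrC.
- by apply: eq_L2 (chi_L2 e Ld) => x _; rewrite /fdiv mulrA.
- exists (expR (- e^-1)), (expR e^-1); split; first exact: expR_gt0.
    by rewrite ler_expR ge0_cp ?invr_ge0 ?ltW.
  by move=> x x0 h; rewrite /cut /= chi_support// mul0r.
Qed.

Let N (e : R) := II (fun x => chi e x * p.1 x ^+ 2 * x).

Let cut_itg (e : R) : 0 < e -> itg (fun x => chi e x * p.1 x ^+ 2 * x).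
Proof.
move=> e0; have tc := cut_tst e0; have mc := tst_meas tc.
case: (ap) => _ _ Lp _; case: (tc) => _ _ Lc cc.
apply: eq_itg (L2_itg Lp (cs_L2_x mc Lc cc)) => x x0.
by rewrite /fdiv /cut /=; field; rewrite gt_eqF.
Qed.

(** F(chi p) = chi F p + chi' p. Tested with chi p, the terms carrying chi are nonnegative, so b^2
    N(e) is at most the pairing of F p with -chi' p. The bound |chi'| <= 4 e/x turns it into norms
    of F p and p/x, which are finite although p itself need not be in L^2. *)
Let N_bound (e : R) : 0 < e ->
  (b ^+ 2 * N e) ^+ 2 <= 16 * e ^+ 2 * (nsq (fF r p) * nsq (fdiv p)).
Proof.
move=> e0; have tc := cut_tst e0; have := hp tc.
have LF := fF_L2 r0 ap; case: (ap) => wp Lg Ld Lx.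
have -> : II (fun x => p.1 x * (cut e).1 x * x) = N e.
  by apply: eq_II => x _; rewrite /cut /=; ring.
rewrite /Bf.
have -> : ip (fF r p) (fF r (cut e)) =
    ip (fF r p) (fun x => chi e x * fF r p x) +
    ip (fF r p) (fun x => dchi e x * p.1 x).
  rewrite -ipDr//; [|exact: chi_L2|exact: dchi_L2].
  by apply: eq_ip => // x _; rewrite /fF /Fp /cut /=; ring.
set P := ip _ (fun x => dchi e x * _).
have h1 : 0 <= ip (fF r p) (fun x => chi e x * fF r p x).
  apply: II_ge0 => x x0; rewrite mulrCA -expr2.
  by rewrite mulr_ge0 ?(ltW x0)// mulr_ge0 ?sqr_ge0 ?chi_ge0.
have h2 : 0 <= ip (fxb r xi p) (fxb r xi (cut e)).
  apply: II_ge0 => x x0; rewrite /fxb /cut /=.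
  have -> : xibar r xi x * p.1 x * (xibar r xi x * (chi e x * p.1 x)) =
    chi e x * (xibar r xi x * p.1 x) ^+ 2 by ring.
  by rewrite mulr_ge0 ?(ltW x0)// mulr_ge0 ?sqr_ge0 ?chi_ge0.
have N0 : 0 <= N e.
  apply: II_ge0 => x x0.
  by rewrite mulr_ge0 ?(ltW x0)// mulr_ge0 ?sqr_ge0 ?chi_ge0.
move=> hE; have hP : b ^+ 2 * N e <= - P.
  have : 0 <= 2^-1 * ip (fxb r xi p) (fxb r xi (cut e)) by rewrite mulr_ge0.
  by move: h1 hE; lra.
have bN : 0 <= b ^+ 2 * N e by rewrite mulr_ge0 ?sqr_ge0.
apply: (@le_trans _ _ (P ^+ 2)).
  by rewrite -[P ^+ 2]sqrrN lerXn2r ?nnegrE// (le_trans bN).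
apply: le_trans (ip_cs LF (dchi_L2 e0)) _.
have -> : 16 * e ^+ 2 * (nsq (fF r p) * nsq (fdiv p)) =
  nsq (fF r p) * ((4 * e) ^+ 2 * nsq (fdiv p)) by ring.
rewrite ler_wpM2l ?nsq_ge0//; apply: le_nsq => //; first exact: dchi_L2.
by move=> x x0; exact: dchi_sqr.
Qed.

Lemma unique_zero : ae_eq_halfline p.1 (fun=> 0).
Proof.
pose e n : R := n.+1%:R^-1.
have e0 n : 0 < e n by rewrite invr_gt0.
(* N(e_m) <= N(e_n) for n >= m, since chi grows as e decreases, and N(e_n) is of order e_n. *)
have Nm m : N (e m) <= 0.
  rewrite leNgt; apply/negP => Npos.
  set A := 16 * (nsq (fF r p) * nsq (fdiv p)).
  have key n : (m <= n)%N -> (b ^+ 2 * N (e m)) ^+ 2 <= A * e n ^+ 2.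
    move=> mn; apply: (@le_trans _ _ ((b ^+ 2 * N (e n)) ^+ 2)).
      have NN : N (e m) <= N (e n).
        apply: le_II; [exact: cut_itg|exact: cut_itg|] => x x0.
        rewrite ler_wpM2r ?(ltW x0)// ler_wpM2r ?sqr_ge0//.
        by apply: chi_mono; [exact: ltW|rewrite lef_pV2 ?posrE// ler_nat].
      have b2 : 0 <= b ^+ 2 by exact: sqr_ge0.
      rewrite lerXn2r ?nnegrE ?ler_wpM2l// mulr_ge0//; first exact: ltW.
      by apply: le_trans NN; exact: ltW.
    apply: le_trans (N_bound (e0 n)) _.
    by rewrite /A le_eqVlt; apply/orP; left; apply/eqP; ring.
  set B := (b ^+ 2 * N (e m)) ^+ 2 in key.
  have B0 : 0 < B by rewrite exprn_gt0// mulr_gt0// exprn_gt0.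
  have A0 : 0 <= A by rewrite !mulr_ge0 ?nsq_ge0.
  (* Large enough that A < B (n+1), which contradicts B (n+1)^2 <= A. *)
  pose n := (m + Num.truncn (A / B))%N.
  have := key n (leq_addr _ _).
  have nAB : A / B < n.+1%:R.
    by apply: lt_le_trans (truncnS_gt _) _; rewrite ler_nat ltnS leq_addl.
  have n1 : 1 <= n.+1%:R :> R by rewrite ler1n.
  rewrite /e exprVn ler_pdivlMr; last by rewrite exprn_gt0.
  move: nAB; rewrite ltr_pdivrMr//; set k := n.+1%:R in n1 *; nra.
have : {ae mu, forall x n, 0 < x -> chi (e n) x * p.1 x ^+ 2 * x = 0}.
  apply: ae_foralln => n; apply: II_eq0; [exact: cut_itg| |exact: Nm].
  by move=> x x0; rewrite mulr_ge0 ?(ltW x0)// mulr_ge0 ?sqr_ge0 ?chi_ge0.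
apply: aeS => x hx x0.
(* |ln x| < n + 1 places x in the interior of the support of [chi (e n)]. *)
pose n := Num.truncn `|ln x|.
have /eqP := hx n x0.
rewrite mulf_eq0 (gt_eqF x0) orbF mulf_eq0.
have c0 : 0 < chi (e n) x.
  apply: chi_gt0; rewrite -real_normK ?num_real// expr_lt1//.
  rewrite normrM ger0_norm; last exact: ltW.
  by rewrite /e mulrC ltr_pdivrMr// mul1r truncnS_gt.
by rewrite (gt_eqF c0) orFb sqrf_eq0 => /eqP.
Qed.

End uniqueness.

(** * The two estimates *)

Section norms.
Context {R : realType}.
Local Notation mu := (@lebesgue_measure R).
Local Notation H := (halfline R).

Lemma l2norm_ge0 (f : R -> R) : (0 <= l2norm f)%E.
Proof. exact: poweR_ge0. Qed.

Lemma l2norm_sqr (f : R -> R) : L2 f -> (l2norm f `^ 2 = (nsq f)%:E)%E.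
Proof. by move=> Lf; rewrite l2normE// poweR_EFin powR_half_sqr ?nsq_ge0. Qed.

Lemma l2norm_sqr_lty (f : R -> R) : measurable_fun H f ->
  (l2norm f `^ 2 < +oo)%E -> L2 f.
Proof.
move=> mf h; apply: l2norm_lty => //; apply: lty_poweRy h.
by rewrite pnatr_eq0.
Qed.

Lemma div_meas (v : R -> R) : measurable_fun H v -> measurable_fun H (fun x => v x / x).
Proof. by move=> mv; apply: measurable_funM => //; exact: inv_meas. Qed.

Lemma Xnorm_lty (v : R -> R) : wdifferentiable v ->
  (l2norm (wderiv v) `^ 2 + l2norm (fun x => v x / x)%R `^ 2 < +oo)%E ->
  [/\ is_wderiv v (wderiv v), L2 (wderiv v) & L2 (fun x => v x / x)].
Proof.
move=> /wderiv_is wv h; have [mv mg] := is_wderiv_meas wv; split => //.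
- apply: l2norm_sqr_lty => //; apply: le_lt_trans h.
  by rewrite leeDl// poweR_ge0.
- apply: l2norm_sqr_lty; first exact: div_meas.
  by apply: le_lt_trans h; rewrite leeDr// poweR_ge0.
Qed.

Lemma in_XE (v : R -> R) : in_X v <->
  [/\ is_wderiv v (wderiv v), L2 (wderiv v) & L2 (fun x => v x / x)].
Proof.
split=> [[dv h]|[wv Lg Lv]].
  by apply: Xnorm_lty => //; apply: lty_poweRy h; rewrite invr_neq0.
split; first by exists (wderiv v).
by rewrite /Xnorm !l2norm_sqr// -EFinD poweR_EFin ltry.
Qed.

Lemma XnormE (v : R -> R) : in_X v ->
  Xnorm v = ((nsq (wderiv v) + nsq (fun x => v x / x)) `^ 2^-1)%:E.
Proof.
by move=> /in_XE[_ Lg Lv]; rewrite /Xnorm !l2norm_sqr// -EFinD poweR_EFin.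
Qed.

(** Origin of the radius 1/5: [sup_bound] gives xi^2 <= 3/25, which is below the 1/8 needed for
    coercivity. *)
Lemma small_sup (xi : R -> R) : in_X xi -> (Xnorm xi <= (5^-1)%:E)%E ->
  measurable_fun H xi /\ {ae mu, forall x, 0 < x -> xi x ^+ 2 <= 8^-1}.
Proof.
move=> Xxi; rewrite XnormE// lee_fin => h; move/in_XE : Xxi => [wx Lg Lv].
split; first by case: (is_wderiv_meas wx).
have := sup_bound wx Lg Lv; apply: aeS => x hx x0; apply: le_trans (hx x0) _.
have S0 : 0 <= nsq (wderiv xi) + nsq (fun x => xi x / x) by rewrite addr_ge0 ?nsq_ge0.
have := powR_half_sqr S0; have := powR_ge0 (nsq (wderiv xi) + nsq (fun x => xi x / x)) 2^-1.
move: h; set S := nsq _ + _; set t := S `^ _ => h t0.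
by rewrite (powR_mulrn 2)// => <-; nra.
Qed.

Lemma ae_ip (f f' h : R -> R) : measurable_fun H f -> measurable_fun H f' ->
  measurable_fun H h -> ae_eq_halfline f f' -> ip f h = ip f' h.
Proof.
move=> mf mf' mh ff; apply: ae_II.
- by apply: measurable_funM; [exact: measurable_funM|exact: id_meas].
- by apply: measurable_funM; [exact: measurable_funM|exact: id_meas].
- by apply: aeS ff => x e x0; rewrite e.
Qed.

Variables (r : R) (xi : R -> R) (b : R).
Hypothesis r0 : 0 < r.
Hypothesis mxi : measurable_fun H xi.
Hypothesis bxi : {ae mu, forall x, 0 < x -> xi x ^+ 2 <= 8^-1}.
Hypothesis b0 : 0 < b.

Lemma in_Xxi_adm (u : R -> R) : in_Xxi r xi u -> adm r xi (u, wderiv u).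
Proof.
move=> [du h].
have [mu_ _] := is_wderiv_meas (wderiv_is du).
have {}h : (Xnorm u `^ 2 + 2^-1%:E * l2norm (fun x => xibar r xi x * u x)%R `^ 2 < +oo)%E.
  by apply: lty_poweRy h; rewrite invr_neq0.
have hX : (Xnorm u `^ 2 < +oo)%E.
  by apply: le_lt_trans h; rewrite leeDl// mule_ge0// poweR_ge0.
have hx : (2^-1%:E * l2norm (fun x => xibar r xi x * u x)%R `^ 2 < +oo)%E.
  by apply: le_lt_trans h; rewrite leeDr// poweR_ge0.
have /in_XE[wu Lg Lv] : in_X u.
  by split => //; apply: lty_poweRy hX; rewrite pnatr_eq0.
split => //; apply: l2norm_sqr_lty.
  by apply: measurable_funM => //; exact: xibar_meas.
rewrite ltNge leye_eq; apply/negP => /eqP e; move: hx; rewrite e.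
by rewrite gt0_muley ?lte_fin ?invr_gt0// ltxx.
Qed.

(** The construction produces one weak derivative and [wderiv] selects another. This lemma and the
    next two let either be used. *)
Lemma adm_ae (u g g' : R -> R) : adm r xi (u, g) -> is_wderiv u g' ->
  adm r xi (u, g').
Proof.
move=> [/= wu Lg Lv Lx] wu'; split => //=.
apply: ae_L2 Lg; first by case: (is_wderiv_meas wu').
by apply: is_wderiv_uniq wu wu' _; exact: aeW.
Qed.

Lemma Qf_ae (u g g' : R -> R) : is_wderiv u g -> is_wderiv u g' ->
  Qf r xi (u, g) = Qf r xi (u, g').
Proof.
move=> wu wu'; rewrite /Qf /=; congr (_ + _ + _); apply: ae_nsq.
- by case: (is_wderiv_meas wu).
- by case: (is_wderiv_meas wu').
- by apply: is_wderiv_uniq wu wu' _; exact: aeW.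
Qed.

Lemma Bf_ae (u g g' v h h' : R -> R) : is_wderiv u g -> is_wderiv u g' ->
  is_wderiv v h -> is_wderiv v h' ->
  Bf r xi (u, g) (v, h) = Bf r xi (u, g') (v, h').
Proof.
move=> wu wu' wv wv'.
have mF w k : is_wderiv w k -> measurable_fun H (fF r (w, k)).
  move=> /is_wderiv_meas[mw mk]; apply: measurable_funD => //.
  apply: measurable_funM => //; apply: measurable_funM; last exact: inv_meas.
  by apply: continuousH_meas => x _; exact: potc_continuous.
have aeF w k k' : is_wderiv w k -> is_wderiv w k' ->
    ae_eq_halfline (fF r (w, k)) (fF r (w, k')).
  move=> wk wk'; have : ae_eq_halfline k k'.
    by apply: is_wderiv_uniq wk wk' _; exact: aeW.
  by apply: aeS => x e x0; rewrite /fF /Fp /= e.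
rewrite /Bf; congr (_ + _).
rewrite (ae_ip (mF _ _ wu) (mF _ _ wu') (mF _ _ wv))//; last exact: aeF.
by rewrite ipC (ae_ip (mF _ _ wv) (mF _ _ wv') (mF _ _ wu')) 1?ipC//; exact: aeF.
Qed.

Lemma opFE (u : R -> R) x : opF r u x = fF r (u, wderiv u) x.
Proof. by rewrite /opF cos_theta. Qed.

Lemma adm_Xxinorm (u g : R -> R) : adm r xi (u, g) ->
  in_Xxi r xi u /\ Xxinorm r xi u = (Qf r xi (u, g) `^ 2^-1)%:E.
Proof.
move=> au; have [/= wu _ _ _] := au.
have wu' : is_wderiv u (wderiv u) by apply: wderiv_is; exists g.
have [/= _ Lg Lv Lx] := adm_ae au wu'.
have Xu : in_X u by apply/in_XE.
have E : Xxinorm r xi u = (Qf r xi (u, g) `^ 2^-1)%:E.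
  rewrite (Qf_ae wu wu') /Xxinorm XnormE// poweR_EFin powR_half_sqr; last first.
    by rewrite addr_ge0 ?nsq_ge0.
  by rewrite l2norm_sqr// -EFinM -EFinD poweR_EFin.
by split => //; split; [exists g|rewrite E ltry].
Qed.

Lemma adm_tst_itg p t : adm r xi p -> tst t -> itg (fun x => p.1 x * t.1 x * x).
Proof.
move=> ap tt; have mt := tst_meas tt; case: ap tt => _ _ Lp _ [_ _ Lt ct].
apply: eq_itg (L2_itg Lp (cs_L2_x mt Lt ct)) => x x0.
by rewrite /fdiv; field; rewrite gt_eqF.
Qed.

Lemma in_X_tst (v : R -> R) : in_X v -> compactly_supported v -> tst (v, wderiv v).
Proof. by move=> /in_XE[wv Lg Lv] cv. Qed.

(** Turns the two extended-real sides of [is_adjF] into real numbers, so that the adjoint equation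
    becomes the weak equation for [Bf]. Integrability of f v x is passed in because f is only
    controlled through the splitting of the source. *)
Lemma adjoint_formE (f u v : R -> R) : adm r xi (u, wderiv u) -> in_X v ->
  compactly_supported v -> itg (fun x => f x * v x * x) ->
  (\int[mu]_(x in H) (opF r u x * opF r v x * x)%:E =
     (ip (fF r (u, wderiv u)) (fF r (v, wderiv v)))%:E)%E /\
  (\int[mu]_(x in H) ((f x - (2^-1 * xibar r xi x ^+ 2 * u x + b ^+ 2 * u x)) * v x * x)%:E =
    (II (fun x => f x * v x * x) - 2^-1 * ip (fxb r xi (u, wderiv u)) (fxb r xi (v, wderiv v))
      - b ^+ 2 * II (fun x => u x * v x * x))%:E)%E.
Proof.
move=> au Xv cv If; have tv := in_X_tst Xv cv; have av := tst_adm r0 mxi bxi tv.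
have Fu := fF_L2 r0 au; have Fv := fF_L2 r0 av; split.
  rewrite /ip EFin_II; last exact: L2_itg.
  by apply: eq_integral => x _; rewrite !opFE.
have Iuv : itg (fun x => u x * v x * x) by exact: (adm_tst_itg au tv).
have Lxu : L2 (fxb r xi (u, wderiv u)) by case: au.
have Lxv : L2 (fxb r xi (v, wderiv v)) by case: av.
have Ix := L2_itg Lxu Lxv.
rewrite -IIZ// -IIZ// -IIB//; last exact: itgZ.
rewrite -IIB//; [|by apply: itgB => //; exact: itgZ|exact: itgZ].
rewrite EFin_II; last by apply: itgB; [apply: itgB => //|]; exact: itgZ.
by apply: eq_integral => x _; congr (_%:E); rewrite /fxb /=; ring.
Qed.

Lemma solves_weak (f u : R -> R) t : solves r xi b f u -> tst t ->
  itg (fun x => f x * t.1 x * x) ->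
  Bf r xi (u, wderiv u) t = II (fun x => f x * t.1 x * x)
                          - b ^+ 2 * II (fun x => u x * t.1 x * x).
Proof.
case: t => v h [Xu adj] tt If; have au := in_Xxi_adm Xu.
case: (tt) => /= wv Lh Lv cv.
have wv' : is_wderiv v (wderiv v) by apply: wderiv_is; exists h.
have wu : is_wderiv u (wderiv u) by case: au.
have Xv : in_X v.
  apply/in_XE; split => //; apply: ae_L2 Lh; first by case: (is_wderiv_meas wv').
  by apply: is_wderiv_uniq wv wv' _; exact: aeW.
have [E1 E2] := adjoint_formE au Xv cv If.
have := adj v Xv cv; rewrite E1 E2 => -[E].
by rewrite (Bf_ae wu wu wv wv') /Bf E; ring.
Qed.

Lemma weak_solves (f u g : R -> R) : adm r xi (u, g) ->
  (forall t, tst t -> itg (fun x => f x * t.1 x * x) /\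
    Bf r xi (u, g) t = II (fun x => f x * t.1 x * x)
                          - b ^+ 2 * II (fun x => u x * t.1 x * x)) ->
  is_inverse r xi b f u.
Proof.
move=> au hu; have [/= wu _ _ _] := au.
have wu' : is_wderiv u (wderiv u) by apply: wderiv_is; exists g.
have au' := adm_ae au wu'.
split.
  split; first by case: (adm_Xxinorm au).
  move=> v Xv cv; have tv := in_X_tst Xv cv.
  have [/= If E] := hu _ tv; have [E1 E2] := adjoint_formE au' Xv cv If.
  rewrite E1 E2; congr (_%:E); move: E.
  have wv : is_wderiv v (wderiv v) by case: tv.
  by rewrite (Bf_ae wu wu' wv wv) /Bf; lra.
move=> u' su'; have au'' : adm r xi (u', wderiv u') by apply: in_Xxi_adm; case: su'.
(* The source is integrable against each test function, so it cancels and the difference solves the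
   homogeneous equation. *)
pose p := lin (u', wderiv u') (-1) (u, g).
have ap : adm r xi p by exact: adm_lin.
have hp t : tst t -> Bf r xi p t = - (b ^+ 2 * II (fun x => p.1 x * t.1 x * x)).
  move=> tt; have [If E] := hu t tt; have at_ := tst_adm r0 mxi bxi tt.
  rewrite Bf_lin// (solves_weak su' tt If) E.
  have I1 := adm_tst_itg au tt; have I2 := adm_tst_itg au'' tt.
  have -> : II (fun x => p.1 x * t.1 x * x) =
      II (fun x => u' x * t.1 x * x) - II (fun x => u x * t.1 x * x).
    by rewrite -IIB//; apply: eq_II => x _; rewrite /p /=; ring.
  by ring.
have := unique_zero r0 b0 ap hp; apply: aeS => x hx x0.
by have := hx x0; rewrite /p /=; lra.
Qed.

End norms.

(** * The rational cutoff at scale 1/beta *)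

Section rational_cutoff.
Context {R : realType}.

Definition eta (b x : R) : R := (b * x) ^+ 2 / (1 + (b * x) ^+ 2).
Definition deta (b x : R) : R := 2 * b ^+ 2 * x / (1 + (b * x) ^+ 2) ^+ 2.

Lemma eta_den (b x : R) : 0 < 1 + (b * x) ^+ 2.
Proof. by rewrite ltr_wpDr ?sqr_ge0. Qed.

Lemma is_derive_eta (b x : R) : is_derive x 1 (eta b) (deta b x).
Proof.
have d0 : 1 + (b * x) ^+ 2 != 0 by rewrite gt_eqF ?eta_den.
have -> : eta b = (fun x => 1 - (1 + (b * x) ^+ 2)^-1).
  apply/funext => y; have := eta_den b y; rewrite /eta => dy.
  by field; rewrite gt_eqF.
apply: is_derive_eq; rewrite /GRing.scale/= /deta.
by field.
Qed.

Lemma eta_acp (b : R) : acp (eta b) (deta b).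
Proof.
apply: acp_C1 => x _; first exact: is_derive_eta.
have cden : {for x, continuous (fun x : R => 1 + (b * x) ^+ 2)}.
  apply: cvgD; first exact: cvg_cst.
  by apply: cvgM; apply: cvgMr; exact: cvg_id.
apply: cvgM; first by apply: cvgMr; exact: cvg_id.
by apply: cvgV; [rewrite expf_neq0// gt_eqF ?eta_den|apply: cvgM].
Qed.

(** y^(-s) is at least 1 for y <= 1 and at least 1/y for y > 1. Hence 1/(1 + y^2) and y/(1 + y^2)
    are both at most y^(-s). *)
Lemma powR_cutoff (s y : R) : 0 <= s -> s <= 1 -> 0 < y ->
  1 <= y `^ (- s) * (1 + y ^+ 2) /\ y <= y `^ (- s) * (1 + y ^+ 2).
Proof.
move=> s0 s1 y0; have z0 : 0 < y `^ (- s) by rewrite powR_gt0.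
have [y1|y1] := leP y 1.
  have z1 : 1 <= y `^ (- s).
    by rewrite -(powRr0 y) ger_powR ?y0// oppr_le0.
  have := sqr_ge0 y; split; nra.
have z1 : y^-1 <= y `^ (- s).
  by rewrite -(powR_inv1 (ltW y0)) ler_powR ?lerN2//; exact: ltW.
have : 1 <= y `^ (- s) * y.
  by rewrite -(ler_pM2r (x := y^-1)) ?invr_gt0// mul1r mulfK ?gt_eqF.
move: (y `^ (- s)) z0 z1 => z z0 z1 zy; split; nra.
Qed.

(* With y = b x: the cutoff 1/(1+y^2) pays b^-s x^-s, and y/(1+y^2), y^2/(1+y^2)
   pay the missing powers of x at the price b^(1-s). *)
Lemma eta_bounds (b s x : R) : 0 < b -> 0 <= s -> s <= 1 -> 0 < x ->
  [/\ 0 <= 1 - eta b x <= b `^ (- s) * x `^ (- s),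
      0 <= eta b x <= b `^ (1 - s) * x `^ (1 - s),
      eta b x / x <= b `^ (1 - s) * x `^ (- s) &
      0 <= deta b x <= 2 * (b `^ (1 - s) * x `^ (- s))].
Proof.
move=> b0 s0 s1 x0; set y := b * x; have y0 : 0 < y by rewrite mulr_gt0.
have [h1 h2] := powR_cutoff s0 s1 y0; have D0 := eta_den b x.
have yE : y `^ (- s) = b `^ (- s) * x `^ (- s) by rewrite powRM// ltW.
have pE a : 0 < a -> a `^ (1 - s) = a * a `^ (- s).
  move=> a0; rewrite -{2}[a]powRr1 ?ltW// -powRD//.
  by apply/implyP => _; rewrite gt_eqF.
rewrite !pE// -yE; set z := y `^ (- s) in h1 h2 yE *.
have -> : b * b `^ (- s) * (x * x `^ (- s)) = y * z by rewrite yE /y; ring.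
have -> : b * b `^ (- s) * x `^ (- s) = b * z by rewrite yE; ring.
have e1 : 1 - eta b x = (1 + y ^+ 2)^-1.
  by rewrite /eta -/y; field; rewrite gt_eqF.
have e2 : eta b x = y * (y / (1 + y ^+ 2)).
  by rewrite /eta -/y; field; rewrite gt_eqF.
have e3 : eta b x / x = b * (y / (1 + y ^+ 2)).
  by rewrite e2 /y; field; rewrite !gt_eqF.
have k1 : (1 + y ^+ 2)^-1 <= z by rewrite -div1r ler_pdivrMr.
have k2 : y / (1 + y ^+ 2) <= z by rewrite ler_pdivrMr.
have k20 : 0 <= y / (1 + y ^+ 2) by rewrite divr_ge0// ltW.
have k3 : 0 <= (1 + y ^+ 2)^-1 <= 1.
  by rewrite invr_ge0 ltW//= invf_le1// lerDl sqr_ge0.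
have e4 : deta b x = 2 * b * (y / (1 + y ^+ 2)) * (1 + y ^+ 2)^-1.
  by rewrite /deta -/y /y; field; rewrite gt_eqF.
split.
- by rewrite e1 k1 andbT; case/andP: k3.
- by rewrite e2 mulr_ge0 ?(ltW y0)//= ler_wpM2l// ltW.
- by rewrite e3 ler_wpM2l// ltW.
- case/andP: k3 => k3 k4; have bk : 0 <= 2 * b * (y / (1 + y ^+ 2)).
    by rewrite !mulr_ge0// ltW.
  rewrite e4 mulr_ge0//=; apply: le_trans (_ : 2 * b * (y / (1 + y ^+ 2)) <= _).
    by rewrite ler_piMr.
  by rewrite -mulrA ler_wpM2l// ler_wpM2l// ltW.
Qed.

End rational_cutoff.

Lemma sqrt_scale {R : realType} (K n d : R) : 0 <= K -> 0 <= n -> 0 < d ->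
  Num.sqrt K / d * Num.sqrt n = Num.sqrt (K * (n / d ^+ 2)).
Proof.
move=> K0 n0 d0; rewrite (sqrtrM _ K0) (sqrtrM _ n0) sqrtrV ?sqr_ge0//.
by rewrite sqrtr_sqr gtr0_norm//; ring.
Qed.

(** * Derivation of the two bounds *)

Section estimates.
Context {R : realType}.
Local Notation mu := (@lebesgue_measure R).
Local Notation H := (halfline R).
Variables (r : R) (xi : R -> R) (b : R).
Hypothesis r0 : 0 < r.
Hypothesis mxi : measurable_fun H xi.
Hypothesis bxi : {ae mu, forall x, 0 < x -> xi x ^+ 2 <= 8^-1}.
Hypothesis b0 : 0 < b.

Lemma inverse_split (f f1 : R -> R) (s : R) q : 0 <= s -> s <= 1 ->
  L2 (fun x => x `^ s * f1 x) -> adm r xi q ->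
  (forall x, 0 < x -> f x = f1 x + q.1 x) ->
  exists u, is_inverse r xi b f u /\ exists2 Q : R,
    Xxinorm r xi u = (Num.sqrt Q)%:E &
    Q <= bound_const r *
      (nsq (fun x => x `^ s * f1 x) / (b `^ (1 - s)) ^+ 2 + Qf r xi q / b ^+ 4).
Proof.
move=> s0 s1 Lf aq fE.
have [[u g] [au hu Qu]] := exists_solution r0 mxi bxi b0 s0 s1 Lf aq.
exists u; split.
  apply: (weak_solves r0 mxi bxi b0 au) => t tt; have [I1 [I2 E]] := hu t tt.
  have fe x : 0 < x -> (f1 x + q.1 x) * t.1 x * x = f x * t.1 x * x.
    by move=> x0; rewrite fE.
  by split; [exact: eq_itg I1|rewrite E (eq_II fe)].
exists (Qf r xi (u, g)) => //.
have [_ ->] := adm_Xxinorm au.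
by rewrite powR12_sqrt// /Qf !addr_ge0 ?mulr_ge0 ?nsq_ge0.
Qed.

Lemma l2norm_sqrt (f : R -> R) : L2 f -> l2norm f = (Num.sqrt (nsq f))%:E.
Proof. by move=> Lf; rewrite l2normE// powR12_sqrt// nsq_ge0. Qed.

Lemma bound_const_ge0 : 0 <= bound_const r.
Proof.
have := coerc_ge2 r; rewrite /bound_const; set c := coerc r => c2.
by rewrite addr_ge0// mulr_ge0//; nra.
Qed.

Lemma first_estimate (s : R) (f : R -> R) (C : R) : 0 <= s -> s <= 1 ->
  measurable_fun H f -> Num.sqrt (10 * bound_const r) <= C ->
  (l2norm (fun x => x `^ s * f x)%R < +oo)%E ->
  exists u : R -> R, is_inverse r xi b f u /\
    (Xxinorm r xi u <=
     (C / b `^ (1 - s))%:E * l2norm (fun x => x `^ s * f x)%R)%E.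
Proof.
move=> s0 s1 mf hC foo.
have Lf : L2 (fun x => x `^ s * f x).
  by apply: l2norm_lty => //; apply: measurable_funM => //; exact: powR_meas.
pose q : (R -> R) * (R -> R) := (fun=> 0, fun=> 0).
have L0 := @L20 R.
have aq : adm r xi q.
  split => //.
  - by apply: acp_wderiv; apply: acp_C1 => x _; exact: cst_continuous.
  - by apply: eq_L2 L0 => x _; rewrite /fdiv /= mul0r.
  - by apply: eq_L2 L0 => x _; rewrite /fxb /= mulr0.
have Q0 : Qf r xi q = 0.
  have z (h : R -> R) : (forall x, h x = 0) -> nsq h = 0.
    move=> h0; rewrite -[RHS](@II_zero R); apply: eq_II => x _.
    by rewrite h0 expr0n/= mul0r.
  by rewrite /Qf !z ?mulr0 ?addr0// => x; rewrite /fdiv /fxb /= ?mul0r ?mulr0.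
have [u [iu [Q uQ hQ]]] := inverse_split (f := f) s0 s1 Lf aq (fun x _ => esym (addr0 _)).
exists u; split => //; rewrite uQ l2norm_sqrt// -EFinM lee_fin.
have B0 := bound_const_ge0.
have d0 : 0 < b `^ (1 - s) by rewrite powR_gt0.
have n0 := nsq_ge0 (fun x => x `^ s * f x).
set d := b `^ (1 - s) in hQ d0 *; set n := nsq _ in hQ n0 *.
(* The factor 10 comes from the second estimate; one constant serves both. *)
apply: le_trans (_ : Num.sqrt (10 * bound_const r) / d * Num.sqrt n <= _); last first.
  by rewrite ler_wpM2r ?sqrtr_ge0// ler_wpM2r// invr_ge0 ltW.
have -> : Num.sqrt (10 * bound_const r) / d * Num.sqrt n =
    Num.sqrt (10 * bound_const r * (n / d ^+ 2)).
  by rewrite sqrt_scale// mulr_ge0.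
rewrite ler_sqrt; last by rewrite !mulr_ge0// invr_ge0 sqr_ge0.
apply: le_trans hQ _; rewrite Q0 mul0r addr0 ler_wpM2r//.
  by rewrite divr_ge0// sqr_ge0.
by rewrite ler_peMl// ler1n.
Qed.

Lemma le_nsq_norm c (f h : R -> R) : 0 <= c -> measurable_fun H f -> L2 h ->
  (forall x, 0 < x -> `|f x| <= c * `|h x|) ->
  L2 f /\ nsq f <= c ^+ 2 * nsq h.
Proof.
move=> c0 mf Lh fh; have Lf := L2_dom mf fh Lh; split => //.
apply: le_nsq => // x x0.
rewrite -[f x ^+ 2]real_normK ?num_real// -[h x ^+ 2]real_normK ?num_real//.
by rewrite -exprMn lerXn2r ?nnegrE ?mulr_ge0// fh.
Qed.

Lemma second_estimate (s : R) (f : R -> R) (C : R) : 0 < s -> s <= 1 ->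
  wdifferentiable f -> Num.sqrt (10 * bound_const r) <= C ->
  (l2norm (fun x => x `^ (1 - s) * wderiv f x)%R
   + l2norm (fun x => x `^ (- s) * f x)%R
   + l2norm (fun x => x `^ (1 - s) * (xibar r xi x * f x))%R < +oo)%E ->
  exists u : R -> R, is_inverse r xi b f u /\
    (Xxinorm r xi u <= (C / b `^ (1 + s))%:E *
     (l2norm (fun x => x `^ (1 - s) * wderiv f x)%R
      + l2norm (fun x => x `^ (- s) * f x)%R
      + l2norm (fun x => x `^ (1 - s) * (xibar r xi x * f x))%R))%E.
Proof.
move=> s0 s1 df hC foo; have s0' := ltW s0.
have wf := wderiv_is df; have [mf mg] := is_wderiv_meas wf.
set g := wderiv f in wf mg foo *.
have mA : measurable_fun H (fun x => x `^ (1 - s) * g x).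
  by apply: measurable_funM => //; exact: powR_meas.
have mB : measurable_fun H (fun x => x `^ (- s) * f x).
  by apply: measurable_funM => //; exact: powR_meas.
have mxf : measurable_fun H (fun x => xibar r xi x * f x).
  by apply: measurable_funM => //; exact: xibar_meas.
have mC : measurable_fun H (fun x => x `^ (1 - s) * (xibar r xi x * f x)).
  by apply: measurable_funM => //; exact: powR_meas.
have LA : L2 (fun x => x `^ (1 - s) * g x).
  apply: l2norm_lty => //; apply: le_lt_trans foo.
  by rewrite -addeA leeDl// adde_ge0// l2norm_ge0.
have LB : L2 (fun x => x `^ (- s) * f x).
  apply: l2norm_lty => //; apply: le_lt_trans foo.
  by rewrite addeAC leeDr// adde_ge0// l2norm_ge0.
have LC : L2 (fun x => x `^ (1 - s) * (xibar r xi x * f x)).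
  apply: l2norm_lty => //; apply: le_lt_trans foo.
  by rewrite leeDr// adde_ge0// l2norm_ge0.
have eb x : 0 < x -> _ := @eta_bounds R b s x b0 s0' s1.
set D := b `^ (1 - s) in eb; set E := b `^ (- s) in eb.
have D0 : 0 < D by rewrite powR_gt0.
have E0 : 0 < E by rewrite powR_gt0.
have aeta := eta_acp b.
have meta : measurable_fun H (eta b) := acp_meas aeta.
have mdeta : measurable_fun H (deta b) by case: aeta => -[].
have normp (x a : R) : `|x `^ a| = x `^ a by rewrite ger0_norm ?powR_ge0.
pose f1 x := (1 - eta b x) * f x.
pose q : (R -> R) * (R -> R) :=
  (fun x => eta b x * f x, fun x => deta b x * f x + g x * eta b x).
have [L1 N1] : L2 (fun x => x `^ 0 * f1 x) /\
    nsq (fun x => x `^ 0 * f1 x) <= E ^+ 2 * nsq (fun x => x `^ (- s) * f x).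
  apply: le_nsq_norm => //; first exact: ltW.
    apply: measurable_funM; first exact: powR_meas.
    by apply: measurable_funM => //; apply: measurable_funB.
  move=> x x0; have [/andP[h1 h2] _ _ _] := eb x x0.
  by rewrite powRr0 mul1r !normrM normp mulrA ler_wpM2r// ger0_norm.
have [Lq1 Nq1] : L2 (fdiv q) /\
    nsq (fdiv q) <= D ^+ 2 * nsq (fun x => x `^ (- s) * f x).
  apply: le_nsq_norm => //; first exact: ltW.
    by apply: div_meas; apply: measurable_funM.
  move=> x x0; have [_ /andP[h1 _] h3 _] := eb x x0.
  have -> : fdiv q x = eta b x / x * f x by rewrite /fdiv /q /= mulrAC.
  rewrite normrM [`|x `^ _ * _|]normrM normp mulrA ler_wpM2r//.
  by rewrite ger0_norm// divr_ge0// ltW.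
have [Lq2 Nq2] : L2 (fxb r xi q) /\ nsq (fxb r xi q) <=
    D ^+ 2 * nsq (fun x => x `^ (1 - s) * (xibar r xi x * f x)).
  apply: le_nsq_norm => //; first exact: ltW.
    apply: measurable_funM; first exact: xibar_meas.
    exact: measurable_funM.
  move=> x x0; have [_ /andP[h1 h2] _ _] := eb x x0.
  rewrite /fxb /q /= mulrCA normrM [`|x `^ _ * _|]normrM normp mulrA ler_wpM2r//.
  by rewrite ger0_norm.
have [Lq3 Nq3] : L2 (fun x => deta b x * f x) /\
    nsq (fun x => deta b x * f x) <= (2 * D) ^+ 2 * nsq (fun x => x `^ (- s) * f x).
  apply: le_nsq_norm => //; [by rewrite mulr_ge0// ltW|exact: measurable_funM|].
  move=> x x0; have [_ _ _ /andP[h1 h2]] := eb x x0.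
  rewrite normrM [`|x `^ _ * _|]normrM normp mulrA ler_wpM2r//.
  by rewrite ger0_norm// -mulrA.
have [Lq4 Nq4] : L2 (fun x => g x * eta b x) /\
    nsq (fun x => g x * eta b x) <= D ^+ 2 * nsq (fun x => x `^ (1 - s) * g x).
  apply: le_nsq_norm => //; [exact: ltW|exact: measurable_funM|].
  move=> x x0; have [_ /andP[h1 h2] _ _] := eb x x0.
  rewrite mulrC normrM [`|x `^ _ * _|]normrM normp mulrA ler_wpM2r//.
  by rewrite ger0_norm.
have aq : adm r xi q.
  by split => //; [exact: is_wderivM (acp_wderiv aeta) wf|exact: L2D].
have fE x : 0 < x -> f x = f1 x + q.1 x by move=> _; rewrite /f1 /q /=; ring.
(* The part f1 is used with exponent 0, hence the price b^-1; the decay b^-s is already in the bound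
   on its norm. *)
have [u [iu [Q uQ hQ]]] := inverse_split (lexx 0) ler01 L1 aq fE.
exists u; split => //; rewrite uQ !l2norm_sqrt// -!EFinD -EFinM lee_fin.
have B0 := bound_const_ge0.
set F := b `^ (1 + s); have F0 : 0 < F by rewrite powR_gt0.
set NA := nsq (fun x => _ * g x) in Nq4 *.
set NB := nsq (fun x => _ * f x) in N1 Nq1 Nq3 *.
set NC := nsq (fun x => _ * (_ * _)) in Nq2 *.
have NA0 : 0 <= NA by exact: nsq_ge0.
have NB0 : 0 <= NB by exact: nsq_ge0.
have NC0 : 0 <= NC by exact: nsq_ge0.
(* Here and in [Db] the two parts of the source turn out to carry the same power: -2s - 2 and 2(1-s)
   - 4 are both -2(1+s). *)
have Eb : E ^+ 2 / (b `^ (1 - 0)) ^+ 2 = (F ^+ 2)^-1.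
  rewrite subr0 powRr1; last exact: ltW.
  rewrite /E /F powRN powRD; last by apply/implyP => _; rewrite gt_eqF.
  by rewrite powRr1 ?ltW//; field; rewrite !gt_eqF ?powR_gt0.
have Db : D ^+ 2 / b ^+ 4 = (F ^+ 2)^-1.
  rewrite /D /F !powRD; try by apply/implyP => _; rewrite gt_eqF.
  by rewrite powRN powRr1 ?ltW//; field; rewrite !gt_eqF ?powR_gt0.
(* The product rule for eta f gives 2 NA + 8 NB, the 8 being twice the square of the 2 in the bound
   on [deta]; eta f / x adds one NB. The part f1 adds another NB below, whence the 10. *)
have hq : Qf r xi q <= D ^+ 2 * (2 * NA + 9 * NB + NC).
  have := nsqD Lq3 Lq4; rewrite /Qf -/(q.2) => h.
  have h' : nsq q.2 <= 8 * (D ^+ 2 * NB) + 2 * (D ^+ 2 * NA).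
    apply: le_trans h _; move: Nq3 Nq4; rewrite exprMn.
    by set k := D ^+ 2; lra.
  have := nsq_ge0 (fxb r xi q); move: h' Nq1 Nq2; rewrite !mulrDr.
  by set k := D ^+ 2; lra.
have hQ2 : Q <= 10 * bound_const r * ((F ^+ 2)^-1 * (NA + NB + NC)).
  apply: le_trans hQ _.
  apply: (@le_trans _ _ (bound_const r * ((F ^+ 2)^-1 * (2 * NA + 10 * NB + NC)))).
    rewrite ler_wpM2l//.
    have k1 : nsq (fun x => x `^ 0 * f1 x) / (b `^ (1 - 0)) ^+ 2 <= (F ^+ 2)^-1 * NB.
      by rewrite -Eb mulrAC ler_wpM2r// invr_ge0 sqr_ge0.
    have k2 : Qf r xi q / b ^+ 4 <= (F ^+ 2)^-1 * (2 * NA + 9 * NB + NC).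
      by rewrite -Db mulrAC ler_wpM2r// invr_ge0 exprn_ge0// ltW.
    by move: k1 k2; set k := (F ^+ 2)^-1; lra.
  have F2 : 0 <= (F ^+ 2)^-1 by rewrite invr_ge0 sqr_ge0.
  have -> : 10 * bound_const r * ((F ^+ 2)^-1 * (NA + NB + NC)) =
    bound_const r * ((F ^+ 2)^-1 * (10 * (NA + NB + NC))) by ring.
  by rewrite ler_wpM2l// ler_wpM2l//; lra.
set T := Num.sqrt NA + Num.sqrt NB + Num.sqrt NC.
have T0 : 0 <= T by rewrite !addr_ge0 ?sqrtr_ge0.
(* The cross terms of T^2 are nonnegative; this converts the sum of squared norms into the sum of
   norms in the statement. *)
have hT : NA + NB + NC <= T ^+ 2.
  have := sqr_sqrtr NA0; have := sqr_sqrtr NB0; have := sqr_sqrtr NC0.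
  have := sqrtr_ge0 NA; have := sqrtr_ge0 NB; have := sqrtr_ge0 NC.
  rewrite /T; set x := Num.sqrt NA; set y := Num.sqrt NB; set z := Num.sqrt NC.
  move=> z0 y0 x0 <- <- <-.
  have := mulr_ge0 x0 y0; have := mulr_ge0 x0 z0; have := mulr_ge0 y0 z0; nra.
apply: le_trans (_ : Num.sqrt (10 * bound_const r) / F * T <= _); last first.
  by rewrite ler_wpM2r// ler_wpM2r// invr_ge0 ltW.
have BB0 : 0 <= 10 * bound_const r by rewrite mulr_ge0.
have -> : Num.sqrt (10 * bound_const r) / F * T =
    Num.sqrt (10 * bound_const r * ((F ^+ 2)^-1 * T ^+ 2)).
  rewrite [_^-1 * _]mulrC -sqrt_scale ?sqr_ge0//.
  by rewrite [in RHS]sqrtr_sqr ger0_norm.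
rewrite ler_sqrt; last by rewrite mulr_ge0// mulr_ge0 ?invr_ge0 ?sqr_ge0.
apply: le_trans hQ2 _; rewrite ler_wpM2l// ler_wpM2l ?invr_ge0 ?sqr_ge0//.
Qed.

End estimates.

Theorem proposition7 (R : realType) (r : R) (hr : 0 < r) :
  exists C delta0 beta_star : R,
    [/\ 0 < C, 0 < delta0, 0 < beta_star &
      forall (xi : R -> R) (beta : R),
        in_X xi -> (Xnorm xi <= delta0%:E)%E ->
        0 < beta -> beta < beta_star ->
        (forall (s : R) (f : R -> R), 0 <= s -> s <= 1 ->
           measurable_fun (halfline R) f ->
           (l2norm (fun x => x `^ s * f x)%R < +oo)%E ->
           exists u : R -> R, is_inverse r xi beta f u /\
             (Xxinorm r xi u <=
              (C / beta `^ (1 - s))%:E * l2norm (fun x => x `^ s * f x)%R)%E)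
        /\
        (forall (s : R) (f : R -> R), 0 < s -> s <= 1 ->
           wdifferentiable f ->
           (l2norm (fun x => x `^ (1 - s) * wderiv f x)%R
            + l2norm (fun x => x `^ (- s) * f x)%R
            + l2norm (fun x => x `^ (1 - s) * (xibar r xi x * f x))%R
              < +oo)%E ->
           exists u : R -> R, is_inverse r xi beta f u /\
             (Xxinorm r xi u <=
              (C / beta `^ (1 + s))%:E *
              (l2norm (fun x => x `^ (1 - s) * wderiv f x)%R
               + l2norm (fun x => x `^ (- s) * f x)%R
               + l2norm (fun x => x `^ (1 - s) * (xibar r xi x * f x))%R))%E)].
Proof.
pose C := Num.sqrt (10 * bound_const r) + 1.
have C0 : 0 < C by rewrite ltr_wpDl// sqrtr_ge0.
have hC : Num.sqrt (10 * bound_const r) <= C by rewrite lerDl.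
exists C, 5^-1, 1; split => //.
move=> xi b Xxi hxi b0 _; have [mxi bxi] := small_sup Xxi hxi; split.
  by move=> s f s0 s1 mf foo; exact: first_estimate.
by move=> s f s0 s1 df foo; exact: second_estimate.
Qed.
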